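(* Let $D(t)\in\mathbb{C}[t]$ be a polynomial of even degree $2d>0$ which is not a square in $\mathbb{C}[t]$, and let $a_n(t)$ ($n\ge0$) be the partial quotients of the continued fraction expansion of $\sqrt{D(t)}\in\mathbb{C}((t^{-1}))$. Then $\deg a_n(t)\le d/2$ for all sufficiently large $n$, unless $D(t)=r(t)^2D^*(t)$ for polynomials $r,D^*\in\mathbb{C}[t]$ with $D^*$ Pellian of degree $>\frac32 d$. In particular, the bound $\deg a_n\le d/2$ for all large $n$ holds whenever $D$ is squarefree and not Pellian.
   Context: The continued fraction of $\lambda\in\mathbb{C}((t^{-1}))\setminus\mathbb{C}(t)$ is defined by $\lambda_0=\lambda$, $a_n=$ polynomial part of $\lambda_n$ (the unique polynomial with $\lambda_n-a_n$ of negative order in $t$), $\lambda_n=a_n+1/\lambda_{n+1}$. A polynomial $E(t)\in\mathbb{C}[t]$ of even degree, not a square, is called Pellian if the Pell equation $x(t)^2-E(t)y(t)^2=1$ has a solution in polynomials $x,y\in\mathbb{C}[t]$ with $y\neq0$. *)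

(* Defs.v *)
From HB Require Import structures.
From mathcomp Require Import all_boot all_order all_algebra.
From mathcomp Require Import boolp classical_sets fsbigop.
From mathcomp Require Import zify ring.

Set Implicit Arguments.
Unset Strict Implicit.
Unset Printing Implicit Defensive.

Import Order.TTheory GRing.Theory Num.Theory.

Local Open Scope ring_scope.

(* The field K((t^-1)): [f n] is the coefficient of t^n, and f has finitely
   many nonzero coefficients of positive index. *)
Record laurent (K : fieldType) := Laurent {
  lcoef :> int -> K;
  lcoef_bounded : exists N : int, forall n, N < n -> lcoef n = 0
}.

Section LaurentRing.
Variable K : fieldType.
Implicit Types (f g h : laurent K) (u v w : nat -> K) (M N n : int).

HB.instance Definition _ := gen_eqMixin (laurent K).
HB.instance Definition _ := gen_choiceMixin (laurent K).

Lemma laurentP f g : (forall n, f n = g n) <-> f = g.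
Proof.
split=> [|-> //]; case: f g => [f hf] [g hg] /= /funext fg.
by rewrite fg in hf *; congr Laurent; apply: Prop_irrelevance.
Qed.

Fact laurent0_subproof : exists N : int, forall n, N < n -> (0 : K) = 0.
Proof. by exists 0. Qed.
Definition laurent0 := Laurent laurent0_subproof.

Fact laurent_add_subproof f g :
  exists N : int, forall n, N < n -> f n + g n = 0.
Proof.
have [M hM] := lcoef_bounded f; have [N hN] := lcoef_bounded g.
by exists (Num.max M N) => n; rewrite gt_max => /andP[/hM-> /hN->]; rewrite addr0.
Qed.
Definition laurent_add f g := Laurent (laurent_add_subproof f g).

Fact laurent_opp_subproof f : exists N : int, forall n, N < n -> - f n = 0.
Proof. by have [M hM] := lcoef_bounded f; exists M => n /hM->; rewrite oppr0. Qed.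
Definition laurent_opp f := Laurent (laurent_opp_subproof f).

Fact laurent_addA : associative laurent_add.
Proof. by move=> f g h; apply/laurentP => n /=; rewrite addrA. Qed.
Fact laurent_addC : commutative laurent_add.
Proof. by move=> f g; apply/laurentP => n /=; rewrite addrC. Qed.
Fact laurent_add0 : left_id laurent0 laurent_add.
Proof. by move=> f; apply/laurentP => n /=; rewrite add0r. Qed.
Fact laurent_addN : left_inverse laurent0 laurent_opp laurent_add.
Proof. by move=> f; apply/laurentP => n /=; rewrite addNr. Qed.

HB.instance Definition _ := GRing.isZmodule.Build (laurent K)
  laurent_addA laurent_addC laurent_add0 laurent_addN.

(* For fixed n only finitely many terms of the convolution are nonzero. *)
Fact laurent_mul_subproof f g :
  exists N : int, forall n, N < n -> \sum_(i \in [set: int]) f i * g (n - i) = 0.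
Proof.
have [M hM] := lcoef_bounded f; have [N hN] := lcoef_bounded g.
exists (M + N) => n ltn; apply: fsbig1 => i _.
have [lti|lei] := ltP M i; first by rewrite hM ?mul0r.
by rewrite hN ?mulr0 //; lia.
Qed.
Definition laurent_mul f g := Laurent (laurent_mul_subproof f g).

Fact laurent1_subproof :
  exists N : int, forall n, N < n -> (n == 0)%:R = 0 :> K.
Proof. by exists 0 => n; case: eqP => // ->. Qed.
Definition laurent1 := Laurent laurent1_subproof.

(* The series t^M * \sum_k u k t^-k. *)
Definition psl M u n : K := if n <= M then u `|M - n|%N else 0.
Fact psl_subproof M u : exists N : int, forall n, N < n -> psl M u n = 0.
Proof. by exists M => n; rewrite /psl ltNge => /negbTE->. Qed.
Definition laurent_ps M u := Laurent (psl_subproof M u).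

Lemma laurent_psE f M : (forall n, M < n -> f n = 0) ->
  f = laurent_ps M (fun k => f (M - k%:Z)).
Proof.
move=> hM; apply/laurentP => n /=; rewrite /psl.
by case: leP => [le_n|/hM//]; congr (f _); lia.
Qed.

Definition conv u v k : K := \sum_(i < k.+1) u i * v (k - i)%N.

Lemma laurent_mul_ps M N u v :
  laurent_mul (laurent_ps M u) (laurent_ps N v) = laurent_ps (M + N) (conv u v).
Proof.
apply/laurentP => n; rewrite /= [RHS]/psl; case: ifPn => [len|ltn]; last first.
  apply: fsbig1 => i _; rewrite /psl.
  case: ifPn => hi; last by rewrite mul0r.
  by case: ifPn => hj; [lia|rewrite mulr0].
pose k := `|(M + N - n)%R|%N.
rewrite (fsbigE [seq M - j%:Z | j <- iota 0 k.+1]) //; first last.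
- move=> i _ /mapP hi; rewrite /psl.
  case: ifPn => hiM; last by rewrite mul0r.
  case: ifPn => hj; last by rewrite mulr0.
  by case: hi; exists `|M - i|%N; [rewrite mem_iota|]; lia.
- by rewrite map_inj_uniq ?iota_uniq // => i j; lia.
rewrite big_map (eq_bigl xpredT) => [|i]; last by rewrite in_setT.
rewrite -[iota 0 k.+1]/(index_iota 0 k.+1) big_mkord; apply: eq_bigr => i _.
have := ltn_ord i; rewrite ltnS => lik.
rewrite /psl !ifT; [|lia|lia].
by move: (nat_of_ord i) lik; rewrite {i}/k => i lik; congr (u _ * v _); lia.
Qed.

Definition trunc m u : {poly K} := \poly_(i < m.+1) u i.

Lemma conv_trunc m u v k : (k <= m)%N -> conv u v k = (trunc m u * trunc m v)`_k.
Proof.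
move=> lekm; rewrite coefM; apply: eq_bigr => i _; rewrite !coef_poly.
by rewrite !ifT //; have := ltn_ord i; lia.
Qed.

Lemma convA u v w : conv u (conv v w) = conv (conv u v) w.
Proof.
apply/funext => k; rewrite /conv.
transitivity ((trunc k u * (trunc k v * trunc k w))`_k).
  rewrite [RHS]coefM; apply: eq_bigr => i _; rewrite -/(conv v w _) (@conv_trunc k) ?leq_subr //.
  by rewrite coef_poly ltn_ord.
rewrite mulrA [LHS]coefM; apply: eq_bigr => i _; rewrite -/(conv u v _).
rewrite (@conv_trunc k); last by rewrite -ltnS.
by rewrite [(trunc k w)`__]coef_poly ltnS leq_subr.
Qed.

Lemma convC u v : conv u v = conv v u.
Proof. by apply/funext => k; rewrite !(@conv_trunc k) // mulrC. Qed.

Lemma conv1 u : conv (fun k => (k == 0)%N%:R) u = u.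
Proof.
apply/funext => k; rewrite /conv big_ord_recl /= mul1r subn0 big1 ?addr0 // => i _.
by rewrite mul0r.
Qed.

Lemma laurent_mulA : associative laurent_mul.
Proof.
move=> f g h; have [M hM] := lcoef_bounded f; have [N hN] := lcoef_bounded g.
have [P hP] := lcoef_bounded h.
rewrite (laurent_psE hM) (laurent_psE hN) (laurent_psE hP) !laurent_mul_ps.
by rewrite convA addrA.
Qed.

Lemma laurent_mulC : commutative laurent_mul.
Proof.
move=> f g; have [M hM] := lcoef_bounded f; have [N hN] := lcoef_bounded g.
rewrite (laurent_psE hM) (laurent_psE hN) !laurent_mul_ps.
by rewrite convC addrC.
Qed.

Lemma laurent1_ps : laurent1 = laurent_ps 0 (fun k => (k == 0)%N%:R).
Proof.
apply/laurentP => n; rewrite /= /psl; case: ifPn => hn.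
  by congr (nat_of_bool _)%:R; lia.
by case: eqP => // n0; rewrite n0 in hn.
Qed.

Lemma laurent_mul1 : left_id laurent1 laurent_mul.
Proof.
move=> f; have [M hM] := lcoef_bounded f.
by rewrite (laurent_psE hM) laurent1_ps laurent_mul_ps conv1 add0r.
Qed.

Lemma laurent_mulDl : left_distributive laurent_mul +%R.
Proof.
move=> f g h; have [M hM] := lcoef_bounded f; have [N hN] := lcoef_bounded g.
have [P hP] := lcoef_bounded h; set Q := Num.max M N.
have hf n : Q < n -> f n = 0 by rewrite gt_max => /andP[/hM].
have hg n : Q < n -> g n = 0 by rewrite gt_max => /andP[_ /hN].
rewrite (laurent_psE hf) (laurent_psE hg) (laurent_psE hP).
move: (fun k => f (Q - k%:Z)) => u; move: (fun k => g (Q - k%:Z)) => v.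
move: (fun k => h (P - k%:Z)) => w.
have -> : laurent_ps Q u + laurent_ps Q v = laurent_ps Q (fun k => u k + v k).
  by apply/laurentP => n /=; rewrite /psl; case: ifP => _ //; rewrite addr0.
rewrite !laurent_mul_ps; apply/laurentP => n; rewrite /= /psl.
case: ifP => _; last by rewrite addr0.
by rewrite -big_split /=; apply: eq_bigr => i _; rewrite mulrDl.
Qed.

Fact laurent1_neq0 : laurent1 != 0.
Proof. by apply/eqP => /laurentP /(_ 0) /eqP; rewrite /= oner_eq0. Qed.

HB.instance Definition _ := GRing.Zmodule_isComNzRing.Build (laurent K)
  laurent_mulA laurent_mulC laurent_mul1 laurent_mulDl laurent1_neq0.

Lemma laurent_topP f : f != 0 ->
  exists M, f M != 0 /\ (forall n, M < n -> f n = 0).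
Proof.
move=> f0; have [N hN] := lcoef_bounded f.
have ex : exists k : nat, f (N - k%:Z) != 0.
  apply: contrapT => nex; case/eqP: f0; apply/laurentP => n /=.
  have [/hN//|len] := ltP N n.
  apply/eqP; apply: contrapT => /negP fn; apply: nex; exists `|N - n|%N.
  by have -> : N - `|N - n|%N%:Z = n by lia.
case: (ex_minnP ex) => k fk mink; exists (N - k%:Z); split=> // n ltn.
have [/hN//|len] := ltP N n; apply/eqP; apply: contraT => fn.
suff : (k <= `|N - n|)%N by lia.
by apply: mink; have -> : N - `|N - n|%N%:Z = n by lia.
Qed.

Lemma exists_rec (Phi : nat -> (nat -> K) -> K) :
  (forall k u v, (forall i, (i < k)%N -> u i = v i) -> Phi k u = Phi k v) ->
  exists u, forall k, u k = Phi k u.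
Proof.
move=> ext; pose s k := iteri k (fun j r => rcons r (Phi j (nth 0 r))) [::].
have sz k : size (s k) = k by elim: k => //= k IH; rewrite size_rcons -/(s k) IH.
pose u k := nth 0 (s k.+1) k; have nths k i : (i < k)%N -> nth 0 (s k) i = u i.
  elim: k => // k IH; rewrite ltnS leq_eqVlt => /predU1P[->//|lik].
  by rewrite /= nth_rcons -/(s k) sz lik IH.
exists u => k; rewrite {1}/u /= nth_rcons -/(s k) sz ltnn eqxx.
by apply: ext => i /nths.
Qed.

Lemma conv_inv u : u 0%N != 0 ->
  exists v, conv v u = fun k => (k == 0)%N%:R.
Proof.
move=> u0.
have [|v hv] := @exists_rec
  (fun k v => ((k == 0)%N%:R - \sum_(i < k) v i * u (k - i)%N) / u 0%N).
  by move=> k v w vw; congr ((_ - _) / _); apply: eq_bigr => i _; rewrite vw.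
exists v; apply/funext => k; rewrite /conv big_ord_recr /= subnn [v k]hv.
by rewrite divfK // addrC subrK.
Qed.

Lemma laurent_inv_ex f : f != 0 -> exists g, g * f = 1.
Proof.
case/laurent_topP => M [fM hM].
have [|v hv] := @conv_inv (fun k => f (M - k%:Z)); first by rewrite subr0.
exists (laurent_ps (- M) v); rewrite {1}(laurent_psE hM).
by rewrite [LHS]laurent_mul_ps hv addNr [RHS]laurent1_ps.
Qed.

Definition laurent_inv f : laurent K := xget 0 [set g | g * f = 1]%classic.

Fact laurent_mulVf f : f != 0 -> laurent_inv f * f = 1.
Proof. by move=> /laurent_inv_ex; apply: xgetPex. Qed.

Fact laurent_inv0 : laurent_inv 0 = 0.
Proof.
rewrite /laurent_inv; case: xgetP => // g _ /= /eqP.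
by rewrite mulr0 eq_sym oner_eq0.
Qed.

HB.instance Definition _ :=
  GRing.ComNzRing_isField.Build (laurent K) laurent_mulVf laurent_inv0.

Lemma lcoefD f g n : (f + g) n = f n + g n. Proof. by []. Qed.
Lemma lcoefN f n : (- f) n = - f n. Proof. by []. Qed.
Lemma lcoefB f g n : (f - g) n = f n - g n. Proof. by []. Qed.
Lemma lcoef1 n : (1 : laurent K) n = (n == 0)%:R. Proof. by []. Qed.
Lemma lcoefM f g n : (f * g) n = \sum_(i \in [set: int]) f i * g (n - i).
Proof. by []. Qed.

End LaurentRing.

Section PolynomialPart.
Variable K : fieldType.
Implicit Types (f g : laurent K) (p q : {poly K}).

Fact poly_laurent_subproof p : exists N : int, forall n, N < n ->
  (if n is Posz m then p`_m else 0) = 0.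
Proof.
by exists (size p)%:Z => -[m|//]; rewrite ltz_nat => /ltnW; apply: nth_default.
Qed.
Definition poly_laurent p := Laurent (poly_laurent_subproof p).

Fact poly_laurent_is_zmod_morphism : zmod_morphism poly_laurent.
Proof.
by move=> p q; apply/laurentP => -[n|n]; rewrite lcoefB /= ?coefB ?subr0.
Qed.

Fact poly_laurent_is_monoid_morphism : monoid_morphism poly_laurent.
Proof.
split; first by apply/laurentP => -[n|n]; rewrite lcoef1 //= coef1.
move=> p q; apply/laurentP => n; rewrite lcoefM.
case: n => n; last first.
  rewrite fsbig1 // => i _; case: i => i /=; last by rewrite mul0r.
  by case E: (Negz n - Posz i) => [j|j]; [lia|rewrite mulr0].
rewrite (fsbigE [seq j%:Z | j <- iota 0 n.+1]) //; first last.
- move=> [i|i] _ /mapP hi /=; last by rewrite mul0r.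
  case E: (Posz n - Posz i) => [j|j]; last by rewrite mulr0.
  by case: hi; exists i => //; rewrite mem_iota; lia.
- by rewrite map_inj_uniq ?iota_uniq // => i j [].
rewrite big_map (eq_bigl xpredT) => [|i]; last by rewrite in_setT.
rewrite -[iota 0 n.+1]/(index_iota 0 n.+1) big_mkord.
rewrite [RHS](_ : _ = (p * q)`_n) // coefM.
apply: eq_bigr => i _; have := ltn_ord i; rewrite ltnS => lein.
by have -> : Posz n - Posz i = Posz (n - i) by lia.
Qed.
HB.instance Definition _ := GRing.isZmodMorphism.Build {poly K} (laurent K)
  poly_laurent poly_laurent_is_zmod_morphism.
HB.instance Definition _ := GRing.isMonoidMorphism.Build {poly K} (laurent K)
  poly_laurent poly_laurent_is_monoid_morphism.

Definition polypart f : {poly K} :=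
  \poly_(i < `|projT1 (cid (lcoef_bounded f))|.+1) f i%:Z.

Lemma coef_polypart f i : (polypart f)`_i = f i%:Z.
Proof.
rewrite coef_poly; case: cid => N hN /=.
by case: ltnP => // leNi; rewrite hN //; lia.
Qed.

Lemma polypartP f p :
  p = polypart f <-> (forall n, 0 <= n -> (f - poly_laurent p) n = 0).
Proof.
split=> [-> [n|//] _|h]; first by rewrite lcoefB /= coef_polypart subrr.
apply/polyP => i; rewrite coef_polypart; apply/esym/eqP.
by rewrite -subr_eq0; apply/eqP/(h i%:Z).
Qed.

End PolynomialPart.

Notation "p %:L" := (poly_laurent p) (at level 2, format "p %:L") : ring_scope.

Section ContinuedFraction.
Variable K : fieldType.
Implicit Types (x : laurent K).

(* As 0^-1 = 0, these are total; if x is not in K(t), then no inverse of zero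
   is ever taken. *)
Definition complete_quotient x n : laurent K :=
  iter n (fun y => (y - (polypart y)%:L)^-1) x.

Definition partial_quotient x n : {poly K} := polypart (complete_quotient x n).

Lemma complete_quotientS x n : complete_quotient x n =
  (partial_quotient x n)%:L + 1 / complete_quotient x n.+1.
Proof. by rewrite /= div1r invrK addrC subrK. Qed.

Definition squarefree (p : {poly K}) : Prop :=
  forall q, q ^+ 2 %| p -> size q = 1%N.

Definition is_square (p : {poly K}) : Prop := exists q, p = q ^+ 2.

Definition Pellian (E : {poly K}) : Prop :=
  [/\ ~~ odd (size E).-1, ~ is_square E &
      exists x y : {poly K}, y != 0 /\ x ^+ 2 - E * y ^+ 2 = 1].

End ContinuedFraction.

(* sqrt D exists in K((t^-1)) (it is then unique up to sign). *)
Lemma laurent_sqrt_ex (K : numClosedFieldType) (D : {poly K}) (d : nat) :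
  size D = (2 * d).+1 -> exists x : laurent K, x ^+ 2 = D%:L.
Proof.
move=> sD; have hD n : (2 * d)%:Z < n -> D%:L n = 0.
  by case: n => //= n hn; rewrite nth_default // sD; lia.
set w := fun k => D%:L ((2 * d)%:Z - k%:Z).
have w0 : w 0 != 0.
  by rewrite /w subr0 /= -[(2 * d)%N]/((2 * d).+1.-1) -sD -/(lead_coef D)
             lead_coef_eq0 -size_poly_eq0 sD.
pose c := sqrtC (w 0); have c0 : c != 0 by rewrite sqrtC_eq0.
have [|u hu] := @exists_rec _ (fun k u => if k is k'.+1 then
    (w k - \sum_(i < k') u i.+1 * u (k' - i)%N) / (2 * c) else c).
  case=> // k u v uv; congr ((_ - _) / _); apply: eq_bigr => i _.
  by rewrite !uv // ltnS ?leq_subr.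
exists (laurent_ps d%:Z u); rewrite expr2 (laurent_psE hD) -/w.
rewrite [LHS]laurent_mul_ps; congr laurent_ps; first by lia.
apply/funext => -[|k]; rewrite /conv.
  by rewrite big_ord_recl big_ord0 addr0 hu -expr2 sqrtCK.
have u0 : u 0%N = c by rewrite hu.
rewrite big_ord_recl big_ord_recr /= subn0 subnn u0 /bump /=.
under eq_bigr => i _ do rewrite add1n subSS.
rewrite add1n; set S := \sum_(i < k) _.
have -> : S = w k.+1 - u k.+1 * (2 * c).
  by rewrite hu -/S divfK ?mulf_neq0 ?pnatr_eq0 //; ring.
ring.
Qed.

(* Main.v *)
(** Write S for the square root of D and L for the field of Laurent series, and
    identify P + Q S with the pair (P + Q S, P - Q S) in L * L.  If deg a_n > d/2,
    the numerator and denominator of a convergent give a pair with degrees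
    bounded by d + M and - M - deg a_n; hence for at least d/2 consecutive n
    there is a nonzero pair with degrees at most n - 1 and d - 1 - n, that is,
    a certain n by n determinant tau_n vanishes.

    The coefficients of S lie in a ring A with finitely many classes modulo
    p^2 B, where B is a p-adically separated ring.  By finiteness, D has a Pell
    solution E modulo p^2 of some degree k > 0 and leading coefficient 1.
    Multiplication by E^j shows that on a class n = a + j k the sequence tau_n is,
    up to units and modulo each power of p, a polynomial in p j; so, as in the
    Skolem-Mahler-Lech theorem (in the style of Hansel), if it vanishes
    infinitely often on the class it vanishes identically there.

    Infinitely many large partial quotients thus give, for all j, a coprime pair
    phi_j with degrees at most a - 1 + j k and d - a - d/2 - j k, of norm N_j.
    Comparing degrees, phi_i phi_l and phi_m phi_n are proportional when
    i + l = m + n, so the N_j only have finitely many prime factors and, having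
    bounded degree, N_i and N_j agree up to a constant for some i < j.  The
    product of phi_j and the conjugate of phi_i, divided by N_i, has constant
    norm and is integral up to a denominator r with r^2 dividing both D and N_i:
    the quotient D / r^2 is Pellian, and deg r is small. *)

From HB Require Import structures.
Require Import Defs.
From mathcomp Require Import all_boot all_order all_algebra.
From mathcomp Require Import boolp classical_sets.
From mathcomp Require Import complex reals.
From mathcomp Require Import zify ring.

Set Implicit Arguments.
Unset Strict Implicit.
Unset Printing Implicit Defensive.

Import Order.TTheory GRing.Theory Num.Theory.
Local Open Scope ring_scope.
Arguments lcoef : simpl never.

(** * Laurent series *)

Section Subrings.
Variable K : fieldType.
Implicit Types (A U : K -> Prop) (x y : K).

(** A general D has no Pell solution over the field, so no unit acts on the pairs; a unit is
    available only in a finite quotient. The modulus is p^2 because in the expansion of (1 + p^2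
    w)^j one factor p^i absorbs i! and the other turns j into p j, for every p including 2. As E has
    norm v = 1 + p^2 w instead of 1, multiplication by powers of E and of its inverse relates the
    lattice {(P + Q S, P - Q S)} to one whose second component is twisted by a power of v; the
    twisted lattice still has a complement, given by a Neumann series in v - 1. Since B is only
    separated, series are truncated and equalities of determinants become divisibilities modulo p^N,
    with N arbitrary. The ideal of A cut out by p^2 B need not be prime: Pell solutions are found
    modulo prime ideals by Lagrange's argument and then glued. The bound 3/2 d arises thus: runs of
    length [d./2] give norms of degree at most s = d - [d./2] - 1 < d/2; as r^2 divides such a norm,
    D / r^2 has degree at least 2 d - s > 3/2 d. *)

Definition addgroup U := U 0 /\ forall x y, U x -> U y -> U (x - y).

Definition subring A :=
  [/\ A 1, forall x y, A x -> A y -> A (x - y) & forall x y, A x -> A y -> A (x * y)].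

Definition stable A U := addgroup U /\ forall x y, A x -> U y -> U (x * y).

Lemma addgroupN U x : addgroup U -> U x -> U (- x).
Proof. by move=> [U0 UB] Ux; rewrite -sub0r; apply: UB. Qed.

Lemma addgroupD U x y : addgroup U -> U x -> U y -> U (x + y).
Proof.
by move=> hU Ux Uy; rewrite -[y]opprK; apply: hU.2 => //; apply: addgroupN.
Qed.

Lemma addgroup_sum U (I : Type) (r : seq I) (P : pred I) (F : I -> K) :
  addgroup U -> (forall i, P i -> U (F i)) -> U (\sum_(i <- r | P i) F i).
Proof. by move=> hU hF; apply: big_ind => //; [case: hU|move=> *; apply: addgroupD]. Qed.

Lemma addgroupMn U x n : addgroup U -> U x -> U (x *+ n).
Proof.
by move=> hU Ux; elim: n => [|n IH]; rewrite ?mulrS; [case: hU|apply: addgroupD].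
Qed.

Lemma subring_addgroup A : subring A -> addgroup A.
Proof. by move=> [A1 AB AM]; split=> //; rewrite -(subrr 1); apply: AB. Qed.

Lemma subring_stable A : subring A -> stable A A.
Proof. by move=> hA; split; [exact: subring_addgroup|case: hA]. Qed.

Lemma subring_nat A n : subring A -> A n%:R.
Proof. by move=> hA; apply: addgroupMn; [exact: subring_addgroup|case: hA]. Qed.

Lemma subringX A x n : subring A -> A x -> A (x ^+ n).
Proof.
by move=> [A1 _ AM] Ax; elim: n => // n IH; rewrite exprS; apply: AM.
Qed.

Lemma subring_prod A (I : Type) (r : seq I) (P : pred I) (F : I -> K) :
  subring A -> (forall i, P i -> A (F i)) -> A (\prod_(i <- r | P i) F i).
Proof. by move=> [A1 AB AM] hF; apply: big_ind. Qed.

End Subrings.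

Section Laurent.
Variable K : fieldType.
Implicit Types (f g h : laurent K) (p q : {poly K}) (M N n m : int) (a : K).
Implicit Types (A U : K -> Prop).

Lemma lcoef_poly p (i : nat) : p%:L i%:Z = p`_i. Proof. by []. Qed.

Lemma lcoef_ps M (u : nat -> K) n : laurent_ps M u n = psl M u n.
Proof. by []. Qed.

(** Scalars act through constant polynomials; the series become a K-vector space, on which linear
    maps have matrices. *)
Definition lscale a f : laurent K := a%:P%:L * f.

Fact lscaleA a b f : lscale a (lscale b f) = lscale (a * b) f.
Proof. by rewrite /lscale mulrA -rmorphM polyCM. Qed.
Fact lscale1 : left_id 1 lscale.
Proof. by move=> f; rewrite /lscale rmorph1 mul1r. Qed.
Fact lscaleDr : right_distributive lscale +%R.
Proof. by move=> a f g; rewrite /lscale mulrDr. Qed.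
Fact lscaleDl f : {morph lscale^~ f : a b / a + b}.
Proof. by move=> a b; rewrite /lscale polyCD rmorphD mulrDl. Qed.

HB.instance Definition _ := GRing.Zmodule_isLmodule.Build K (laurent K)
  lscaleA lscale1 lscaleDr lscaleDl.

Lemma lscaleE a f : a *: f = a%:P%:L * f. Proof. by []. Qed.

Lemma lscaleAl a f g : a *: (f * g) = (a *: f) * g.
Proof. by rewrite !lscaleE mulrA. Qed.

Lemma lscaleAr a f g : a *: (f * g) = f * (a *: g).
Proof. by rewrite !lscaleE mulrCA. Qed.

Lemma lscale_poly a p : a *: p%:L = (a *: p)%:L.
Proof. by rewrite lscaleE -rmorphM mul_polyC. Qed.

Definition lord_le f n := forall m, n < m -> f m = 0.

Lemma lord_le_trans f n m : n <= m -> lord_le f n -> lord_le f m.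
Proof. by move=> nm hf k mk; apply: hf; apply: le_lt_trans mk. Qed.

Lemma lord_leD f g n : lord_le f n -> lord_le g n -> lord_le (f + g) n.
Proof. by move=> hf hg m nm; rewrite lcoefD hf ?hg ?addr0. Qed.

Lemma lord_leN f n : lord_le f n -> lord_le (- f) n.
Proof. by move=> hf m nm; rewrite lcoefN hf ?oppr0. Qed.

Lemma lord_leB f g n : lord_le f n -> lord_le g n -> lord_le (f - g) n.
Proof. by move=> hf hg; apply: lord_leD => //; apply: lord_leN. Qed.

Lemma lord_le_sum (I : Type) (r : seq I) (P : pred I) (F : I -> laurent K) n :
  (forall i, P i -> lord_le (F i) n) -> lord_le (\sum_(i <- r | P i) F i) n.
Proof.
move=> hF; apply: (big_ind (fun f => lord_le f n)) => // f g hf hg.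
exact: lord_leD.
Qed.

Lemma laurent_mulE f g M N : lord_le f M -> lord_le g N ->
  f * g = laurent_ps (M + N) (conv (fun k => f (M - k%:Z)) (fun k => g (N - k%:Z))).
Proof. by move=> hf hg; rewrite {1}(laurent_psE hf) {1}(laurent_psE hg) -laurent_mul_ps. Qed.

Lemma lord_leM f g M N : lord_le f M -> lord_le g N -> lord_le (f * g) (M + N).
Proof.
by move=> hf hg m; rewrite (laurent_mulE hf hg) lcoef_ps /psl ltNge => /negbTE ->.
Qed.

Lemma lcoefM_conv f g M N (k : nat) : lord_le f M -> lord_le g N ->
  (f * g) (M + N - k%:Z) = \sum_(i < k.+1) f (M - i%:Z) * g (N - (k - i)%N%:Z).
Proof.
move=> hf hg; rewrite (laurent_mulE hf hg) lcoef_ps /psl ifT; last by lia.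
have -> : `|(M + N - (M + N - k%:Z))%R|%N = k by lia.
by [].
Qed.

Lemma lcoefM_top f g M N : lord_le f M -> lord_le g N ->
  (f * g) (M + N) = f M * g N.
Proof.
move=> hf hg; have := lcoefM_conv 0 hf hg.
by rewrite big_ord_recl big_ord0 /= !subr0 !addr0.
Qed.

Lemma lcoefZ a f n : (a *: f) n = a * f n.
Proof.
have [N hN] := lcoef_bounded f.
have hP : lord_le a%:P%:L 0 by case=> [[|m]|m] // _; rewrite lcoef_poly coefC.
have [lt|le] := ltP N n; first by rewrite hN // mulr0 (lord_leM hP hN) // add0r.
have -> : n = 0 + N - `|N - n|%N%:Z by lia.
rewrite lscaleE (lcoefM_conv _ hP hN) big_ord_recl big1 ?addr0 => [|i _].
  congr (_ * f _); last by rewrite /=; lia.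
  by transitivity (a%:P%:L 0%N%:Z); [congr lcoef|rewrite lcoef_poly coefC].
by rewrite [X in X * _](_ : _ = 0) ?mul0r //; case: i => i hi; rewrite /= sub0r.
Qed.

Lemma lord_leZ a f n : lord_le f n -> lord_le (a *: f) n.
Proof. by move=> hf m nm; rewrite lcoefZ hf ?mulr0. Qed.

Lemma lord_le1 : lord_le 1 0.
Proof. by move=> n n0; rewrite lcoef1; case: eqP n0 => // ->. Qed.

Lemma lord_leX f n (k : nat) : lord_le f n -> lord_le (f ^+ k) (n *+ k).
Proof.
move=> hf; elim: k => [|k IH]; first by rewrite expr0 mulr0n; apply: lord_le1.
by rewrite exprS mulrS; apply: lord_leM.
Qed.

Lemma lcoefX_top f n (k : nat) : lord_le f n -> (f ^+ k) (n *+ k) = f n ^+ k.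
Proof.
move=> hf; elim: k => [|k IH]; first by rewrite !expr0 mulr0n lcoef1.
by rewrite !exprS mulrS lcoefM_top // ?IH //; apply: lord_leX.
Qed.

Lemma lord_le_poly p (n : nat) : (size p <= n.+1)%N -> lord_le p%:L n.
Proof.
move=> sp; case=> [m|//]; rewrite ltz_nat => nm.
by rewrite lcoef_poly nth_default //; apply: leq_trans sp nm.
Qed.

Lemma poly_lord_le p (n : nat) : lord_le p%:L n -> (size p <= n.+1)%N.
Proof. by move=> hp; apply/leq_sizeP => j nj; apply: (hp j%:Z). Qed.

Lemma poly_lord_lt0 p n : n < 0 -> lord_le p%:L n -> p = 0.
Proof.
move=> n0 hp; apply/polyP => i; rewrite coef0; apply: (hp i%:Z).
by apply: lt_le_trans n0 _.
Qed.

Lemma lpoly_inj : injective (@poly_laurent K).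
Proof.
move=> p q pq; apply/polyP => i.
by have := congr1 (fun f : laurent K => f i%:Z) pq.
Qed.

Lemma lpoly_eq0 p : (p%:L == 0) = (p == 0).
Proof. by rewrite -(inj_eq lpoly_inj) rmorph0. Qed.

Definition lcoefs U f := forall n, U (f n).

Lemma lcoefs0 U : addgroup U -> lcoefs U 0. Proof. by move=> [U0 _] n. Qed.

Lemma lcoefsD U f g : addgroup U -> lcoefs U f -> lcoefs U g -> lcoefs U (f + g).
Proof. by move=> hU hf hg n; rewrite lcoefD; apply: addgroupD. Qed.

Lemma lcoefsN U f : addgroup U -> lcoefs U f -> lcoefs U (- f).
Proof. by move=> hU hf n; rewrite lcoefN; apply: addgroupN. Qed.

Lemma lcoefsB U f g : addgroup U -> lcoefs U f -> lcoefs U g -> lcoefs U (f - g).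
Proof. by move=> hU hf hg; apply: lcoefsD => //; apply: lcoefsN. Qed.

Lemma lcoefs_sum U (I : Type) (r : seq I) (P : pred I) (F : I -> laurent K) :
  addgroup U -> (forall i, P i -> lcoefs U (F i)) ->
  lcoefs U (\sum_(i <- r | P i) F i).
Proof.
move=> hU hF; apply: (big_ind (lcoefs U)) => //; first exact: lcoefs0.
by move=> f g hf hg; apply: lcoefsD.
Qed.

Lemma lcoefsM A U f g : stable A U -> lcoefs A f -> lcoefs U g -> lcoefs U (f * g).
Proof.
move=> [hU AU] hf hg n; have [M hM] := lcoef_bounded f.
have [N hN] := lcoef_bounded g.
rewrite (laurent_mulE hM hN) lcoef_ps /psl; case: ifP => _; last by case: hU.
by apply: addgroup_sum => // i _; apply: AU.
Qed.

Lemma lcoefsZ A U a f : stable A U -> A a -> lcoefs U f -> lcoefs U (a *: f).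
Proof. by move=> [_ AU] Aa hf n; rewrite lcoefZ; apply: AU. Qed.

Lemma lcoefs1 A : subring A -> lcoefs A 1.
Proof. by move=> hA n; rewrite lcoef1; apply: subring_nat. Qed.

Lemma lcoefsX A f (k : nat) : subring A -> lcoefs A f -> lcoefs A (f ^+ k).
Proof.
move=> hA hf; elim: k => [|k IH]; first by rewrite expr0; apply: lcoefs1.
by rewrite exprS; apply: lcoefsM (subring_stable hA) hf IH.
Qed.

Lemma lcoefs_poly U p : U 0 -> (forall i, U p`_i) -> lcoefs U p%:L.
Proof. by move=> U0 hp [n|n]; [apply: hp|apply: U0]. Qed.

Lemma lcoefs_polyE U p i : lcoefs U p%:L -> U p`_i.
Proof. by move=> /(_ i%:Z). Qed.

Lemma lcoefs_polypart U f : lcoefs U f -> forall i, U (polypart f)`_i.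
Proof. by move=> hf i; rewrite coef_polypart. Qed.

Lemma polypartD f g : polypart (f + g) = polypart f + polypart g.
Proof. by apply/polyP => i; rewrite coefD !coef_polypart. Qed.

Lemma polypartZ a f : polypart (a *: f) = a *: polypart f.
Proof. by apply/polyP => i; rewrite coefZ !coef_polypart lcoefZ. Qed.

Lemma polypart_poly p : polypart p%:L = p.
Proof. by apply/polyP => i; rewrite coef_polypart. Qed.

Lemma lord_le_polypart f : lord_le (f - (polypart f)%:L) (-1).
Proof. by move=> n n0; apply: (iffLR (polypartP f _)) => //; lia. Qed.

Lemma polypart_neg f : lord_le f (-1) -> polypart f = 0.
Proof. by move=> hf; apply/polyP => i; rewrite coef_polypart coef0 hf. Qed.

Lemma lord_leV f M : lord_le f M -> f M != 0 -> lord_le f^-1 (- M).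
Proof.
move=> hf fM; have f0 : f != 0 by apply: contraNneq fM => ->.
have [N [fN hN]] : exists N, (f^-1) N != 0 /\ lord_le f^-1 N.
  by apply: laurent_topP; rewrite invr_eq0.
have := lcoefM_top hf hN; rewrite divff // lcoef1.
case: eqP => [MN _|_ /eqP]; last by rewrite eq_sym mulf_eq0 (negbTE fM) (negbTE fN).
by have <- : N = - M by lia.
Qed.

Lemma lcoefV_top f M : lord_le f M -> f M != 0 -> (f^-1) (- M) = (f M)^-1.
Proof.
move=> hf fM; have f0 : f != 0 by apply: contraNneq fM => ->.
have := lcoefM_top hf (lord_leV hf fM); rewrite divff // lcoef1 subrr eqxx => e.
by apply: (mulfI fM); rewrite -e divff.
Qed.

(** Solving f * f^-1 = 1 degree by degree downwards divides only by the leading coefficient of f. *)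
Lemma lcoefsV A f M : subring A -> lcoefs A f -> lord_le f M -> f M != 0 ->
  A (f M)^-1 -> lcoefs A f^-1.
Proof.
move=> hA Af hf fM Ai; have f0 : f != 0 by apply: contraNneq fM => ->.
have hV := lord_leV hf fM; have AG := subring_addgroup hA.
have [A1 AB AM] := hA.
suff H (k : nat) : A ((f^-1) (- M - k%:Z)).
  move=> n; have [lt|le] := ltP (- M) n; first by rewrite hV //; case: AG.
  by have -> : n = - M - `|- M - n|%N%:Z by lia.
elim/ltn_ind: k => -[|k] IH; first by rewrite subr0 lcoefV_top.
have := lcoefM_conv k.+1 hf hV; rewrite divff // lcoef1.
rewrite (_ : _ == 0 = false); last by lia.
rewrite big_ord_recl subr0 subn0 => /esym/eqP; rewrite addr_eq0 => /eqP e.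
rewrite -[X in A X](mulKf fM) e; apply: (AM) => //.
apply: addgroupN => //; apply: addgroup_sum => // i _; apply: AM => //.
apply: IH => /=; rewrite /bump /=; have := ltn_ord i; lia.
Qed.

Definition lmon m : laurent K :=
  Laurent (ex_intro (fun N => forall n, N < n -> (n == m)%:R = 0 :> K) m
    (fun n (h : m < n) => congr1 (fun b : bool => b%:R : K) (gt_eqF h))).

Lemma lcoef_mon m n : lmon m n = (n == m)%:R. Proof. by []. Qed.

Lemma lord_le_mon m : lord_le (lmon m) m.
Proof. by move=> n hn; rewrite lcoef_mon gt_eqF. Qed.

Lemma lcoefs_mon A m : subring A -> lcoefs A (lmon m).
Proof. by move=> hA n; apply: subring_nat. Qed.

Lemma lmon_poly (i : nat) : lmon i = ('X^i)%:L.
Proof. by apply/laurentP => -[n|n] //; rewrite lcoef_poly coefXn. Qed.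

Lemma lord_le_sub_mon f M (n : nat) : lord_le f M ->
  lord_le (f - \sum_(l < n) f (M - l%:Z) *: lmon (M - l%:Z)) (M - n%:Z).
Proof.
move=> hf m hm; rewrite lcoefB.
have -> (F : 'I_n -> laurent K) k : (\sum_l F l) k = \sum_l F l k.
  by elim/big_rec2: _ => // i x y _ <-.
have [lt|le] := ltP M m.
  rewrite hf // big1 ?subr0 // => l _; rewrite lcoefZ lcoef_mon.
  by case: eqP => [e|_]; [lia|rewrite mulr0].
have lt : (`|M - m|%N < n)%N by lia.
rewrite (bigD1 (Ordinal lt)) //= big1 => [|l /negP ne]; last first.
  rewrite lcoefZ lcoef_mon; case: eqP => [e|_]; last by rewrite mulr0.
  by case: ne; apply/eqP/val_inj => /=; lia.
rewrite lcoefZ lcoef_mon; have -> : M - `|M - m|%N%:Z = m by lia.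
by rewrite eqxx mulr1 addr0 subrr.
Qed.

End Laurent.

(** * Subrings and p-adic frames *)

Section PolyCoefs.
Variable K : fieldType.
Implicit Types (A U F : K -> Prop) (f g h m : {poly K}).

Definition pcoefs U f := forall i, U f`_i.

Lemma pcoefs0 U : U 0 -> pcoefs U 0. Proof. by move=> U0 i; rewrite coef0. Qed.

Lemma pcoefsD U f g : addgroup U -> pcoefs U f -> pcoefs U g -> pcoefs U (f + g).
Proof. by move=> hU hf hg i; rewrite coefD; apply: addgroupD. Qed.

Lemma pcoefsN U f : addgroup U -> pcoefs U f -> pcoefs U (- f).
Proof. by move=> hU hf i; rewrite coefN; apply: addgroupN. Qed.

Lemma pcoefsB U f g : addgroup U -> pcoefs U f -> pcoefs U g -> pcoefs U (f - g).
Proof. by move=> hU hf hg; apply: pcoefsD => //; apply: pcoefsN. Qed.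

Lemma pcoefs_sum U (I : Type) (r : seq I) (P : pred I) (G : I -> {poly K}) :
  addgroup U -> (forall i, P i -> pcoefs U (G i)) ->
  pcoefs U (\sum_(i <- r | P i) G i).
Proof. by move=> hU hG i; rewrite coef_sum; apply: addgroup_sum => // j /hG. Qed.

Lemma pcoefsM A U f g : stable A U -> pcoefs A f -> pcoefs U g -> pcoefs U (f * g).
Proof.
move=> [hU AU] hf hg i; rewrite coefM; apply: addgroup_sum => // j _; exact: AU.
Qed.

Lemma pcoefsZ A U a f : stable A U -> A a -> pcoefs U f -> pcoefs U (a *: f).
Proof. by move=> [_ AU] Aa hf i; rewrite coefZ; apply: AU. Qed.

Lemma pcoefsC U a : U 0 -> U a -> pcoefs U a%:P.
Proof. by move=> U0 Ua i; rewrite coefC; case: ifP. Qed.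

Lemma pcoefsXn A n : subring A -> pcoefs A 'X^n.
Proof. by move=> hA i; rewrite coefXn; apply: subring_nat. Qed.

Lemma pcoefs_X A : subring A -> pcoefs A 'X.
Proof. by move=> hA i; rewrite coefX; apply: subring_nat. Qed.

Lemma pcoefs1 A : subring A -> pcoefs A 1.
Proof. by move=> hA i; rewrite coef1; apply: subring_nat. Qed.

Lemma pcoefsX A f n : subring A -> pcoefs A f -> pcoefs A (f ^+ n).
Proof.
move=> hA hf; elim: n => [|n IH]; first by rewrite expr0; apply: pcoefs1.
by rewrite exprS; apply: pcoefsM (subring_stable hA) hf IH.
Qed.

Lemma pcoefs_comp A f g : subring A -> pcoefs A f -> pcoefs A g -> pcoefs A (f \Po g).
Proof.
move=> hA hf hg; rewrite comp_polyE; apply: pcoefs_sum => [|i _].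
  exact: subring_addgroup.
by apply: pcoefsZ (subring_stable hA) (hf i) _; apply: pcoefsX.
Qed.

Lemma pcoefs_horner A U f x : stable A U -> subring A -> A x -> pcoefs U f -> U f.[x].
Proof.
move=> [hU AU] hA Ax hf; rewrite horner_coef; apply: addgroup_sum => // i _.
by rewrite mulrC; apply: AU => //; apply: subringX.
Qed.

(** A monic divisor costs no division of coefficients, so Euclidean division stays inside A. *)
Lemma pcoefs_division A m f : subring A -> m \is monic -> pcoefs A m -> pcoefs A f ->
  exists u r, [/\ pcoefs A u, pcoefs A r, f = u * m + r & (size r < size m)%N].
Proof.
move=> hA mm hm; have AG := subring_addgroup hA; have AS := subring_stable hA.
have m0 : (0 < size m)%N by rewrite size_poly_gt0 monic_neq0.
move: {2}(size f) (leqnn (size f)) => n; elim: n f => [|n IH] f sf hf.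
  have hz : pcoefs A 0 by apply: pcoefs0; case: AG.
  exists 0, 0; rewrite mul0r add0r size_poly0; split=> //.
  by apply/eqP; rewrite -size_poly_leq0.
have [lt|le] := ltnP (size f) (size m).
  by exists 0, f; rewrite mul0r add0r; split=> //; apply: pcoefs0; case: AG.
pose c := lead_coef f *: 'X^(size f - size m).
have hc : pcoefs A c by apply: pcoefsZ AS (hf _) _; apply: pcoefsXn.
have [||u [r [hu hr e sr]]] := IH (f - c * m).
- have f0 : f != 0 by rewrite -size_poly_gt0; apply: leq_trans le.
  have c0 : c != 0 by rewrite scaler_eq0 lead_coef_eq0 (negbTE f0) -size_poly_eq0 size_polyXn.
  have sc : size (c * m) = size f.
    by rewrite size_Mmonic // size_scale ?lead_coef_eq0 // size_polyXn addSn subnK.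
  have : (size (f - c * m)%R <= (size f).-1)%N; last by lia.
  apply/leq_sizeP => j lej; rewrite coefB.
  have [/eqP je|ne] := boolP (j == (size f).-1)%N; last first.
    have lt : (size f <= j)%N.
      by move: lej; rewrite leq_eqVlt eq_sym (negbTE ne) /= prednK // size_poly_gt0.
    by rewrite !nth_default ?subrr // sc.
  have -> : f`_j = lead_coef f by rewrite je.
  have -> : (c * m)`_j = lead_coef (c * m) by rewrite lead_coefE sc je.
  by rewrite lead_coef_Mmonic // lead_coefZ lead_coefXn mulr1 subrr.
- by apply: pcoefsB => //; apply: pcoefsM AS hc hm.
exists (u + c), r; split=> //; first exact: pcoefsD.
by rewrite mulrDl addrAC -e subrK.
Qed.

End PolyCoefs.

Section Frames.
Variable K : numClosedFieldType.
Implicit Types (A B U F : K -> Prop) (f g h m : {poly K}) (p : nat) (x y z : K).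

Definition pmul p B N x := exists2 b, B b & x = p%:R ^+ N * b.

(** What is kept of the p-adic integers: integers prime to p are invertible and the ideals p^N B
    intersect in 0. Working modulo every p^N takes the place of completeness. *)
Definition padic p B := [/\ subring B, forall n, coprime p n -> B n%:R^-1 &
  forall b, (forall N, pmul p B N b) -> b = 0].

Definition subfield F := subring F /\ forall x, F x -> F x^-1.

(* Elementary substitute for embedding a finitely generated ring into a p-adic
   field: A plays the role of the ring and B of the p-adic integers. *)
Definition framed F (Z : seq K) := exists p A B, [/\ prime p, subring A & padic p B] /\
  [/\ forall x, A x -> B x, forall x, B x -> F x, forall z, z \in Z -> A z &
      exists L : seq K, forall x, A x -> exists2 y, y \in L & A y /\ pmul p B 2 (x - y)].

(** Quantifying over all finite lists lets the induction on generators enlarge the list, by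
    coefficients and inverses of values, before it calls its hypothesis. *)
Definition framable F := forall Z : seq K, (forall z, z \in Z -> F z) -> framed F Z.

Lemma pmul_stable p B N : subring B -> stable B (pmul p B N).
Proof.
move=> hB; have [B0 BB] := subring_addgroup hB; have [B1 _ BM] := hB.
split; first split; first by exists 0; rewrite ?mulr0.
  by move=> _ _ [x Bx ->] [y By ->]; exists (x - y); rewrite ?mulrBr //; apply: BB.
by move=> x _ Bx [y By ->]; exists (x * y); [apply: BM|rewrite mulrCA].
Qed.

Lemma pmul_le p B N M x : subring B -> (M <= N)%N -> pmul p B N x -> pmul p B M x.
Proof.
move=> hB le [b Bb ->]; exists (p%:R ^+ (N - M) * b); last first.
  by rewrite mulrA -exprD subnKC.
by case: (hB) => _ _; apply => //; apply: subringX => //; apply: subring_nat.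
Qed.

Lemma pmulM p B N M x y : subring B -> pmul p B N x -> pmul p B M y ->
  pmul p B (N + M) (x * y).
Proof.
move=> hB [b Bb ->] [c Bc ->]; exists (b * c); last by rewrite exprD; ring.
by case: hB => _ _; apply.
Qed.

Lemma pmul0 p B x : pmul p B 0 x <-> B x.
Proof. by split=> [[b Bb ->]|Bx]; [|exists x => //]; rewrite expr0 mul1r. Qed.

Lemma pnat_neq0 p : prime p -> (p%:R : K) != 0.
Proof. by move=> pp; rewrite pnatr_eq0; case: p pp. Qed.

Definition rationals x := exists r : rat, x = ratr r.

(** The localisation of the integers at p. *)
Definition plocal p x := exists (a : int) (n : nat), coprime p n /\ x = a%:~R / n%:R.

Lemma coprime_natr_neq0 p n : prime p -> coprime p n -> (n%:R : K) != 0.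
Proof.
by move=> pp; rewrite pnatr_eq0; case: n => //; rewrite /coprime gcdn0; case: p pp => [|[]].
Qed.

Lemma plocal_padic p : prime p -> padic p (plocal p).
Proof.
move=> pp; split.
- split; first by exists 1, 1%N; rewrite coprimen1 divr1.
    move=> _ _ [a [n [cn ->]]] [b [m [cm ->]]].
    exists (a * m%:Z - b * n%:Z), (n * m)%N; rewrite coprimeMr cn cm; split=> //.
    rewrite natrM rmorphB !rmorphM /= -!pmulrn; field.
    by rewrite !(coprime_natr_neq0 pp).
  move=> _ _ [a [n [cn ->]]] [b [m [cm ->]]].
  exists (a * b), (n * m)%N; rewrite coprimeMr cn cm; split=> //.
  by rewrite natrM rmorphM /= invfM; ring.
- by move=> n cn; exists 1, n; split=> //; rewrite mul1r.
move=> x hx; have [y [a [n [cn yE]]]] := hx 0%N; rewrite expr0 mul1r {y}yE => xE.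
have [a00|a0] := eqVneq a 0; first by rewrite xE a00 mul0r.
have dv N : (p ^ N %| `|a|)%N.
  have [_ [b [m [cm ->]]]] := hx N; rewrite xE.
  have n0 := coprime_natr_neq0 pp cn; have m0 := coprime_natr_neq0 pp cm.
  move=> /(congr1 (fun y => y * (n%:R * m%:R))) e.
  have {}e : a * m%:Z = p%:Z ^+ N * b * n%:Z.
    apply: (@intr_inj K); rewrite !rmorphM rmorphXn /= -!pmulrn.
    transitivity (a%:~R / n%:R * (n%:R * m%:R) : K); first by field.
    by rewrite e; field.
  have := congr1 absz e; rewrite !abszM abszX !absz_nat => {}e.
  have cpm : coprime (p ^ N) m by rewrite coprimeXl.
  by rewrite -(Gauss_dvdl _ cpm) e -mulnA dvdn_mulr.
have := dvdn_leq _ (dv `|a|%N); rewrite absz_gt0 => /(_ a0).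
by rewrite leqNgt ltn_expl // prime_gt1.
Qed.

Lemma plocal_finite p x : prime p -> plocal p x ->
  exists2 i, (i < p ^ 2)%N & pmul p (plocal p) 2 (x - i%:R).
Proof.
move=> pp [a [n [cn ->]]]; have n0 := coprime_natr_neq0 pp cn.
have cpn : coprime (p ^ 2) n by rewrite coprimeXl.
have p2 : (0 < p ^ 2)%N by rewrite expn_gt0 prime_gt0.
have [u uE] : exists u : int, ((u * n%:Z) = 1 %[mod (p ^ 2)%N])%Z.
  have : coprimez (p ^ 2)%N n by [].
  case/coprimezP => -[s t] /= e; exists t; rewrite -e.
  by rewrite -modzDml modzMl add0r.
pose i := `|((a * u) %% (p ^ 2)%N)%Z|%N.
have iE : i%:Z = ((a * u) %% (p ^ 2)%N)%Z.
  by rewrite /i gez0_abs // modz_ge0 //; lia.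
exists i.
  by rewrite -ltz_nat iE ltz_pmod.
have : ((p ^ 2)%N %| a - i%:Z * n%:Z)%Z.
  rewrite -eqz_mod_dvd iE modzMml -mulrA -modzMmr uE modzMmr mulr1.
  by apply/eqP.
case/dvdzP => b e; exists (b%:~R / n%:R); first by exists b, n.
have {}e : a%:~R - i%:R * n%:R = b%:~R * p%:R ^+ 2 :> K.
  have := congr1 (fun c : int => c%:~R : K) e.
  by rewrite rmorphB !rmorphM /= -!pmulrn expr2.
rewrite mulrA [_ ^+ 2 * _]mulrC -e; field.
by rewrite n0.
Qed.

Lemma framable_rationals : framable rationals.
Proof.
move=> Z hZ.
have /choice [r rE] : forall z, exists q : rat, z \in Z -> z = ratr q.
  by move=> z; have [/hZ [q ->]|] := boolP (z \in Z); [exists q|exists 0].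
(* p exceeds the product of all denominators, hence is prime to each of them. *)
have [p pl pp] := prime_above (\prod_(z <- Z) `|denq (r z)|)%N.
have cden z : z \in Z -> coprime p `|denq (r z)|.
  move=> zZ; rewrite prime_coprime //; apply/negP => /dvdn_leq.
  rewrite absz_gt0 denq_neq0 => /(_ isT); rewrite leqNgt => /negP; apply.
  apply: leq_ltn_trans pl; apply: dvdn_leq.
    by rewrite prodn_gt0 // => y; rewrite absz_gt0 denq_neq0.
  by rewrite (big_rem z) //= dvdn_mulr.
exists p, (plocal p), (plocal p); have pB := plocal_padic pp.
split; first by split=> //; case: pB.
split=> //.
- move=> _ [a [n [_ ->]]]; exists (a%:~R / n%:R).
  by rewrite rmorphM fmorphV /= ratr_int ratr_nat.
- move=> z zZ; exists (numq (r z)), `|denq (r z)|%N; split; first exact: cden.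
  rewrite {1}(rE _ zZ) /ratr; congr (_ / _).
  by rewrite -[in LHS](absz_denq (r z)).
exists [seq i%:R | i <- iota 0 (p ^ 2)] => x hx.
have [i ip hi] := plocal_finite pp hx; exists i%:R => //.
  by apply/mapP; exists i; rewrite ?mem_iota.
by split=> //; apply: subring_nat; case: pB.
Qed.

End Frames.

(** * Frames over a transcendental extension *)

Section Adjunction.
Variable K : numClosedFieldType.
Implicit Types (A B U F : K -> Prop) (f g h m : {poly K}) (p : nat) (x y z : K).

Definition adjoin F z x := exists f g, [/\ pcoefs F f, pcoefs F g, g.[z] != 0 &
  x = f.[z] / g.[z]].

Lemma adjoin_subfield F z : subfield F -> subfield (adjoin F z).
Proof.
move=> [hF FV]; have FG := subring_addgroup hF; have FS := subring_stable hF.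
have h1 := pcoefs1 hF; split; first split.
- by exists 1, 1; rewrite hornerC oner_eq0 divr1.
- move=> _ _ [f [g [hf hg g0 ->]]] [f' [g' [hf' hg' g0' ->]]].
  exists (f * g' - f' * g), (g * g'); split.
  + by apply: pcoefsB => //; apply: (pcoefsM FS).
  + exact: (pcoefsM FS).
  + by rewrite hornerM mulf_neq0.
  + by rewrite hornerD hornerN !hornerM; field; rewrite g0 g0'.
- move=> _ _ [f [g [hf hg g0 ->]]] [f' [g' [hf' hg' g0' ->]]].
  exists (f * f'), (g * g'); split; try exact: (pcoefsM FS).
  + by rewrite hornerM mulf_neq0.
  + by rewrite !hornerM; field; rewrite g0 g0'.
move=> _ [f [g [hf hg g0 ->]]]; have [f0|f0] := eqVneq f.[z] 0.
  exists 0, 1; rewrite hornerC oner_eq0 horner0 f0 !mul0r invr0.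
  by split=> //; apply: pcoefs0; case: FG.
by exists g, f; split=> //; rewrite invfM invrK mulrC.
Qed.

Lemma adjoin_sub F z x : subring F -> F x -> adjoin F z x.
Proof.
move=> hF Fx; exists x%:P, 1; rewrite !hornerC oner_eq0 divr1; split=> //.
  by apply: pcoefsC => //; case: (subring_addgroup hF).
exact: pcoefs1.
Qed.

Lemma adjoin_gen F z : subring F -> adjoin F z z.
Proof.
move=> hF; exists 'X, 1; rewrite hornerX hornerC oner_eq0 divr1.
by split=> //; [apply: pcoefs_X|apply: pcoefs1].
Qed.

Lemma exists_nat_nonroot f : f != 0 -> exists n : nat, f.[n%:R] != 0.
Proof.
move=> f0; pose rs := [seq n%:R : K | n <- iota 0 (size f)].
have : ~~ all (root f) rs.
  apply/negP => ar; have := max_poly_roots f0 ar.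
  rewrite map_inj_uniq ?iota_uniq => [/(_ isT)|i j /eqP].
    by rewrite size_map size_iota ltnn.
  by rewrite eqr_nat => /eqP.
by move=> /allPn[_ /mapP[n _ ->] nr]; exists n.
Qed.

Lemma padic_pneq0 p B : prime p -> padic p B -> ~ pmul p B 1 1.
Proof.
move=> pp [hB _ sep] h1; suff /eqP : (1 : K) = 0 by rewrite oner_eq0.
apply: sep; elim=> [|N IH]; first by rewrite pmul0; case: hB.
by rewrite -[1]mulr1 -addn1; apply: pmulM.
Qed.

(** The factor 1 + p^2 s behaves as a unit: each pass through f = (1 + p^2 s) f - p^2 s f improves
    the divisibility of f by p, up to p^N. *)
Lemma pcoefs_cancel p B (s f : {poly K}) N : padic p B -> pcoefs B s -> pcoefs B f ->
  pcoefs (pmul p B N) ((1 + p%:R ^+ 2 *: s) * f) -> pcoefs (pmul p B N) f.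
Proof.
move=> [hB _ _] hs hf h; have BS := subring_stable hB.
suff H M : (M <= N)%N -> pcoefs (pmul p B M) f by apply: H.
elim: M => [|M IH] MN; first by move=> i; rewrite pmul0.
have -> : f = (1 + p%:R ^+ 2 *: s) * f - p%:R ^+ 2 *: (s * f).
  by rewrite mulrDl mul1r -scalerAl addrK.
apply: pcoefsB => [|i|i]; first by case: (pmul_stable p M.+1 hB).
  exact: pmul_le hB MN (h i).
rewrite coefZ; have Mp := pmul_stable p M hB.
have [b Bb ->] := pcoefsM Mp hs (IH (ltnW MN)) i.
rewrite mulrA -exprD; exists (p%:R * b).
  by case: (hB) => _ _; apply => //; apply: subring_nat.
by rewrite mulrA -exprSr.
Qed.

(** Specialise z to a natural number c at which no denominator vanishes. Writing z = c + p^2 w, a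
    denominator g(z) becomes g(c) (1 + p^2 s(w)), a unit of B', and modulo p^2 no class is added, so
    the list L survives. *)
Lemma framable_transcendental F z : subfield F -> framable F ->
  (forall f, pcoefs F f -> f.[z] = 0 -> f = 0) -> framable (adjoin F z).
Proof.
move=> Ff frF tr Z hZ; have [hF FV] := Ff.
have FG := subring_addgroup hF; have FS := subring_stable hF.
have /choice [fg fgE] : forall x, exists fg : {poly K} * {poly K}, x \in Z ->
    [/\ pcoefs F fg.1, pcoefs F fg.2, fg.2.[z] != 0 & x = fg.1.[z] / fg.2.[z]].
  move=> x; have [/hZ [f [g H]]|_] := boolP (x \in Z); first by exists (f, g).
  by exists (0, 0).
have [c hc] : exists c : nat, forall x, x \in Z -> (fg x).2.[c%:R] != 0.
  have [|c] := @exists_nat_nonroot (\prod_(x <- Z) (fg x).2).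
    rewrite prodf_seq_neq0; apply/allP => x /fgE [_ _ g0 _] /=.
    by apply: contraNneq g0 => ->; rewrite horner0.
  rewrite horner_prod prodf_seq_neq0 => /allP hc; exists c => x xZ.
  exact: (hc x xZ).
(* Besides the coefficients, the list contains the inverses of the values g(c), which thereby become
   elements of A. *)
pose Z' := flatten [seq (fg x).1 ++ (fg x).2 ++ [:: (fg x).2.[c%:R]^-1] | x <- Z].
have Fc : F c%:R by apply: subring_nat.
have [|p [A [B [[pp hA pB] [AB BF AZ [L hL]]]]]] := frF Z'.
  move=> y /flatten_mapP [x /fgE [hf hg _ _]].
  rewrite !mem_cat inE => /or3P[/(nthP 0)[i _ <-]|/(nthP 0)[i _ <-]|/eqP ->] //.
  by apply: FV; apply: pcoefs_horner FS _ _ _.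
have {AZ} hZ' x : x \in Z ->
  [/\ pcoefs A (fg x).1, pcoefs A (fg x).2 & A (fg x).2.[c%:R]^-1].
  move=> xZ; have AZ' y : y \in (fg x).1 ++ (fg x).2 ++ [:: (fg x).2.[c%:R]^-1] -> A y.
    by move=> yZ; apply: AZ; apply/flatten_mapP; exists x.
  have [A0 _] := subring_addgroup hA; split=> [i|i|].
  - have [lt|le] := ltnP i (size (fg x).1); last by rewrite nth_default.
    by apply: AZ'; rewrite mem_cat mem_nth.
  - have [lt|le] := ltnP i (size (fg x).2); last by rewrite nth_default.
    by apply: AZ'; rewrite !mem_cat mem_nth ?orbT.
  - by apply: AZ'; rewrite !mem_cat inE eqxx !orbT.
have [hB Bn sep] := pB; have BG := subring_addgroup hB.
have BS := subring_stable hB; have [B1 BB BM] := hB; have [B0 _] := BG.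
pose q : K := p%:R ^+ 2; have q0 : q != 0 by rewrite expf_neq0 ?pnat_neq0.
have Bq : B q by apply: subringX => //; apply: subring_nat.
pose w := (z - c%:R) / q; have zE : z = c%:R + q * w by rewrite /w; field.
have trw f : pcoefs F f -> f.[w] = 0 -> f = 0.
  move=> hf fw; pose l : {poly K} := q^-1 *: ('X - c%:R%:P).
  have hl : pcoefs F l.
    apply: (pcoefsZ FS); first by apply: FV; apply: BF.
    apply: pcoefsB => //; first exact: pcoefs_X.
    by apply: pcoefsC => //; case: FG.
  have /eqP : f \Po l = 0.
    apply: tr; first exact: pcoefs_comp.
    by rewrite horner_comp hornerZ !hornerE -[q^-1 * _]mulrC -/w.
  rewrite comp_poly_eq0; first by move/eqP.
  by rewrite size_scale ?invr_eq0 // size_XsubC.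
have BFp f : pcoefs B f -> pcoefs F f by move=> hf i; apply: BF.
pose den (s : {poly K}) : {poly K} := 1 + q *: s.
have hden s : pcoefs B s -> pcoefs B (den s).
  by move=> hs; apply: pcoefsD => //; [apply: pcoefs1|apply: (pcoefsZ BS)].
have denw s : pcoefs B s -> (den s).[w] != 0.
  move=> hs; apply/eqP => /(trw _ (BFp _ (hden s hs))) d0.
  apply: (padic_pneq0 pp pB); exists (- (p%:R * s`_0)).
    by apply: addgroupN => //; apply: BM => //; apply: subring_nat.
  have e : 1 + q * s`_0 = 0.
    by have := congr1 (fun f : {poly K} => f`_0) d0; rewrite coefD coef1 coefZ coef0.
  by rewrite -[LHS](addrK (q * s`_0)) e /q; ring.
have denM s s' : den s * den s' = den (s + s' + q *: (s * s')).
  by rewrite /den -!mul_polyC; ring.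
have hden2 s s' : pcoefs B s -> pcoefs B s' -> pcoefs B (s + s' + q *: (s * s')).
  move=> hs hs'; apply: pcoefsD => //; first exact: pcoefsD.
  by apply: (pcoefsZ BS) => //; apply: (pcoefsM BS).
(* By [pcoefs_cancel] these denominators do not spoil separatedness: an element divisible by p^N has
   a numerator whose coefficients are divisible by p^N. *)
pose B' x := exists f s, [/\ pcoefs B f, pcoefs B s & x = f.[w] / (den s).[w]].
have den0 : den 0 = 1 by rewrite /den scaler0 addr0.
have hB' : subring B'.
  split.
  - exists 1, 0; rewrite den0 divff ?hornerC ?oner_eq0 //.
    by split=> //; [apply: pcoefs1|apply: pcoefs0].
  - move=> _ _ [f [s [hf hs ->]]] [f' [s' [hf' hs' ->]]].
    exists (f * den s' - f' * den s), (s + s' + q *: (s * s')).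
    split; [|exact: hden2|].
      by apply: pcoefsB => //; apply: (pcoefsM BS) => //; apply: hden.
    rewrite -denM !hornerE; field.
    by have := (denw s hs, denw s' hs'); rewrite !hornerE => -[-> ->].
  - move=> _ _ [f [s [hf hs ->]]] [f' [s' [hf' hs' ->]]].
    exists (f * f'), (s + s' + q *: (s * s')).
    split; [exact: (pcoefsM BS)|exact: hden2|].
    by rewrite -denM !hornerM; field; rewrite denw ?denw.
have BB' x : B x -> B' x.
  move=> Bx; exists x%:P, 0; rewrite den0 !hornerC divr1; split=> //.
    exact: pcoefsC.
  exact: pcoefs0.
have B'w : B' w.
  exists 'X, 0; rewrite den0 hornerX hornerC divr1; split=> //.
    exact: pcoefs_X.
  exact: pcoefs0.
have pB' : padic p B'.
  split=> // [n cn|x hx]; first by apply: BB'; apply: Bn.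
  have [_ [f [s [hf hs ->]]]] := hx 0%N; rewrite expr0 mul1r => xE.
  suff f0 : f = 0 by rewrite xE f0 horner0 mul0r.
  apply/polyP => i; rewrite coef0; apply: sep => N; move: i.
  have [_ [g [s' [hg hs' ->]]] xE'] := hx N.
  have e : den s' * f = p%:R ^+ N *: (den s * g).
    apply/eqP; rewrite -subr_eq0; apply/eqP; apply: trw.
      apply: BFp; apply: pcoefsB => //; first by apply: (pcoefsM BS) => //; apply: hden.
      apply: (pcoefsZ BS); first by apply: subringX => //; apply: subring_nat.
      by apply: (pcoefsM BS) => //; apply: hden.
    rewrite hornerD hornerN hornerZ !hornerM; apply/eqP; rewrite subr_eq0; apply/eqP.
    have d1 := denw s hs; have d2 := denw s' hs'.
    move: xE'; rewrite xE => xE'.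
    have -> : f.[w] = f.[w] / (den s).[w] * (den s).[w] by rewrite divfK.
    by rewrite xE'; field.
  apply: (pcoefs_cancel pB hs' hf); rewrite -/(den s') e => i; rewrite coefZ.
  by exists (den s * g)`_i => //; apply: (pcoefsM BS (hden _ hs) hg i).
(* Being defined by the congruence itself, A' has the same representatives modulo p^2 as A. *)
pose A' x := B' x /\ exists2 y, A y & pmul p B' 2 (x - y).
have AB' x : A x -> B' x by move=> /AB /BB'.
have [A1 Asub Amul] := hA.
have B'S := pmul_stable p 2 hB'; have B'G := subring_addgroup hB'.
have A'A x : A x -> A' x.
  by move=> Ax; split; [exact: AB'|exists x => //; rewrite subrr; case: B'S => -[]].
have hA' : subring A'.
  split; first exact: A'A.
    move=> x1 x2 [b1 [y1 a1 e1]] [b2 [y2 a2 e2]]; split.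
      by case: hB' => _ + _; apply.
    exists (y1 - y2); first exact: Asub.
    have -> : x1 - x2 - (y1 - y2) = x1 - y1 - (x2 - y2) by ring.
    by case: B'S => -[_ +] _; apply.
  move=> x1 x2 [b1 [y1 a1 e1]] [b2 [y2 a2 e2]]; split.
    by case: hB' => _ _; apply.
  exists (y1 * y2); first exact: Amul.
  have -> : x1 * x2 - y1 * y2 = x1 * (x2 - y2) + y2 * (x1 - y1) by ring.
  by case: B'S => B'g B'm; apply: addgroupD => //; apply: B'm => //; apply: AB'.
have A'z : A' z.
  split.
    rewrite zE; apply: addgroupD => //; first by apply: AB'; apply: subring_nat.
    by case: (hB') => _ _; apply => //; apply: BB'.
  by exists c%:R; [exact: subring_nat|exists w; rewrite // zE addrC addKr].
have A'V x : x \in Z -> A' (fg x).2.[z]^-1.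
  move=> xZ; have [_ hg hi] := hZ' x xZ; set g := (fg x).2 in hg hi *.
  pose gi := g.[c%:R]^-1; have gc0 := hc x xZ; rewrite -/g in gc0.
  have [s [hs sE]] : exists s, pcoefs B s /\ gi * g.[z] = (den s).[w].
    (* g(z) - g(c) is a combination of the differences z^i - c^i, each a multiple of z - c = p^2 w;
       s collects the quotients by p^2. *)
    pose s := gi *: (('X * \sum_(i < size g) g`_i *:
      \sum_(j < i) (c%:R%:P + q *: 'X) ^+ (i.-1 - j) * c%:R%:P ^+ j) : {poly K}).
    exists s; split.
      apply: (pcoefsZ BS); first exact: AB.
      apply: (pcoefsM BS); first exact: pcoefs_X.
      apply: pcoefs_sum => // i _; apply: (pcoefsZ BS); first exact: AB.
      apply: pcoefs_sum => // j _; apply: (pcoefsM BS); apply: pcoefsX => //.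
        apply: pcoefsD => //; first by apply: pcoefsC => //; apply: subring_nat.
        by apply: (pcoefsZ BS) => //; apply: pcoefs_X.
      by apply: pcoefsC => //; apply: subring_nat.
    have -> : (den s).[w] = 1 + gi * (g.[z] - g.[c%:R]).
      rewrite /den /s hornerD hornerC !hornerZ hornerM hornerX horner_sum.
      rewrite !horner_coef -sumrB mulrCA; congr (_ + _ * _).
      rewrite mulrCA mulrA mulr_sumr; apply: eq_bigr => i _.
      rewrite -mulrBr subrXX hornerZ horner_sum mulrCA; congr (_ * (_ * _)).
        by rewrite zE; ring.
      apply: eq_bigr => j _; rewrite hornerM !horner_exp hornerD hornerZ !hornerC hornerX.
      by rewrite -zE.
    by rewrite /gi; field.
  have g0 : g.[z] != 0 by case: (fgE x xZ).
  have gz : g.[z]^-1 = gi / (den s).[w].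
    by rewrite -sE /gi; field; rewrite g0 gc0.
  split.
    by exists gi%:P, s; rewrite hornerC; split=> //; apply: pcoefsC => //; apply: AB.
  exists gi => //; exists (- (gi * s.[w] / (den s).[w])).
    apply: addgroupN => //; exists (gi *: s), s; rewrite hornerZ; split=> //.
    by apply: (pcoefsZ BS) => //; apply: AB.
  have := denw s hs; rewrite gz -/q /den hornerD hornerZ hornerC => d0.
  by field.
have A'p f : pcoefs A f -> A' f.[z].
  move=> hf; apply: pcoefs_horner (subring_stable hA') hA' A'z _.
  by move=> i; apply: A'A.
exists p, A', B'; split=> //; split.
- by move=> x [].
- move=> _ [f [s [hf hs ->]]]; have [[_ _ adM] adV] := adjoin_subfield z Ff.
  have adh h : pcoefs B h -> adjoin F z h.[w].
    move=> hh; have adR := (adjoin_subfield z Ff).1.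
    apply: (pcoefs_horner (subring_stable adR) adR).
      apply: adM; last by apply: adjoin_sub => //; apply: FV; apply: BF.
      case: (adR) => _ + _; apply; first exact: adjoin_gen.
      exact: adjoin_sub.
    by move=> i; apply: adjoin_sub => //; apply: BF.
  by apply: adM; [exact: adh|apply: adV; apply: adh; apply: hden].
- move=> x xZ; have [_ _ _ ->] := fgE x xZ; have [hf _ _] := hZ' x xZ.
  by case: hA' => _ _; apply; [exact: A'p|exact: A'V].
- exists L => x [_ [y Ay e]]; have [l Ll [Al e']] := hL y Ay; exists l => //.
  split; first exact: A'A.
  have -> : x - l = (x - y) + (y - l) by ring.
  apply: addgroupD => //; first by case: B'S.
  by case: e' => b Bb ->; exists b => //; apply: BB'.
Qed.

End Adjunction.

(** * Frames over algebraic and finitely generated extensions *)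

Section AlgebraicStep.
Variable K : numClosedFieldType.
Implicit Types (A B U F : K -> Prop) (f g h m : {poly K}) (p : nat) (x y z : K).

Lemma exists_minpoly F z f : subfield F -> pcoefs F f -> f != 0 -> f.[z] = 0 ->
  exists m, [/\ m \is monic, pcoefs F m, m.[z] = 0 &
    forall g, pcoefs F g -> g.[z] = 0 -> (size g < size m)%N -> g = 0].
Proof.
move=> [hF FV] hf f0 fz.
pose P n := `[< exists g, [/\ pcoefs F g, g != 0, g.[z] = 0 & size g = n] >].
have exP : exists n, P n by exists (size f); apply/asboolP; exists f.
case: (ex_minnP exP) => n /asboolP [g [hg g0 gz sg]] mn.
have lg : lead_coef g != 0 by rewrite lead_coef_eq0.
exists ((lead_coef g)^-1 *: g); split.
- by rewrite monicE lead_coefZ mulVf.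
- by apply: (pcoefsZ (subring_stable hF)) => //; apply: FV; apply: hg.
- by rewrite hornerZ gz mulr0.
move=> h hh hz; rewrite size_scale ?invr_eq0 // sg => lt; apply/eqP.
apply: contraTT lt => h0; rewrite -leqNgt; apply: (mn); apply/asboolP.
by exists h.
Qed.

(** Euclid's algorithm at z: dividing m by g, made monic, gives u(z) c g(z) = - r(z) with deg r <
    deg g, and the recursion goes on with r. If r(z) = 0, minimality of m leaves only a constant
    g. *)
Lemma minpoly_inverse F z m g : subfield F -> m \is monic -> pcoefs F m -> m.[z] = 0 ->
  (forall g, pcoefs F g -> g.[z] = 0 -> (size g < size m)%N -> g = 0) ->
  pcoefs F g -> g.[z] != 0 -> exists2 u, pcoefs F u & u.[z] * g.[z] = 1.
Proof.
move=> [hF FV] mm hm mz mn; have FS := subring_stable hF.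
have FG := subring_addgroup hF => hg gz.
have [v [r [_ hr gE sr]]] := pcoefs_division hF mm hm hg.
have {gz} rz : r.[z] != 0 by move: gz; rewrite gE hornerD hornerM mz mulr0 add0r.
rewrite gE hornerD hornerM mz mulr0 add0r {g hg v gE}; move: r sr hr rz => g.
move: {2}(size g) (leqnn (size g)) => n; elim: n g => [|n IH] g sg sgm hg gz.
  have g0 : g = 0 by apply/eqP; rewrite -size_poly_leq0.
  by move: gz; rewrite g0 horner0 eqxx.
have g0 : g != 0 by apply: contraNneq gz => ->; rewrite horner0.
have lg : lead_coef g != 0 by rewrite lead_coef_eq0.
pose c := (lead_coef g)^-1; have Fc : F c by apply: FV; apply: hg.
have [|u [r [hu hr mE sr]]] := @pcoefs_division _ F (c *: g) m hF _ (pcoefsZ FS Fc hg) hm.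
  by rewrite monicE lead_coefZ mulVf.
rewrite size_scale ?invr_eq0 // in sr.
have e : u.[z] * (c * g.[z]) = - r.[z].
  apply/eqP; rewrite -addr_eq0; apply/eqP; rewrite -[RHS]mz mE.
  by rewrite hornerD hornerM hornerZ.
have [rz|rz] := eqVneq r.[z] 0; last first.
  have [||v hv vE] := IH r _ _ hr rz; first by rewrite -ltnS; apply: leq_trans sr sg.
    exact: ltn_trans sr sgm.
  exists (- c *: (v * u)).
    apply: (pcoefsZ FS); first exact: addgroupN.
    exact: (pcoefsM FS).
  rewrite hornerZ hornerM -[RHS]vE -[r.[z]]opprK -e; ring.
have : u.[z] = 0.
  apply/eqP; move: e; rewrite rz oppr0 => /eqP; rewrite !mulf_eq0.
  by rewrite (negbTE gz) invr_eq0 (negbTE lg) !orbF.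
have [sg1|sg1] := leqP (size g) 1.
  move=> _; have gE := size1_polyC sg1; move: gE; move: g`_0 => a gE.
  exists c%:P; first by apply: pcoefsC => //; case: FG.
  by rewrite /c gE lead_coefC !hornerC mulVf //; move: gz; rewrite gE hornerC.
move=> uz; have r0 : r = 0.
  by apply: (mn) => //; apply: ltn_trans sr sgm.
have u0 : u = 0.
  have [//|un0] := eqVneq u 0.
  apply: (mn) => //; rewrite mE r0 addr0.
  rewrite size_Mmonic ?size_scale ?invr_eq0 //.
    rewrite -subn1 -addnBA ?(ltnW sg1) //.
    by rewrite -[X in (X < _)%N]addn0 ltn_add2l subn_gt0.
  by rewrite monicE lead_coefZ mulVf.
by move: (monic_neq0 mm); rewrite mE u0 r0 mul0r addr0 eqxx.
Qed.

(** Once the monic minimal polynomial m of z has coefficients in A, the powers z^i with i < deg m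
    form a basis of A[z] over A and of B[z] over B, so separatedness and finiteness modulo p^2 are
    checked on coefficients. *)
Lemma framable_algebraic F z f : subfield F -> framable F ->
  pcoefs F f -> f != 0 -> f.[z] = 0 -> framable (adjoin F z).
Proof.
move=> Ff frF hf f0 fz Z hZ; have [hF FV] := Ff.
have FG := subring_addgroup hF; have FS := subring_stable hF.
have [m [mm hm mz mn]] := exists_minpoly Ff hf f0 fz.
have /choice [fz' fzE] : forall x, exists f, x \in Z -> pcoefs F f /\ x = f.[z].
  move=> x; have [/hZ [g [h [hg hh hz ->]]]|_] := boolP (x \in Z); last by exists 0.
  have [u hu uE] := minpoly_inverse Ff mm hm mz mn hh hz.
  exists (g * u) => _; split; first exact: (pcoefsM FS).
  by rewrite hornerM -[u.[z]](mulfK hz) uE mul1r.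
pose Z' := m ++ flatten [seq polyseq (fz' x) | x <- Z].
have [|p [A [B [[pp hA pB] [AB BF AZ [L hL]]]]]] := frF Z'.
  move=> y; rewrite mem_cat => /orP[/(nthP 0)[i _ <-] //|].
  by case/flatten_mapP => x /fzE [hx _] /(nthP 0)[i _ <-].
have [A0 _] := subring_addgroup hA.
have Am : pcoefs A m.
  move=> i; have [lt|le] := ltnP i (size m); last by rewrite nth_default.
  by apply: AZ; rewrite mem_cat mem_nth.
have Ax x : x \in Z -> pcoefs A (fz' x).
  move=> xZ i; have [lt|le] := ltnP i (size (fz' x)); last by rewrite nth_default.
  by apply: AZ; rewrite mem_cat; apply/orP; right; apply/flatten_mapP; exists x; rewrite ?mem_nth.
have [hB Bn sep] := pB; have BG := subring_addgroup hB; have BS := subring_stable hB.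
have adh R : subring R -> subring (fun x => exists2 h, pcoefs R h & x = h.[z]).
  move=> hR; have RG := subring_addgroup hR; have RS := subring_stable hR; split.
  - by exists 1; [apply: pcoefs1|rewrite hornerC].
  - move=> _ _ [g hg ->] [h hh ->]; exists (g - h); first exact: pcoefsB.
    by rewrite hornerD hornerN.
  - move=> _ _ [g hg ->] [h hh ->]; exists (g * h); first exact: (pcoefsM RS).
    by rewrite hornerM.
have adsub R x : subring R -> R x -> exists2 h, pcoefs R h & x = h.[z].
  move=> hR Rx; exists x%:P; last by rewrite hornerC.
  by apply: pcoefsC => //; case: (subring_addgroup hR).
have Bm : pcoefs B m by move=> i; apply: AB.
have adred R x : subring R -> pcoefs R m -> (exists2 h, pcoefs R h & x = h.[z]) ->
    exists h, [/\ pcoefs R h, x = h.[z] & (size h < size m)%N].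
  move=> hR Rm [h hh ->]; have [u [r [_ hr -> sr]]] := pcoefs_division hR mm Rm hh.
  by exists r; rewrite hornerD hornerM mz mulr0 add0r.
pose A' x := exists2 h, pcoefs A h & x = h.[z].
pose B' x := exists2 h, pcoefs B h & x = h.[z].
have hB' : subring B' := adh B hB; have hA' : subring A' := adh A hA.
have B'z : B' z by exists 'X; [apply: pcoefs_X|rewrite hornerX].
have pB' : padic p B'.
  split=> // [n cn|x hx]; first by apply: adsub => //; apply: Bn.
  have [y B'y] := hx 0%N; rewrite expr0 mul1r => xy.
  rewrite -{y}xy in B'y; have [h [hh xE sh]] := adred B x hB Bm B'y.
  suff h0 : h = 0 by rewrite xE h0 horner0.
  apply/polyP => i; rewrite coef0; apply: sep => N.
  have [y' B'y' xE'] := hx N; have [h' [hh' yE sh']] := adred B y' hB Bm B'y'.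
  suff -> : h = p%:R ^+ N *: h' by rewrite coefZ; exists h'`_i.
  apply/eqP; rewrite -subr_eq0; apply/eqP; apply: (mn).
  - move=> j; apply: BF; apply: (pcoefsB BG hh); apply: (pcoefsZ BS) => //.
    by apply: subringX => //; apply: subring_nat.
  - by rewrite hornerD hornerN hornerZ -xE xE' yE subrr.
  apply: leq_ltn_trans (size_polyD _ _) _; rewrite gtn_max sh size_polyN.
  exact: leq_ltn_trans (size_scale_leq _ _) sh'.
exists p, A', B'; split=> //; split.
- by move=> x [h hh ->]; exists h => // i; apply: AB.
- move=> _ [h hh ->]; exists h, 1; rewrite hornerC oner_eq0 divr1; split=> //.
    by move=> i; apply: BF.
  exact: pcoefs1.
- by move=> x xZ; have [_ ->] := fzE x xZ; exists (fz' x) => //; apply: Ax.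
(* Horner's scheme: representatives for one more coefficient are a z + b, with a from the list
   already built and b from L. *)
have [Le hLe] : exists L' : seq K, forall h, pcoefs A h -> (size h <= size m)%N ->
    exists2 y, y \in L' & A' y /\ pmul p B' 2 (h.[z] - y).
  elim: (size m) => [|n [L' hL']].
    exists [:: 0] => h _; rewrite size_poly_leq0 => /eqP ->.
    exists 0; rewrite ?inE // horner0 subrr; split.
      by apply: adsub.
    by case: (pmul_stable p 2 hB') => -[].
  exists [seq a * z + b | a <- L', b <- L] => h hh sh.
  pose h1 : {poly K} := \poly_(i < n) h`_i.+1.
  have hE : h = h1 * 'X + (h`_0)%:P.
    apply/polyP => -[|i]; rewrite coefD coefMX coefC /= ?add0r ?addr0 // coef_poly.
    by case: ltnP => // le; rewrite nth_default //; apply: leq_trans sh _.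
  have [|a La [A'a e1]] := hL' h1 _ (size_poly _ _).
    by move=> i; rewrite coef_poly; case: ifP.
  have [b Lb [Ab e2]] := hL _ (hh 0%N); exists (a * z + b).
    by apply/allpairsP; exists (a, b).
  have A'b : A' b by apply: adsub.
  have A'z : A' z by exists 'X; [apply: pcoefs_X|rewrite hornerX].
  split.
    by apply: addgroupD; [apply: subring_addgroup|case: hA' => _ _; apply|].
  have -> : h.[z] - (a * z + b) = z * (h1.[z] - a) + (h`_0 - b).
    by rewrite {1}hE hornerD hornerM hornerX hornerC; ring.
  have [pG pM] := pmul_stable p 2 hB'; apply: addgroupD => //; first exact: pM.
  by case: e2 => c Bc ->; exists c => //; apply: adsub.
exists Le => x A'x; have [h [hh -> sh]] := adred A x hA Am A'x.
by apply: hLe => //; apply: ltnW.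
Qed.

Fixpoint generated (Z : seq K) : K -> Prop :=
  if Z is z :: Z' then adjoin (generated Z') z else @rationals K.

Lemma generated_subfield Z : subfield (generated Z).
Proof.
elim: Z => [|z Z IH]; last exact: adjoin_subfield.
split; first split.
- by exists 1; rewrite rmorph1.
- by move=> _ _ [a ->] [b ->]; exists (a - b); rewrite rmorphB.
- by move=> _ _ [a ->] [b ->]; exists (a * b); rewrite rmorphM.
by move=> _ [a ->]; exists a^-1; rewrite fmorphV.
Qed.

Lemma generated_framable Z : framable (generated Z).
Proof.
elim: Z => [|z Z IH]; first exact: framable_rationals.
have Zf := generated_subfield Z.
have [[f [hf f0 fz]]|tr] :=
    pselect (exists f, [/\ pcoefs (generated Z) f, f != 0 & f.[z] = 0]).
  exact: framable_algebraic hf f0 fz.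
apply: framable_transcendental => // f hf fz; apply/eqP; apply: contraPT fz => f0 fz.
by apply: tr; exists f.
Qed.

Lemma exists_frame (Z : seq K) : exists p A B, [/\ prime p, subring A & padic p B] /\
  [/\ forall x, A x -> B x, forall z, z \in Z -> A z &
      exists L : seq K, forall x, A x -> exists2 y, y \in L & A y /\ pmul p B 2 (x - y)].
Proof.
have [|p [A [B [h [AB _ AZ hL]]]]] := @generated_framable Z Z; last by exists p, A, B.
elim: Z => // z Z IH x; have [Zr _] := generated_subfield Z.
rewrite inE => /predU1P[->|/IH xZ]; first exact: adjoin_gen.
exact: adjoin_sub.
Qed.

End AlgebraicStep.

(** * Determinants and p-adic interpolation *)

Section Presentations.
Variable K : fieldType.
Implicit Types (B U : K -> Prop).

Lemma stableMr B U x y : stable B U -> B y -> U x -> U (x * y).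
Proof. by move=> [_ BU] By Ux; rewrite mulrC; apply: BU. Qed.

Lemma prod_mod B U (I : Type) (r : seq I) (F G : I -> K) : subring B -> stable B U ->
  (forall i, B (F i)) -> (forall i, B (G i)) -> (forall i, U (F i - G i)) ->
  U (\prod_(i <- r) F i - \prod_(i <- r) G i).
Proof.
move=> hB BU hF hG FG; elim: r => [|i r IH].
  by rewrite !big_nil subrr; case: BU => -[].
rewrite !big_cons; set P := \prod_(j <- r) F j; set Q := \prod_(j <- r) G j.
have -> : F i * P - G i * Q = (F i - G i) * P + G i * (P - Q) by ring.
apply: addgroupD; first by case: BU.
  by apply: (stableMr BU) => //; apply: subring_prod.
by case: BU => _; apply.
Qed.

Lemma det_mod B U n (M M' : 'M[K]_n) : subring B -> stable B U ->
  (forall i j, B (M i j)) -> (forall i j, B (M' i j)) ->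
  (forall i j, U (M i j - M' i j)) -> U (\det M - \det M').
Proof.
move=> hB BU hM hM' MM'; rewrite /determinant -sumrB.
apply: addgroup_sum => [|s _]; first by case: BU.
rewrite -mulrBr; case: (BU) => _ BUm; apply: BUm.
  by apply: subringX => //; apply: addgroupN; [apply: subring_addgroup|case: hB].
exact: prod_mod hB BU _ _ _.
Qed.

Lemma subring_det B n (M : 'M[K]_n) : subring B -> (forall i j, B (M i j)) -> B (\det M).
Proof.
move=> hB hM; apply: addgroup_sum => [|s _]; first exact: subring_addgroup.
have [B1 _ BM] := hB; apply: BM; last exact: subring_prod.
by apply: subringX => //; apply: addgroupN => //; apply: subring_addgroup.
Qed.

(* [Ti] is a square presentation, modulo U, of the quotient of V by [Si]; the
   map M from one quotient onto the other makes det T2 divide det T1. *)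
Lemma det_presentation B U (W : lmodType K) (V S1 S2 : W -> Prop) n1 n2
    (c1 : W -> 'rV[K]_n1) (c2 : {linear W -> 'rV[K]_n2})
    (b1 : {linear 'rV[K]_n1 -> W}) (b2 : 'rV[K]_n2 -> W)
    (M : {linear W -> W}) (M' : W -> W) (T1 : 'M[K]_n1) (T2 : 'M[K]_n2) :
  subring B -> stable B U ->
  (forall z, V z -> forall l, B (c1 z 0 l)) ->
  (forall y : 'rV_n1, (forall l, B (y 0 l)) -> V (b1 y)) ->
  (forall y : 'rV_n2, (forall l, B (y 0 l)) -> V (b2 y)) ->
  (forall i j, B (T1 i j)) -> (forall i j, B (T2 i j)) ->
  (forall z, V z -> V (M z)) -> (forall z, V z -> V (M' z)) -> cancel M' M ->
  (forall z, V z -> forall l, B (c2 z 0 l)) ->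
  (forall z, S1 z -> S2 (M z)) -> (forall i, S1 (b1 (row i T1))) ->
  (forall z, V z -> S1 (z - b1 (c1 z))) ->
  (forall z, S2 z -> exists2 x : 'rV[K]_n2, (forall l, B (x 0 l)) &
    forall l, U ((c2 z - x *m T2) 0 l)) ->
  (forall l, c2 (b2 (delta_mx 0 l)) = delta_mx 0 l) ->
  exists2 x, B x & U (\det T1 - \det T2 * x).
Proof.
move=> hB BU Bc1 Vb1 Vb2 BT1 BT2 VM VM' MM' Bc2 MS ST1 Sc1 hS2 cb2.
have [UG BUm] := BU; have BG := subring_addgroup hB; have [B1 _ Bm] := hB.
pose F := lin1_mx (c2 \o M \o b1).
have FE y : y *m F = c2 (M (b1 y)) by rewrite mul_rV_lin1.
have /choice [X hX] : forall i, exists x : 'rV[K]_n2, (forall l, B (x 0 l)) /\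
    forall l, U ((row i T1 *m F - x *m T2) 0 l).
  move=> i; have [|x Bx hx] := hS2 (M (b1 (row i T1))); first exact: MS.
  by exists x; split=> // l; rewrite FE.
pose Y := \matrix_l c1 (M' (b2 (delta_mx 0 l))).
have Vd l : V (b2 (delta_mx 0 l)).
  by apply: Vb2 => k; rewrite mxE; apply: subring_nat.
have BY l k : B (Y l k) by rewrite mxE; apply: Bc1; apply: VM'; apply: Vd.
have /choice [Z hZ] : forall i, exists x : 'rV[K]_n2, (forall l, B (x 0 l)) /\
    forall l, U ((delta_mx 0 i - row i Y *m F - x *m T2) 0 l).
  move=> i; set z := b2 (delta_mx 0 i).
  have [|x Bx hx] := hS2 (M (M' z - b1 (c1 (M' z)))).
    by apply: MS; apply: Sc1; apply: VM'; apply: Vd.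
  exists x; split=> // l; move: (hx l).
  by rewrite !linearB /= MM' cb2 FE rowK.
(* X records that M sends relations to relations, Y and Z that M is onto. Modulo U the product N Q
   is block lower triangular with diagonal T1 and 1, whence det N det T2 = det T1. *)
pose N := block_mx T1 (- \matrix_i X i) Y (\matrix_i Z i).
pose Q := block_mx 1%:M F 0 T2.
have BF i j : B (F i j).
  have -> : F i j = (row i F) 0 j by rewrite [RHS]mxE.
  by rewrite rowE FE; apply: Bc2; apply: VM; apply: Vb1 => k; rewrite mxE; apply: subring_nat.
have detQ : \det Q = \det T2 by rewrite /Q det_ublock det1 mul1r.
have BN i j : B (N i j).
  rewrite /N; case: (split_ordP i) => i' ->; case: (split_ordP j) => j' ->.
  - by rewrite block_mxEul.
  - by rewrite block_mxEur !mxE; apply: addgroupN => //; apply: (hX i').1.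
  - by rewrite block_mxEdl.
  - by rewrite block_mxEdr mxE; apply: (hZ i').1.
have BQ i j : B (Q i j).
  rewrite /Q; case: (split_ordP i) => i' ->; case: (split_ordP j) => j' ->.
  - by rewrite block_mxEul !mxE; apply: subring_nat.
  - by rewrite block_mxEur.
  - by rewrite block_mxEdl mxE; case: BG.
  - by rewrite block_mxEdr.
exists (\det N); first exact: subring_det.
rewrite mulrC -detQ -det_mulmx -opprB; apply: addgroupN => //.
have -> : \det T1 = \det (block_mx T1 0 Y 1%:M) by rewrite det_lblock det1 mulr1.
apply: (det_mod hB BU).
- move=> i j; rewrite mxE; apply: addgroup_sum => // k _; exact: Bm.
- move=> i j; case: (split_ordP i) => i' ->; case: (split_ordP j) => j' ->.
  + by rewrite block_mxEul.
  + by rewrite block_mxEur mxE; case: BG.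
  + by rewrite block_mxEdl.
  + by rewrite block_mxEdr !mxE; apply: subring_nat.
have -> : N *m Q = block_mx T1 (T1 *m F - (\matrix_i X i) *m T2) Y
    (Y *m F + (\matrix_i Z i) *m T2).
  by rewrite mulmx_block !mulmx1 !mulmx0 !addr0 mulNmx.
move=> i j; case: (split_ordP i) => i' ->; case: (split_ordP j) => j' ->.
- by rewrite !block_mxEul subrr; case: UG.
- rewrite !block_mxEur [X in _ - X]mxE subr0.
  have := (hX i').2 j'; rewrite -row_mul -[X i'](rowK X) -row_mul -linearB /=.
  by rewrite mxE.
- by rewrite !block_mxEdl subrr; case: UG.
- rewrite !block_mxEdr -opprB; apply: addgroupN => //.
  have := (hZ i').2 j'; rewrite -row_mul -[Z i'](rowK Z) -row_mul.
  by rewrite !mxE eqxx /= eq_sym opprD addrA.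
Qed.

End Presentations.

(** * Functions of j that are polynomials in p j *)

Section Interpolation.
Variable F : fieldType.
Implicit Types (U : F -> Prop) (f g : nat -> F) (p J : nat).

(** A polynomial stands for a convergent series: its degree may grow with J, but its coefficients
    stay in U, so that estimates can be uniform in J. *)
Definition panalytic U p J f := exists2 P : {poly F}, pcoefs U P &
  forall j, (j <= J)%N -> f j = P.[(p * j)%:R].

Lemma panalytic_ext U p J f g : (forall j, f j = g j) -> panalytic U p J f -> panalytic U p J g.
Proof. by move=> fg [P hP e]; exists P => // j jJ; rewrite -fg e. Qed.

Lemma panalytic_const U p J x : U 0 -> U x -> panalytic U p J (fun=> x).
Proof. by move=> U0 Ux; exists x%:P; [apply: pcoefsC|move=> j _; rewrite hornerC]. Qed.

Lemma panalyticD U p J f g : subring U ->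
  panalytic U p J f -> panalytic U p J g -> panalytic U p J (fun j => f j + g j).
Proof.
move=> /subring_addgroup hU [P hP fP] [Q hQ gQ]; exists (P + Q); first exact: pcoefsD.
by move=> j jJ; rewrite hornerD fP ?gQ.
Qed.

Lemma panalyticM U p J f g : subring U ->
  panalytic U p J f -> panalytic U p J g -> panalytic U p J (fun j => f j * g j).
Proof.
move=> /subring_stable hU [P hP fP] [Q hQ gQ]; exists (P * Q); first exact: (pcoefsM hU).
by move=> j jJ; rewrite hornerM fP ?gQ.
Qed.

Lemma panalyticN U p J f : subring U -> panalytic U p J f -> panalytic U p J (fun j => - f j).
Proof.
move=> /subring_addgroup hU [P hP fP]; exists (- P); first exact: pcoefsN.
by move=> j jJ; rewrite hornerN fP.
Qed.

Lemma panalytic_sum U p J (I : Type) (r : seq I) (G : I -> nat -> F) : subring U ->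
  (forall i, panalytic U p J (G i)) -> panalytic U p J (fun j => \sum_(i <- r) G i j).
Proof.
move=> hU hG; elim: r => [|i r IH].
  have [U0 _] := subring_addgroup hU.
  by apply: panalytic_ext (panalytic_const p J U0 U0) => j; rewrite big_nil.
by apply: panalytic_ext (panalyticD hU (hG i) IH) => j; rewrite big_cons.
Qed.

Lemma panalytic_prod U p J (I : Type) (r : seq I) (G : I -> nat -> F) : subring U ->
  (forall i, panalytic U p J (G i)) -> panalytic U p J (fun j => \prod_(i <- r) G i j).
Proof.
move=> hU hG; elim: r => [|i r IH].
  have [U0 _] := subring_addgroup hU; have [U1 _ _] := hU.
  by apply: panalytic_ext (panalytic_const p J U0 U1) => j; rewrite big_nil.
by apply: panalytic_ext (panalyticM hU (hG i) IH) => j; rewrite big_cons.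
Qed.

Lemma panalytic_det U p J n (M : nat -> 'M[F]_n) : subring U ->
  (forall i k, panalytic U p J (fun j => M j i k)) ->
  panalytic U p J (fun j => \det (M j)).
Proof.
move=> hU hM; apply: (panalytic_sum _ hU) => s; apply: (panalyticM hU).
  have UG := subring_addgroup hU; have [U1 _ _] := hU.
  by apply: panalytic_const; [case: UG|apply: subringX => //; apply: addgroupN].
exact: panalytic_prod.
Qed.

End Interpolation.

(** Evaluation at the integers p j only takes integer multiples of coefficients, which an additive
    map respects. *)
Lemma panalytic_additive (F G : fieldType) (U : F -> Prop) (V : G -> Prop) p J
  (phi : {additive F -> G}) f : (forall x, U x -> V (phi x)) ->
  panalytic U p J f -> panalytic V p J (phi \o f).
Proof.
move=> UV [P hP fP]; exists (\poly_(i < size P) phi P`_i).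
  move=> i; rewrite coef_poly; case: ltnP => [_|le]; first exact: UV.
  by rewrite -(raddf0 phi) -(nth_default 0 le); apply: UV.
move=> j jJ; rewrite /= fP // horner_coef raddf_sum horner_poly.
by apply: eq_bigr => i _; rewrite -!natrX !mulr_natr raddfMn.
Qed.

(** * Many zeros force p-adically small values *)

Section Hansel.
Variable K : numClosedFieldType.
Implicit Types (B : K -> Prop) (P Q : {poly K}) (p N c x y : nat).

(** Cancelling k costs v_p(k) powers of p; the crude bound v_p(k) < k keeps the later losses simple
    sums of integers. *)
Lemma pmul_cancel p B N (k : nat) (q : K) : prime p -> padic p B -> (0 < k)%N -> B q ->
  pmul p B N (k%:R * q) -> pmul p B (N - k) q.
Proof.
move=> pp [hB Bn _] k0 Bq [b Bb e].
have [N_k|k_N] := leqP N k.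
  have -> : (N - k = 0)%N by lia.
  by rewrite pmul0.
have [u cu kE] := pfactor_coprime pp k0; set l := logn p k in kE.
have lk : (l < k)%N by rewrite /l ltn_logl.
apply: (@pmul_le _ _ _ (N - l)) => //; first by lia.
have u0 := coprime_natr_neq0 K pp cu; have p0 := pnat_neq0 K pp.
exists (u%:R^-1 * b); first by case: hB => _ _; apply=> //; apply: Bn.
apply: (mulfI u0); apply: (mulfI (expf_neq0 l p0)).
transitivity (k%:R * q); first by rewrite kE natrM natrX; ring.
rewrite e -{1}(subnK (ltnW (ltn_trans lk k_N))) exprD.
by field.
Qed.

(** Coefficient i of the quotient is a combination of coefficients of P of index above i, hence
    gains one power of p. *)
Lemma poly_divided_difference p B P (x c : nat) : subring B ->
  (forall i, pmul p B (i + c) P`_i) ->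
  exists Q, (forall i, pmul p B (i + c.+1) Q`_i) /\ P = ('X - x%:R%:P) * Q + P.[x%:R]%:P.
Proof.
move=> hB; elim/poly_ind: P c => [|P a IH] c hP.
  exists 0; rewrite horner0 mulr0 add0r; split=> // i; rewrite coef0.
  by case: (pmul_stable p (i + c.+1) hB) => -[].
have [|Q [hQ PE]] := IH c.+1.
  by move=> i; have := hP i.+1; rewrite coefD coefMX coefC /= addr0 addSnnS.
exists (Q * 'X + P.[x%:R]%:P); split=> [[|i]|].
- rewrite coefD coefMX coefC add0r.
  apply: (pcoefs_horner (pmul_stable p _ hB) hB (subring_nat x hB)) => i.
  have := hP i.+1; rewrite coefD coefMX coefC /= addr0 addSnnS add0n.
  by apply: pmul_le => //; apply: leq_addl.
- by rewrite coefD coefMX coefC /= addr0 addSnnS; apply: hQ.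
by rewrite {1}PE hornerD hornerM hornerX hornerC polyCD polyCM; ring.
Qed.

(** Every point of xs is divided out in turn, and each division gains a factor p. So t zeros modulo
    p^N make all values divisible by p^t, within the precision N - C, where C depends on xs
    alone. *)
Lemma hansel p B (xs : seq nat) : prime p -> padic p B -> uniq xs -> exists C : nat,
  forall c N P, (forall i, pmul p B (i + c) P`_i) ->
    (forall x, x \in xs -> pmul p B N P.[x%:R]) ->
  forall y, pmul p B (minn (size xs + c) (N - C)) P.[y%:R].
Proof.
move=> pp pB; have [hB _ _] := pB.
have hev c P y : (forall i, pmul p B (i + c) P`_i) -> pmul p B c P.[y%:R].
  move=> hP; apply: (pcoefs_horner (pmul_stable p _ hB) hB (subring_nat y hB)) => i.
  by apply: pmul_le (hP i) => //; apply: leq_addl.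
elim: xs => [_|x xs IH /= /andP[xxs uxs]].
  exists 0%N => c N P hP _ y.
  by apply: (@pmul_le _ p B c) => //; [apply: geq_minl|apply: hev].
have [C hC] := IH uxs.
(* Passing from P to Q divides the value at x' by x' - x, which loses at most x' + x powers of p. *)
exists (C + \sum_(x' <- xs) (x' + x))%N => c N P hP zP y.
have [Q [hQ PE]] := poly_divided_difference x hB hP.
have Bg := subring_addgroup hB.
have BQ (y' : nat) : B Q.[y'%:R] by rewrite -(pmul0 p); apply: pmul_le (hev _ _ _ hQ).
have PQ (y' : nat) : P.[y'%:R] = (y'%:R - x%:R) * Q.[y'%:R] + P.[x%:R].
  by rewrite {1}PE hornerD hornerM hornerXsubC hornerC.
have zQ x' : x' \in xs -> pmul p B (N - \sum_(x' <- xs) (x' + x)) Q.[x'%:R].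
  move=> x'xs; have ne : x' != x by apply: contraNneq xxs => <-.
  have h1 : pmul p B N ((x'%:R - x%:R) * Q.[x'%:R]).
    rewrite -[X in pmul _ _ _ X](addrK P.[x%:R]) -PQ.
    by apply: (pmul_stable p N hB).1.2; apply: zP; rewrite inE ?eqxx ?x'xs ?orbT.
  have [k [k0 kl hk]] : exists k, [/\ (0 < k)%N, (k <= x' + x)%N &
      pmul p B N (k%:R * Q.[x'%:R])].
    have [lt|ge] := ltnP x x'.
      exists (x' - x)%N; rewrite subn_gt0 natrB ?(ltnW lt) //; split=> //.
      exact: leq_trans (leq_subr _ _) (leq_addr _ _).
    have lt : (x' < x)%N by rewrite ltn_neqAle ne.
    exists (x - x')%N; rewrite subn_gt0 natrB // -opprB mulNr; split=> //.
      exact: leq_trans (leq_subr _ _) (leq_addl _ _).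
    by apply: addgroupN => //; case: (pmul_stable p N hB).
  apply: pmul_le (pmul_cancel pp pB k0 (BQ _) hk) => //.
  apply: leq_sub2l; apply: leq_trans kl _; rewrite (big_rem x') //=; lia.
have hy := hC c.+1 _ Q hQ zQ y.
rewrite PQ; apply: addgroupD; first by case: (pmul_stable p (minn ((size xs).+1 + c) (N - (C + \sum_(x' <- xs) (x' + x)))) hB).
  have [_ h] := pmul_stable p (minn ((size xs).+1 + c) (N - (C + \sum_(x' <- xs) (x' + x)))) hB.
  apply: h; first by apply: Bg.2; apply: subring_nat.
  by apply: pmul_le hy => //; rewrite addSnnS; lia.
by apply: pmul_le (zP x _) => //; [lia|rewrite inE eqxx].
Qed.

Lemma panalytic_hansel p B (xs : seq nat) : prime p -> padic p B -> uniq xs ->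
  exists C : nat, forall N J f, panalytic B p J f ->
    (forall x, x \in xs -> (x <= J)%N /\ pmul p B N (f x)) ->
  forall y, (y <= J)%N -> pmul p B (minn (size xs) (N - C)) (f y).
Proof.
move=> pp pB uxs; have [C hC] := hansel pp pB uxs; exists C => N J f [P hP fP] hx y yJ.
(* Substituting p X puts a factor p^i into coefficient i, the growth that [hansel] asks for. *)
pose Q : {poly K} := P \Po (p%:R *: 'X).
have QE (z : nat) : Q.[z%:R] = P.[(p * z)%:R].
  by rewrite horner_comp hornerZ hornerX natrM.
rewrite fP // -QE -[size xs]addn0; apply: hC => [i|x xxs]; last first.
  by have [xJ] := hx x xxs; rewrite QE fP.
rewrite addn0 /Q comp_polyE; under eq_bigr => k _ do rewrite exprZn scalerA.
exists P`_i; first exact: hP.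
rewrite coef_sum; have [lt|le] := ltnP i (size P).
  rewrite (bigD1 (Ordinal lt)) //= coefZ coefXn eqxx mulr1 mulrC big1 ?addr0 // => k ne.
  rewrite coefZ coefXn; case: eqP => [e|_]; last by rewrite mulr0.
  by case/eqP: ne; apply: val_inj.
rewrite nth_default // mulr0 big1 // => k _; rewrite coefZ coefXn.
by case: eqP => [e|_]; [have := ltn_ord k; lia|rewrite mulr0].
Qed.

(** Legendre's formula gives v_p(i!) <= i, the case p = 2 included, because twice the integer part
    of k / p is at most k. *)
Lemma pmul_factorial p B i : prime p -> padic p B -> B (p%:R ^+ i / (i`!)%:R).
Proof.
move=> pp [hB Bn _].
have li : (logn p i`! <= i)%N.
  rewrite logn_fact //.
  have p1 := prime_gt1 pp; have p0 := prime_gt0 pp.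
  suff H m k : (\sum_(1 <= j < m.+1) k %/ p ^ j <= k)%N by apply: H.
  elim: m k => [|m IH] k; first by rewrite big_geq.
  rewrite big_nat_recl // expn1.
  under eq_bigr => j _ do rewrite expnS divnMA.
  apply: leq_trans (leq_add (leqnn _) (IH (k %/ p)%N)) _.
  rewrite addnn -muln2; apply: leq_trans (leq_trunc_div k p).
  by rewrite leq_mul2l p1 orbT.
have [u cu kE] := pfactor_coprime pp (fact_gt0 i).
move: (logn p i`!) li kE => l li kE.
have u0 := coprime_natr_neq0 K pp cu; have p0 := pnat_neq0 K pp.
have -> : p%:R ^+ i / (i`!)%:R = p%:R ^+ (i - l) * u%:R^-1 :> K.
  rewrite kE natrM natrX -{1}(subnK li) exprD.
  by field; rewrite u0 expf_neq0.
case: (hB) => _ _; apply; last exact: Bn.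
by apply: subringX => //; apply: subring_nat.
Qed.

(* Binomial expansion: p^(2i) 'C(j, i) = (p^i / i!) prod_(l < i) (p j - p l). *)
Lemma panalytic_power p B J (w : laurent K) : prime p -> padic p B -> lcoefs B w ->
  panalytic (lcoefs B) p J (fun j => (1 + (p%:R ^+ 2 : K) *: w) ^+ j).
Proof.
move=> pp pB hw; have [hB _ _] := pB; have BS := subring_stable hB.
have hL : subring (lcoefs B).
  split; first exact: lcoefs1.
    by move=> f g hf hg; apply: lcoefsB => //; case: BS.
  by move=> f g hf hg; apply: (lcoefsM BS).
exists (\sum_(i < J.+1) ((p%:R ^+ i / (i`!)%:R : K) *: w ^+ i)%:P *
    \prod_(l < i) ('X - (p * l)%:R%:P)).
  apply: pcoefs_sum => [|i _]; first exact: subring_addgroup.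
  apply: (pcoefsM (subring_stable hL)).
    apply: pcoefsC; first by apply: lcoefs0; case: BS.
    by apply: (lcoefsZ BS); [apply: pmul_factorial|apply: lcoefsX].
  elim/big_rec: _ => [|l P _ hP]; first exact: pcoefs1.
  apply: (pcoefsM (subring_stable hL)) => //; apply: pcoefsB.
  - exact: subring_addgroup.
  - exact: pcoefs_X.
  apply: pcoefsC; last exact: subring_nat.
  by apply: lcoefs0; case: BS.
move=> j jJ; rewrite exprDn horner_sum.
(* Binomial coefficients with i > j vanish, so one polynomial of degree at most J serves every j <=
   J. *)
rewrite (big_ord_widen J.+1 (fun i => 1 ^+ (j - i) * ((p%:R ^+ 2 : K) *: w) ^+ i *+ 'C(j, i))) //.
rewrite big_mkcond; apply: eq_bigr => i _.
rewrite hornerM hornerC horner_prod.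
under eq_bigr => l _ do rewrite hornerXsubC.
have fE (k : nat) : \prod_(l < k) ((p * j)%:R - (p * l)%:R : laurent K) =
    p%:R ^+ k * (j ^_ k)%:R.
  elim: k => [|k IH]; first by rewrite big_ord0 expr0 mul1r.
  rewrite big_ord_recr IH ffactnSr exprSr natrM /=.
  have [lt|le] := ltnP j k; first by rewrite ffact_small // !(mulr0n, mul0r, mulr0).
  by rewrite !natrM natrB //; ring.
rewrite fE ltnS; case: leqP => [ij|ji]; last first.
  by rewrite ffact_small // !(mulr0n, mulr0).
rewrite expr1n mul1r.
have exprZL (a : K) (k : nat) : (a *: w) ^+ k = a ^+ k *: w ^+ k.
  elim: k => [|k IH]; first by rewrite !expr0 scale1r.
  by rewrite !exprS IH -lscaleAl -lscaleAr scalerA.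
rewrite exprZL.
have nE (n : nat) (f : laurent K) : n%:R * f = (n%:R : K) *: f.
  by rewrite mulr_natl scaler_nat.
have -> : p%:R ^+ i * (j ^_ i)%:R = (p ^ i * j ^_ i)%N%:R :> laurent K.
  by rewrite natrM natrX.
rewrite [RHS]mulrC nE scalerA -bin_ffact -scaler_nat scalerA.
have f0 : (i`!)%:R != 0 :> K by rewrite pnatr_eq0 -lt0n fact_gt0.
have -> : 'C(j, i)%:R * (p%:R ^+ 2) ^+ i =
    (p ^ i * ('C(j, i) * i`!))%N%:R * (p%:R ^+ i / i`!%:R) :> K.
  by rewrite !natrM natrX -exprM mulnC exprM expr2; field.
by [].
Qed.

End Hansel.

(** * The twisted projection *)

Lemma addr_shuffle (V : zmodType) (x y a b c : V) :
  x + a + (y + b + c) = x + y + (a + b) + c.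
Proof. by rewrite !addrA [x + a + y]addrAC. Qed.

Lemma addr_cancel (V : zmodType) (x s a b : V) : x + s + a + b - s = x + a + b.
Proof. by rewrite (addrAC _ b) (addrAC _ a) addrK. Qed.

Section TwistedProjection.
Variables (K : numClosedFieldType) (S : laurent K) (d : nat).
Local Notation L := (laurent K).
Local Notation W := (laurent K * laurent K)%type.
Implicit Types (z : W) (P Q : {poly K}) (B : K -> Prop) (n N p : nat) (v : L).

Definition val_pos P Q : L := P%:L + Q%:L * S.
Definition val_neg P Q : L := P%:L - Q%:L * S.

(* The projection of L * L onto {(P + Q S, P - Q S)} along
   {deg <= -1} * {deg <= d - 1}. *)
Definition rhoQ z : {poly K} := polypart ((z.1 - z.2) * (2%:R * S)^-1).
Definition rhoP z : {poly K} := polypart (z.1 - (rhoQ z)%:L * S).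

Definition rho_pos z := val_pos (rhoP z) (rhoQ z).
Definition rho_neg z := val_neg (rhoP z) (rhoQ z).

Lemma rhoQ_linear a z z' : rhoQ (a *: z + z') = a *: rhoQ z + rhoQ z'.
Proof.
rewrite /rhoQ /= -polypartZ -polypartD; congr polypart.
by rewrite lscaleAl -mulrDl scalerBr; congr (_ * _); rewrite opprD; ring.
Qed.

Lemma rhoP_linear a z z' : rhoP (a *: z + z') = a *: rhoP z + rhoP z'.
Proof.
rewrite /rhoP rhoQ_linear /= -[in RHS]polypartZ -[in RHS]polypartD; congr polypart.
rewrite rmorphD /= -lscale_poly scalerBr mulrDl -lscaleAl opprD.
by rewrite addrACA.
Qed.

Fact rho_pos_linear : linear rho_pos.
Proof.
move=> a z z'; rewrite /rho_pos rhoP_linear rhoQ_linear /val_pos !rmorphD /=.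
by rewrite -!lscale_poly scalerDr mulrDl -!lscaleAl addrACA.
Qed.

Fact rho_neg_linear : linear rho_neg.
Proof.
move=> a z z'; rewrite /rho_neg rhoP_linear rhoQ_linear /val_neg !rmorphD /=.
by rewrite -!lscale_poly scalerBr mulrDl -!lscaleAl opprD addrACA.
Qed.

HB.instance Definition _ := GRing.isLinear.Build K W L _ rho_pos rho_pos_linear.
HB.instance Definition _ := GRing.isLinear.Build K W L _ rho_neg rho_neg_linear.

(** The complementary projection, onto {deg <= -1} * {deg <= d - 1}. *)
Definition pi0 z : W := (z.1 - rho_pos z, z.2 - rho_neg z).
Fact pi0_linear : linear pi0.
Proof.
move=> a z z'; rewrite /pi0 rho_pos_linear rho_neg_linear.
congr pair; first by rewrite /= scalerBr opprD addrACA.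
by rewrite /= (scalerBr a z.2 (rho_neg z)) opprD addrACA.
Qed.
HB.instance Definition _ := GRing.isLinear.Build K W W _ pi0 pi0_linear.

(** The defect caused by the twist: z = (rho_pos z, rho_neg z * v) + pi0 z + kap v z. *)
Definition kap v z : W := (0, - (rho_neg z * (v - 1))).
Fact kap_linear v : linear (kap v).
Proof.
move=> a z z'; rewrite /kap rho_neg_linear; congr pair; rewrite /=.
  by rewrite scaler0 addr0.
by rewrite mulrDl -lscaleAl opprD scalerN.
Qed.
HB.instance Definition _ v := GRing.isLinear.Build K W W _ (kap v) (kap_linear v).

(** Iterating the identity behind [kap] gives this truncated Neumann series. Modulo p^N it is the
    projection onto {deg <= -1} * {deg <= d - 1} along the twisted lattice {(P + Q S, (P - Q S) v)},
    because each application of [kap] gains a factor p. *)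
Definition proj v N z : W := \sum_(i < N.+1) pi0 (iter i (kap v) z).
Fact proj_linear v N : linear (proj v N).
Proof.
move=> a z z'; rewrite /proj scaler_sumr -big_split /=; apply: eq_bigr => i _.
rewrite -linearP; congr pi0; elim: (nat_of_ord i) => //= k ->.
by rewrite linearP.
Qed.
HB.instance Definition _ v N := GRing.isLinear.Build K W W _ (proj v N) (proj_linear v N).

(** The coefficients in degrees d - 1 down to d - n are coordinates of {deg <= -1} * {deg <= d - 1}
    modulo {deg <= -1} * {deg <= d - 1 - n}. *)
Definition coords v N n z : 'rV[K]_n := \row_l (proj v N z).2 (d%:Z - 1 - l%:Z).
Fact coords_linear v N n : linear (coords v N n).
Proof.
move=> a z z'; apply/rowP => l; rewrite !mxE linearP /=.
by rewrite lcoefD lcoefZ.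
Qed.
HB.instance Definition _ v N n :=
  GRing.isLinear.Build K W 'rV[K]_n _ (coords v N n) (coords_linear v N n).

Definition basis n (y : 'rV[K]_n) : W := (0, \sum_l y 0 l *: lmon K (d%:Z - 1 - l%:Z)).
Fact basis_linear n : linear (@basis n).
Proof.
move=> a y y'; rewrite /basis; congr pair; rewrite /=; first by rewrite scaler0 addr0.
rewrite scaler_sumr -big_split; apply: eq_bigr => l _.
by rewrite !mxE scalerDl scalerA.
Qed.
HB.instance Definition _ n := GRing.isLinear.Build K 'rV[K]_n W _ (@basis n) (@basis_linear n).

(** The rows are the relations imposed by (t^i, 0) for i < n. Modulo p^N the matrix presents the
    quotient of L * L by the twisted lattice plus {deg <= n - 1} * {deg <= d - 1 - n}; for v = 1 its
    determinant is tau_n. *)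
Definition twist_mx v N n : 'M[K]_n := \matrix_i coords v N n (lmon K i%:Z, 0).

Variable B : K -> Prop.
Hypotheses (hB : subring B) (B2 : B (2%:R)^-1) (BSi : B (S d%:Z)^-1) (BS : lcoefs B S).
Hypotheses (Sd : lord_le S d%:Z) (Sd0 : S d%:Z != 0).

Let BG := subring_addgroup hB.
Let BB := subring_stable hB.

Definition integral z := lcoefs B z.1 /\ lcoefs B z.2.

Lemma lcoefs_val_pos P Q : pcoefs B P -> pcoefs B Q -> lcoefs B (val_pos P Q).
Proof.
move=> hP hQ; have [B0 _] := BG; apply: lcoefsD => //; first exact: lcoefs_poly.
by apply: (lcoefsM BB) => //; apply: lcoefs_poly.
Qed.

Lemma lcoefs_val_neg P Q : pcoefs B P -> pcoefs B Q -> lcoefs B (val_neg P Q).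
Proof.
move=> hP hQ; have [B0 _] := BG; apply: lcoefsB => //; first exact: lcoefs_poly.
by apply: (lcoefsM BB) => //; apply: lcoefs_poly.
Qed.

Lemma twoS_coef : (2%:R * S) d%:Z = 2%:R * S d%:Z.
Proof. by rewrite mulr_natl -scaler_nat lcoefZ. Qed.

Lemma twoS_neq0 : (2%:R * S) d%:Z != 0.
Proof. by rewrite twoS_coef mulf_neq0 // pnatr_eq0. Qed.

Lemma twoS_le : lord_le (2%:R * S) d%:Z.
Proof. by rewrite mulr_natl -scaler_nat; apply: lord_leZ. Qed.

Lemma lcoefs_twoSV : lcoefs B (2%:R * S)^-1.
Proof.
apply: (lcoefsV hB _ twoS_le twoS_neq0); last first.
  by rewrite twoS_coef invfM; case: (hB) => _ _; apply.
rewrite mulr_natl -scaler_nat; apply: (lcoefsZ BB) => //; exact: subring_nat.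
Qed.

Lemma rhoQ_coefs N p z : lcoefs (pmul p B N) z.1 -> lcoefs (pmul p B N) z.2 ->
  pcoefs (pmul p B N) (rhoQ z).
Proof.
move=> h1 h2; have Up := pmul_stable p N hB; have [Ug _] := Up.
apply: lcoefs_polypart; rewrite mulrC; apply: (lcoefsM Up); first exact: lcoefs_twoSV.
exact: lcoefsB.
Qed.

Lemma rhoP_coefs N p z : lcoefs (pmul p B N) z.1 -> lcoefs (pmul p B N) z.2 ->
  pcoefs (pmul p B N) (rhoP z).
Proof.
move=> h1 h2; have Up := pmul_stable p N hB; have [Ug _] := Up; have [U0 _] := Ug.
apply: lcoefs_polypart; apply: lcoefsB => //; rewrite mulrC; apply: (lcoefsM Up) => //.
by apply: lcoefs_poly => // i; apply: rhoQ_coefs.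
Qed.

Lemma rho_neg_coefs N p z : lcoefs (pmul p B N) z.1 -> lcoefs (pmul p B N) z.2 ->
  lcoefs (pmul p B N) (rho_neg z).
Proof.
move=> h1 h2; have Up := pmul_stable p N hB; have [Ug _] := Up; have [U0 _] := Ug.
apply: lcoefsB => //; first by apply: lcoefs_poly => // i; apply: rhoP_coefs.
rewrite mulrC; apply: (lcoefsM Up) => //.
by apply: lcoefs_poly => // i; apply: rhoQ_coefs.
Qed.

Lemma rho_pos_coefs N p z : lcoefs (pmul p B N) z.1 -> lcoefs (pmul p B N) z.2 ->
  lcoefs (pmul p B N) (rho_pos z).
Proof.
move=> h1 h2; have Up := pmul_stable p N hB; have [Ug _] := Up; have [U0 _] := Ug.
apply: lcoefsD => //; first by apply: lcoefs_poly => // i; apply: rhoP_coefs.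
rewrite mulrC; apply: (lcoefsM Up) => //.
by apply: lcoefs_poly => // i; apply: rhoQ_coefs.
Qed.

Lemma lcoefs_pmul0 p f : lcoefs B f <-> lcoefs (pmul p B 0) f.
Proof. by split=> h n; [rewrite pmul0|rewrite -(pmul0 p)]. Qed.

Lemma integral_rho_coefs z : integral z -> pcoefs B (rhoP z) /\ pcoefs B (rhoQ z).
Proof.
move=> [/(lcoefs_pmul0 0) h1 /(lcoefs_pmul0 0) h2]; split=> i; rewrite -(pmul0 0).
  exact: rhoP_coefs.
exact: rhoQ_coefs.
Qed.

Lemma pi0_lord_le1 z : lord_le (pi0 z).1 (-1).
Proof.
have -> : (pi0 z).1 = (z.1 - (rhoQ z)%:L * S) - (rhoP z)%:L.
  by rewrite /pi0 /= /rho_pos /val_pos opprD addrA addrAC.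
exact: lord_le_polypart.
Qed.

(** The second component is the first minus 2 S times a fractional part, and this product has degree
    at most d - 1. *)
Lemma pi0_lord_le2 z : lord_le (pi0 z).2 (d%:Z - 1).
Proof.
have -> : (pi0 z).2 = (pi0 z).1 -
    (2%:R * S) * ((z.1 - z.2) * (2%:R * S)^-1 - (rhoQ z)%:L).
  have h : 2%:R * S != 0 by apply: contraNneq twoS_neq0 => ->.
  rewrite mulrBr [_ * (_ * _^-1)]mulrC mulfVK // /pi0 /= /rho_pos /rho_neg /val_pos /val_neg.
  ring.
apply: lord_leB; first by apply: lord_le_trans (pi0_lord_le1 z); lia.
by apply: lord_leM; [exact: twoS_le|exact: lord_le_polypart].
Qed.

Lemma rho_val P Q : rhoP (val_pos P Q, val_neg P Q) = P /\
  rhoQ (val_pos P Q, val_neg P Q) = Q.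
Proof.
have h : 2%:R * S != 0 by apply: contraNneq twoS_neq0 => ->.
have eQ : rhoQ (val_pos P Q, val_neg P Q) = Q.
  rewrite /rhoQ /= (_ : _ - _ = Q%:L * (2%:R * S)); last by rewrite /val_pos /val_neg; ring.
  by rewrite mulfK // polypart_poly.
by split=> //; rewrite /rhoP eQ /= /val_pos addrK polypart_poly.
Qed.

Lemma rho_small z : lord_le z.1 (-1) -> lord_le z.2 (d%:Z - 1) ->
  rhoP z = 0 /\ rhoQ z = 0.
Proof.
move=> h1 h2; have eQ : rhoQ z = 0.
  apply: polypart_neg; have -> : -1 = d%:Z - 1 + - d%:Z by lia.
  apply: lord_leM; last exact: lord_leV twoS_le twoS_neq0.
  by apply: lord_leB => //; apply: lord_le_trans h1; lia.
by split=> //; rewrite /rhoP eQ rmorph0 mul0r subr0 polypart_neg.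
Qed.

(** * The twisted lattice and its presentation modulo p^N *)

Section Modulus.
Variables (p N : nat) (v : L).
Hypothesis hv : lcoefs (pmul p B 2) (v - 1).

Lemma lcoefs_v : lcoefs B v.
Proof.
rewrite -[v](subrK 1); apply: lcoefsD => //; last exact: lcoefs1.
by apply/(lcoefs_pmul0 p) => m; apply: pmul_le (hv m).
Qed.

Lemma kap_coefs M z : lcoefs (pmul p B M) z.1 -> lcoefs (pmul p B M) z.2 ->
  lcoefs (pmul p B M.+1) (kap v z).2.
Proof.
move=> h1 h2; have Up := pmul_stable p M.+1 hB; have [Ug _] := Up.
apply: lcoefsN => //; have hr := rho_neg_coefs h1 h2.
move=> m; have [P hP] := lcoef_bounded (rho_neg z).
have [Q hQ] := lcoef_bounded (v - 1).
rewrite (laurent_mulE hP hQ) lcoef_ps /psl; case: ifP => _; last by case: Ug.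
apply: addgroup_sum => // i _; apply: pmul_le (pmulM hB (hr _) (hv _)) => //; lia.
Qed.

Lemma iter_kap_coefs M z i : lcoefs (pmul p B M) z.1 -> lcoefs (pmul p B M) z.2 ->
  lcoefs (pmul p B (M + i)) (iter i (kap v) z).1 /\
  lcoefs (pmul p B (M + i)) (iter i (kap v) z).2.
Proof.
move=> h1 h2; elim: i => [|i [IH1 IH2]]; first by rewrite addn0.
rewrite addnS; split; last exact: kap_coefs.
by apply: lcoefs0; case: (pmul_stable p (M + i).+1 hB).
Qed.

Lemma proj_coefs M z : lcoefs (pmul p B M) z.1 -> lcoefs (pmul p B M) z.2 ->
  lcoefs (pmul p B M) (proj v N z).1 /\ lcoefs (pmul p B M) (proj v N z).2.
Proof.
move=> h1 h2; have [Ug _] := pmul_stable p M hB.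
suff H i : lcoefs (pmul p B M) (pi0 (iter i (kap v) z)).1 /\
    lcoefs (pmul p B M) (pi0 (iter i (kap v) z)).2.
  rewrite /proj; elim/big_ind: _ => [|x y [x1 x2] [y1 y2]|i _]; last exact: H.
    by split; apply: lcoefs0.
  by split; apply: lcoefsD.
have [k1 k2] := iter_kap_coefs i h1 h2.
have {}k1 : lcoefs (pmul p B M) (iter i (kap v) z).1.
  by move=> m; apply: pmul_le (k1 m) => //; apply: leq_addr.
have {}k2 : lcoefs (pmul p B M) (iter i (kap v) z).2.
  by move=> m; apply: pmul_le (k2 m) => //; apply: leq_addr.
by split; apply: lcoefsB => //; [apply: rho_pos_coefs|apply: rho_neg_coefs].
Qed.

Lemma proj_integral z : integral z -> integral (proj v N z).
Proof.
move=> [/(lcoefs_pmul0 p) h1 /(lcoefs_pmul0 p) h2].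
by have [h1' h2'] := proj_coefs h1 h2; split; apply/(lcoefs_pmul0 p).
Qed.

Lemma proj_lord_le z : lord_le (proj v N z).1 (-1) /\ lord_le (proj v N z).2 (d%:Z - 1).
Proof.
rewrite /proj; elim/big_ind: _ => [//|x y [x1 x2] [y1 y2]|i _].
  by split; apply: lord_leD.
by split; [apply: pi0_lord_le1|apply: pi0_lord_le2].
Qed.

Lemma proj_small z : lord_le z.1 (-1) -> lord_le z.2 (d%:Z - 1) -> proj v N z = z.
Proof.
move=> h1 h2; have [eP eQ] := rho_small h1 h2.
have k0 : kap v z = 0.
  by rewrite /kap /rho_neg eP eQ /val_neg rmorph0 mul0r subrr mul0r oppr0.
rewrite /proj big_ord_recl /= big1 ?addr0 => [|i _].
  by rewrite /pi0 /rho_pos /rho_neg eP eQ /val_pos /val_neg !(rmorph0, mul0r, subr0, addr0) -surjective_pairing.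
rewrite -iterS iterSr k0; have -> : iter i (kap v) 0 = 0.
  by elim: (nat_of_ord i) => //= k ->; rewrite linear0.
by rewrite linear0.
Qed.

(** The one-step identity is telescoped N + 1 times; what remains is iter N.+1 (kap v) z, divisible
    by p^N. *)
Lemma proj_decomp z : integral z -> exists P Q r, [/\ pcoefs B P, pcoefs B Q,
  lcoefs (pmul p B N) r &
  z = (val_pos P Q + (proj v N z).1, val_neg P Q * v + (proj v N z).2 + r)].
Proof.
move=> [/(lcoefs_pmul0 p) h1 /(lcoefs_pmul0 p) h2].
have [Pg _] := pmul_stable p N hB.
have step y : y = (rho_pos y, rho_neg y * v) + pi0 y + kap v y.
  rewrite /pi0 /kap [LHS]surjective_pairing; congr pair; rewrite /=; first by ring.
  by ring.
have [P [Q [hP hQ e]]] : exists P Q, [/\ pcoefs B P, pcoefs B Q &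
    z = (val_pos P Q, val_neg P Q * v) + proj v N z + iter N.+1 (kap v) z].
  suff H M : exists P Q, [/\ pcoefs B P, pcoefs B Q & z = (val_pos P Q, val_neg P Q * v) +
      \sum_(i < M.+1) pi0 (iter i (kap v) z) + iter M.+1 (kap v) z] by apply: H.
  elim: M => [|M [P [Q [hP hQ e]]]].
    exists (rhoP z), (rhoQ z); have [|hP hQ] := @integral_rho_coefs z.
      by split; apply/(lcoefs_pmul0 p).
    by rewrite big_ord_recl big_ord0 addr0; split=> //; apply: step.
  set y := iter M.+1 (kap v) z in e *.
  have [k1 k2] := iter_kap_coefs M.+1 h1 h2.
  have [|hP' hQ'] := @integral_rho_coefs y.
    by split; apply/(lcoefs_pmul0 p) => m; [apply: pmul_le (k1 m)|apply: pmul_le (k2 m)].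
  exists (P + rhoP y), (Q + rhoQ y); split; try exact: pcoefsD.
  rewrite {1}e {1}[y]step [X in _ = _ + X + _]big_ord_recr.
  rewrite (_ : (val_pos (P + _) _, _) =
      (val_pos P Q, val_neg P Q * v) + (rho_pos y, rho_neg y * v)).
    exact: addr_shuffle.
  congr pair; rewrite /rho_pos /rho_neg /val_pos /val_neg !rmorphD /=; ring.
exists P, Q, (iter N.+1 (kap v) z).2; split=> //.
  have [_ k2] := iter_kap_coefs N.+1 h1 h2.
  by move=> m; apply: pmul_le (k2 m) => //; rewrite add0n.
rewrite {1}e [LHS]surjective_pairing; congr pair.
by rewrite /= addr0.
Qed.

(** The element is (P + Q S, P - Q S) + u with u = (0, (P - Q S) (v - 1)). On the first summand
    [pi0] is 0 and [kap] gives -u, so the Neumann series collapses to its last term, [pi0] of the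
    N-th iterate of [kap] at u. *)
Lemma proj_val P Q : pcoefs B P -> pcoefs B Q ->
  lcoefs (pmul p B N) (proj v N (val_pos P Q, val_neg P Q * v)).2.
Proof.
move=> hP hQ; set u : W := (0, val_neg P Q * (v - 1)).
set z : W := (_, _); have zE : z = (val_pos P Q, val_neg P Q) + u.
  by rewrite /z /u; congr pair; rewrite /=; [rewrite addr0|ring].
have [rP rQ] := rho_val P Q.
have kzE : kap v z = - u + kap v u.
  rewrite zE linearD /=; congr (_ + _); rewrite /kap /rho_neg rP rQ /u.
  by congr pair; rewrite /= oppr0.
have pi0zE : pi0 z = pi0 u.
  rewrite zE linearD /= {1}/pi0 /rho_pos /rho_neg rP rQ /=.
  by rewrite (_ : (_, _) = 0) ?add0r // !subrr.
have -> : proj v N z = pi0 (iter N (kap v) u).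
  rewrite /proj; elim: N => [|M IH]; first by rewrite big_ord_recl big_ord0 addr0.
  rewrite big_ord_recr IH /= -linearD; congr pi0.
  have -> : kap v (iter M (kap v) z) = iter M (kap v) (kap v z) by rewrite -iterSr.
  rewrite kzE; have : iter M (kap v) (- u + kap v u) =
     - iter M (kap v) u + iter M (kap v) (kap v u).
    by elim: (M) => //= k ->; rewrite linearD linearN.
  by move=> ->; rewrite addrA subrr add0r -iterSr.
have BN := lcoefs_val_neg hP hQ.
have u1 : lcoefs (pmul p B 0) u.1 by apply: lcoefs0; case: (pmul_stable p 0 hB).
have u2 : lcoefs (pmul p B 0) u.2.
  by apply/(lcoefs_pmul0 p); apply: (lcoefsM BB) => //; apply: lcoefsB;
     [|exact: lcoefs_v|exact: lcoefs1].
have [k1 k2] := iter_kap_coefs N u1 u2; have [Ug _] := pmul_stable p N hB.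
rewrite !add0n in k1 k2.
by apply: lcoefsB => //; apply: rho_neg_coefs.
Qed.

(* Membership in {(P + Q S, (P - Q S) v)} + {deg <= n - 1} * {deg <= d - 1 - n},
   modulo p^N. *)
Definition lattice n z := exists P Q l1 l2 r1 r2,
  [/\ pcoefs B P, pcoefs B Q, [/\ lcoefs B l1 & lcoefs B l2],
      [/\ lord_le l1 (n%:Z - 1) & lord_le l2 (d%:Z - 1 - n%:Z)] &
      [/\ lcoefs (pmul p B N) r1, lcoefs (pmul p B N) r2 &
          z = (val_pos P Q + l1 + r1, val_neg P Q * v + l2 + r2)]].

Lemma lattice_sub_basis n z : integral z -> lattice n (z - @basis n (coords v N n z)).
Proof.
move=> Vz; have [P [Q [r [hP hQ hr zE]]]] := proj_decomp Vz.
have [i1 i2] := proj_integral Vz; have [o1 o2] := proj_lord_le z.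
have [Pg _] := pmul_stable p N hB.
set y := (proj v N z).2 - (basis (coords v N n z)).2.
have yE : y = (proj v N z).2 - \sum_(l < n) (proj v N z).2 (d%:Z - 1 - l%:Z) *:
    lmon K (d%:Z - 1 - l%:Z).
  by congr (_ - _); apply: eq_bigr => l _; rewrite mxE.
exists P, Q, (proj v N z).1, y, 0, r; split=> //; split=> //.
- rewrite yE; apply: lcoefsB => //; apply: lcoefs_sum => // l _.
  by apply: (lcoefsZ BB) => //; apply: lcoefs_mon.
- by apply: lord_le_trans o1; lia.
- by rewrite yE; apply: lord_le_sub_mon.
- exact: lcoefs0.
rewrite {1}zE; congr pair; rewrite /= ?subr0 ?addr0 // /y.
by rewrite -!addrA; congr (_ + (_ + _)); rewrite addrC.
Qed.

(** Up to what [coords] sends to 0 modulo p^N, an element of the lattice is a combination of the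
    (t^i, 0); the coefficients of l1 in degrees 0 to n - 1 are the required x. *)
Lemma lattice_coords n z : lattice n z -> exists2 x : 'rV[K]_n, (forall l, B (x 0 l)) &
  forall l, pmul p B N ((coords v N n z - x *m twist_mx v N n) 0 l).
Proof.
move=> [P [Q [l1 [l2 [r1 [r2 [hP hQ [b1 b2] [o1 o2] [h1 h2 ->]]]]]]]].
have [Pg _] := pmul_stable p N hB.
pose x := \row_(i < n) l1 i%:Z; exists x => [l|l]; first by rewrite mxE.
pose l1' := l1 - \sum_(i < n) l1 (n%:Z - 1 - i%:Z) *: lmon K (n%:Z - 1 - i%:Z).
have l1'E : l1' = l1 - \sum_(i < n) l1 i%:Z *: lmon K i%:Z.
  rewrite /l1'; congr (_ - _); rewrite (reindex_inj rev_ord_inj) /=.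
  apply: eq_bigr => i _; have := ltn_ord i => lt.
  by have -> : n%:Z - 1 - (n - i.+1)%N%:Z = i%:Z by lia.
have o1' : lord_le l1' (-1).
  have -> : -1 = n%:Z - 1 - n%:Z by lia.
  exact: lord_le_sub_mon.
have zE : ((val_pos P Q + l1 + r1, val_neg P Q * v + l2 + r2) : W) =
    (val_pos P Q, val_neg P Q * v) + \sum_(i < n) x 0 i *: (lmon K i%:Z, 0) +
    (l1', l2) + (r1, r2).
  have -> : \sum_(i < n) x 0 i *: ((lmon K i%:Z, 0) : W) =
      (\sum_(i < n) l1 i%:Z *: lmon K i%:Z, 0).
    elim/big_rec2: _ => // i f g _ ->; rewrite mxE.
    by congr pair; rewrite /= scaler0 addr0.
  by rewrite l1'E; congr pair; rewrite /= ?addr0 //; ring.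
have -> : coords v N n (val_pos P Q + l1 + r1, val_neg P Q * v + l2 + r2) -
     x *m twist_mx v N n = coords v N n (val_pos P Q, val_neg P Q * v) +
     coords v N n (l1', l2) + coords v N n (r1, r2).
  rewrite zE !linearD linear_sum /= mulmx_sum_row.
  rewrite (eq_bigr (fun i => x 0 i *: row i (twist_mx v N n))) => [|i _]; last first.
    by rewrite linearZ rowK.
  exact: addr_cancel.
rewrite !mxE; apply: addgroupD => //; last first.
  by have [_ k2] := @proj_coefs N (r1, r2) h1 h2; apply: k2.
apply: addgroupD => //; first exact: proj_val.
rewrite proj_small //=; last by apply: lord_le_trans o2; lia.
rewrite o2; first by case: Pg.
by have := ltn_ord l; lia.
Qed.

Lemma lattice_twist_row n (i : 'I_n) : lattice n (@basis n (row i (twist_mx v N n))).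
Proof.
rewrite rowK; set z : W := (lmon K i%:Z, 0).
have Vz : integral z by split; [apply: lcoefs_mon|apply: lcoefs0].
have [P [Q [l1 [l2 [r1 [r2 [hP hQ [b1 b2] [o1 o2] [h1 h2 e]]]]]]]] := @lattice_sub_basis n z Vz.
have [Pg _] := pmul_stable p N hB.
exists (- P), (- Q), (lmon K i%:Z - l1), (- l2), (- r1), (- r2); split.
- exact: pcoefsN.
- exact: pcoefsN.
- by split; [apply: lcoefsB => //; apply: lcoefs_mon|apply: lcoefsN].
- split; last exact: lord_leN.
  apply: lord_leB => //; apply: lord_le_trans (@lord_le_mon _ _).
  by have := ltn_ord i; lia.
split; [exact: lcoefsN|exact: lcoefsN|].
have -> : basis (coords v N n z) = z - (z - basis (coords v N n z)) by rewrite subKr.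
rewrite e /z; congr pair; rewrite /= /val_pos /val_neg !rmorphN /=; ring.
Qed.

Lemma coords_basis n l : coords v N n (@basis n (delta_mx 0 l)) = delta_mx 0 l.
Proof.
have -> : @basis n (delta_mx 0 l) = (0, lmon K (d%:Z - 1 - l%:Z)).
  congr pair; rewrite (bigD1 l) //= big1 => [|k ne]; rewrite mxE eqxx.
    by rewrite eqxx scale1r addr0.
  by rewrite (negbTE ne) scale0r.
apply/rowP => k; rewrite mxE proj_small //=; last first.
  by apply: lord_le_trans (@lord_le_mon _ _); lia.
rewrite lcoef_mon mxE eqxx /=; congr (nat_of_bool _)%:R.
by apply/eqP/eqP => [e|-> //]; apply: val_inj => /=; lia.
Qed.

Lemma coords_integral n z : integral z -> forall l, B (coords v N n z 0 l).
Proof. by move=> /proj_integral [_ h] l; rewrite mxE. Qed.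

Lemma basis_integral n (y : 'rV[K]_n) : (forall l, B (y 0 l)) -> integral (@basis n y).
Proof.
move=> By; split; first exact: lcoefs0.
by apply: lcoefs_sum => // l _; apply: (lcoefsZ BB) => //; apply: lcoefs_mon.
Qed.

Lemma twist_mx_integral n i j : B (twist_mx v N n i j).
Proof.
rewrite mxE; apply: coords_integral; split; first exact: lcoefs_mon.
exact: lcoefs0.
Qed.

End Modulus.

End TwistedProjection.

(** * Vanishing along residue classes *)

Section Conjugates.
Variables (K : numClosedFieldType) (S : laurent K) (D : {poly K}).
Hypothesis SD : S ^+ 2 = D%:L.
Implicit Types (P Q : {poly K}).

Lemma val_posM P Q P' Q' : val_pos S P Q * val_pos S P' Q' =
  val_pos S (P * P' + D * Q * Q') (P * Q' + Q * P').
Proof. by rewrite /val_pos !rmorphD !rmorphM /= -SD; ring. Qed.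

Lemma val_negM P Q P' Q' : val_neg S P Q * val_neg S P' Q' =
  val_neg S (P * P' + D * Q * Q') (P * Q' + Q * P').
Proof. by rewrite /val_neg !rmorphD !rmorphM /= -SD; ring. Qed.

Lemma val_norm P Q : val_pos S P Q * val_neg S P Q = (P ^+ 2 - D * Q ^+ 2)%:L.
Proof. by rewrite /val_pos /val_neg !expr2 rmorphB !rmorphM /= -SD; ring. Qed.

Lemma val_pos_scale P Q (u : {poly K}) : u%:L * val_pos S P Q = val_pos S (u * P) (u * Q).
Proof. by rewrite /val_pos !rmorphM mulrDr mulrA. Qed.

Lemma val_neg_scale P Q (u : {poly K}) : u%:L * val_neg S P Q = val_neg S (u * P) (u * Q).
Proof. by rewrite /val_neg !rmorphM mulrBr mulrA. Qed.

Lemma val_neg_pos P Q : val_neg S P Q = val_pos S P (- Q).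
Proof. by rewrite /val_neg /val_pos rmorphN mulNr. Qed.

Lemma val_pos_neg P Q : val_pos S P Q = val_neg S P (- Q).
Proof. by rewrite /val_neg /val_pos rmorphN mulNr opprK. Qed.

Lemma val_power (A : K -> Prop) P Q n : subring A -> pcoefs A D -> pcoefs A P -> pcoefs A Q ->
  exists P' Q', [/\ pcoefs A P', pcoefs A Q', val_pos S P Q ^+ n = val_pos S P' Q' &
    val_neg S P Q ^+ n = val_neg S P' Q'].
Proof.
move=> hA hD hP hQ; have AG := subring_addgroup hA; have AS := subring_stable hA.
elim: n => [|n [P' [Q' [hP' hQ' ep en]]]].
  exists 1, 0; rewrite /val_pos /val_neg rmorph1 rmorph0 mul0r addr0 subr0.
  by split=> //; [apply: pcoefs1|apply: pcoefs0; case: AG].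
exists (P * P' + D * Q * Q'), (P * Q' + Q * P').
rewrite !exprS ep en val_posM val_negM; split=> //.
  apply: pcoefsD => //; apply: (pcoefsM AS) => //.
  exact: (pcoefsM AS).
by apply: pcoefsD => //; apply: (pcoefsM AS).
Qed.

End Conjugates.

Section Vanishing.
Variables (K : numClosedFieldType) (S : laurent K) (d : nat) (D : {poly K}).
Local Notation L := (laurent K).
Local Notation W := (laurent K * laurent K)%type.
Hypothesis SD : S ^+ 2 = D%:L.
Hypotheses (Sd : lord_le S d%:Z) (Sd0 : S d%:Z != 0).

Definition mulW (f g : L) (z : W) : W := (f * z.1, g * z.2).
Fact mulW_linear f g : linear (mulW f g).
Proof. by move=> a z z'; rewrite /mulW; congr pair; rewrite /= mulrDr lscaleAr. Qed.
HB.instance Definition _ f g := GRing.isLinear.Build K W W _ (mulW f g) (mulW_linear f g).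

(** [rho_neg] is split by components because [panalytic_additive] takes a map of one series. *)
Definition rho_neg1 (f : L) : L := rho_neg S (f, 0).
Definition rho_neg2 (f : L) : L := rho_neg S (0, f).
Definition lcoef_at (n : int) (f : L) : K := f n.
Fact rho_neg1_zmod : zmod_morphism rho_neg1.
Proof. by move=> f g; rewrite /rho_neg1 -linearB; congr (rho_neg S (_, _)); rewrite subr0. Qed.
Fact rho_neg2_zmod : zmod_morphism rho_neg2.
Proof. by move=> f g; rewrite /rho_neg2 -linearB; congr (rho_neg S (_, _)); rewrite subr0. Qed.
Fact lcoef_at_zmod n : zmod_morphism (lcoef_at n).
Proof. by []. Qed.
HB.instance Definition _ := GRing.isZmodMorphism.Build L L rho_neg1 rho_neg1_zmod.
HB.instance Definition _ := GRing.isZmodMorphism.Build L L rho_neg2 rho_neg2_zmod.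
HB.instance Definition _ n := GRing.isZmodMorphism.Build L K (lcoef_at n) (lcoef_at_zmod n).

Variables (p : nat) (B : K -> Prop).
Hypotheses (pp : prime p) (pB : padic p B) (B2 : B (2%:R)^-1).
Hypotheses (BSi : B (S d%:Z)^-1) (BS : lcoefs B S).

Let hB : subring B. Proof. by case: pB. Qed.
Let BG := subring_addgroup hB.
Let BB := subring_stable hB.

Lemma lcoefs_subring : subring (lcoefs B).
Proof.
split; first exact: lcoefs1.
  by move=> f g hf hg; apply: lcoefsB.
by move=> f g hf hg; apply: (lcoefsM BB).
Qed.

Lemma pcoefs_D : pcoefs B D.
Proof. by move=> i; apply: (@lcoefs_polyE _ B); rewrite -SD; apply: lcoefsX. Qed.

(** Factors of opposite degrees e and -e move the two degree bounds in opposite directions, just as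
    the passage from n1 to n2 = n1 + e does. *)
Lemma lattice_mulW N v1 v2 (n1 n2 : nat) (E1 E2 : L) (e : int) :
  lcoefs B E1 -> lcoefs B E2 -> lord_le E1 e -> lord_le E2 (- e) -> n2%:Z = n1%:Z + e ->
  (forall P Q, pcoefs B P -> pcoefs B Q -> exists P' Q', [/\ pcoefs B P', pcoefs B Q',
     lcoefs (pmul p B N) (E1 * val_pos S P Q - val_pos S P' Q') &
     lcoefs (pmul p B N) (E2 * (val_neg S P Q * v1) - val_neg S P' Q' * v2)]) ->
  forall z, lattice S d B p N v1 n1 z -> lattice S d B p N v2 n2 (mulW E1 E2 z).
Proof.
move=> hE1 hE2 o1 o2 ne hO _ [P [Q [l1 [l2 [r1 [r2 [hP hQ [b1 b2] [k1 k2] [h1 h2 ->]]]]]]]].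
have [P' [Q' [hP' hQ' s1 s2]]] := hO P Q hP hQ.
have Up := pmul_stable p N hB; have [Ug _] := Up.
exists P', Q', (E1 * l1), (E2 * l2).
exists (E1 * r1 + (E1 * val_pos S P Q - val_pos S P' Q')).
exists (E2 * r2 + (E2 * (val_neg S P Q * v1) - val_neg S P' Q' * v2)); split=> //.
- by split; apply: (lcoefsM BB).
- split.
    have -> : n2%:Z - 1 = e + (n1%:Z - 1) by lia.
    exact: lord_leM.
  have -> : d%:Z - 1 - n2%:Z = - e + (d%:Z - 1 - n1%:Z) by lia.
  exact: lord_leM.
split; try by apply: lcoefsD => //; apply: (lcoefsM Up).
by rewrite /mulW; congr pair; rewrite /=; ring.
Qed.

Lemma twist_dvd N v1 v2 (n1 n2 : nat) (E1 E2 : L) :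
  lcoefs (pmul p B 2) (v1 - 1) -> lcoefs (pmul p B 2) (v2 - 1) ->
  lcoefs B E1 -> lcoefs B E2 -> lcoefs B E1^-1 -> lcoefs B E2^-1 -> E1 != 0 -> E2 != 0 ->
  (forall z, lattice S d B p N v1 n1 z -> lattice S d B p N v2 n2 (mulW E1 E2 z)) ->
  exists2 x, B x & pmul p B N (\det (twist_mx S d v1 N n1) - \det (twist_mx S d v2 N n2) * x).
Proof.
move=> hv1 hv2 hE1 hE2 hE1' hE2' E10 E20 hM.
apply: (@det_presentation _ B (pmul p B N) W (integral B) (lattice S d B p N v1 n1)
  (lattice S d B p N v2 n2) n1 n2 (coords S d v1 N n1) (coords S d v2 N n2)
  (@basis K d n1) (@basis K d n2) (mulW E1 E2) (mulW E1^-1 E2^-1)) => //.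
- exact: pmul_stable.
- by move=> z; apply: (coords_integral hB B2 BSi BS Sd Sd0 N hv1).
- by move=> y; apply: basis_integral.
- by move=> y; apply: basis_integral.
- exact: (twist_mx_integral hB B2 BSi BS Sd Sd0 N hv1).
- exact: (twist_mx_integral hB B2 BSi BS Sd Sd0 N hv2).
- by move=> z [h1 h2]; split; apply: (lcoefsM BB).
- by move=> z [h1 h2]; split; apply: (lcoefsM BB).
- move=> [f g]; rewrite /mulW /=; congr pair; rewrite mulrA divff // mul1r //.
- by move=> z; apply: (coords_integral hB B2 BSi BS Sd Sd0 N hv2).
- by move=> i; apply: lattice_twist_row.
- by move=> z; apply: lattice_sub_basis.
- by move=> z; apply: lattice_coords.
- by move=> l; apply: coords_basis.
Qed.

(** Without a twist [kap] vanishes and the Neumann series has a single term. The determinant is thus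
    one element of K, common to all N, to which separatedness can be applied. *)
Lemma twist_mx1 N n : twist_mx S d 1 N n = twist_mx S d 1 0 n.
Proof.
have k0 z : kap S 1 z = 0 by rewrite /kap subrr mulr0 oppr0.
have pE M z : proj S 1 M z = pi0 S z.
  rewrite /proj big_ord_recl big1 ?addr0 // => i _.
  by rewrite /= k0 linear0.
by apply/row_matrixP => i; rewrite !rowK; apply/rowP => l; rewrite !mxE !pE.
Qed.

(** The powers of 1 + p^2 w are [panalytic] with series as coefficients; projection and determinant
    only add, multiply and apply additive maps. *)
Lemma panalytic_twist N J n (w : L) : lcoefs B w ->
  panalytic B p J (fun j => \det (twist_mx S d ((1 + (p%:R ^+ 2 : K) *: w) ^+ j) N n)).
Proof.
move=> hw; have hL := lcoefs_subring; have [L0 _] := subring_addgroup hL.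
set v := fun j => (1 + (p%:R ^+ 2 : K) *: w) ^+ j.
have hv : panalytic (lcoefs B) p J v by apply: panalytic_power.
pose good (z : nat -> W) := panalytic (lcoefs B) p J (fun j => (z j).1) /\
  panalytic (lcoefs B) p J (fun j => (z j).2).
have rho_good z : good z -> panalytic (lcoefs B) p J (fun j => rho_neg S (z j)).
  move=> [h1 h2].
  have k1 : panalytic (lcoefs B) p J (rho_neg1 \o (fun j => (z j).1)).
    apply: panalytic_additive h1 => f hf; apply/(lcoefs_pmul0 B p).
    by apply: (rho_neg_coefs hB B2 BSi BS Sd Sd0); apply/(lcoefs_pmul0 B p);
      first [exact: hf | exact: (lcoefs0 BG)].
  have k2 : panalytic (lcoefs B) p J (rho_neg2 \o (fun j => (z j).2)).
    apply: panalytic_additive h2 => f hf; apply/(lcoefs_pmul0 B p).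
    by apply: (rho_neg_coefs hB B2 BSi BS Sd Sd0); apply/(lcoefs_pmul0 B p);
      first [exact: hf | exact: (lcoefs0 BG)].
  apply: panalytic_ext (panalyticD hL k1 k2) => j.
  rewrite /= /rho_neg1 /rho_neg2 -linearD; congr rho_neg.
  by rewrite [RHS]surjective_pairing; congr pair; rewrite /= ?addr0 ?add0r.
have kap_good z : good z -> good (fun j => kap S (v j) (z j)).
  move=> hz; split; first exact: panalytic_const.
  apply: (panalyticN hL); apply: (panalyticM hL); first exact: rho_good.
  by apply: (panalyticD hL) => //; apply: panalytic_const => //; apply: (lcoefsN BG); exact: lcoefs1.
have iter_good z i : good z -> good (fun j => iter i (kap S (v j)) (z j)).
  by move=> hz; elim: i => // i IH; apply: kap_good.
apply: (panalytic_det hB) => i l.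
have h0 : good (fun=> (lmon K i%:Z, 0)).
  split; first by apply: panalytic_const => //; apply: lcoefs_mon.
  exact: panalytic_const.
suff h : panalytic (lcoefs B) p J (fun j => (proj S (v j) N (lmon K i%:Z, 0)).2).
  have := @panalytic_additive _ _ (lcoefs B) B p J (lcoef_at (d%:Z - 1 - l%:Z)) _ _ h.
  move=> /(_ (fun f hf => hf _)); apply: panalytic_ext => j.
  by rewrite !mxE.
apply: (@panalytic_ext _ _ _ _ (fun j => \sum_(k < N.+1)
    (pi0 S (iter k (kap S (v j)) (lmon K i%:Z, 0))).2)).
  move=> j; rewrite /proj; elim/big_rec2: _ => // k f g _ ->.
  by [].
apply: (panalytic_sum _ hL) => k; have [k1 k2] := iter_good _ k h0.
by apply: (panalyticD hL) => //; apply: (panalyticN hL); apply: rho_good; split.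
Qed.

Variables (P0 Q0 w : {poly K}) (k : nat).
Hypotheses (hP0 : pcoefs B P0) (hQ0 : pcoefs B Q0) (hw : pcoefs B w).
Hypothesis (norm0 : P0 ^+ 2 - D * Q0 ^+ 2 = 1 + (p%:R ^+ 2 : K) *: w).

Let E := val_pos S P0 Q0.
Let v : L := 1 + (p%:R ^+ 2 : K) *: w%:L.

Hypotheses (Ek : lord_le E k%:Z) (Ek1 : E k%:Z = 1).

Let Ek0 : E k%:Z != 0. Proof. by rewrite Ek1 oner_eq0. Qed.
Let E0 : E != 0. Proof. by apply: contraNneq Ek0 => ->. Qed.
Let hE : lcoefs B E. Proof. by apply: lcoefs_val_pos. Qed.
Let hEV : lcoefs B E^-1.
Proof. by apply: (lcoefsV hB hE Ek Ek0); rewrite Ek1 invr1; case: hB. Qed.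
Let hwL : lcoefs B w%:L. Proof. by apply: lcoefs_poly => //; case: BG. Qed.

Let Ev : E * val_neg S P0 Q0 = v.
Proof. by rewrite (val_norm SD) norm0 rmorphD rmorph1 /v lscale_poly. Qed.

Let hv1 j : lcoefs (pmul p B 2) (v ^+ j - 1).
Proof.
have Up := pmul_stable p 2 hB; have [Ug _] := Up.
have h : lcoefs (pmul p B 2) (v - 1).
  by rewrite /v addrC addKr => n; rewrite lcoefZ; exists (w%:L n).
have hv : lcoefs B v by apply: (@lcoefs_v _ B hB p).
elim: j => [|j IH]; first by rewrite expr0 subrr; apply: lcoefs0.
have -> : v ^+ j.+1 - 1 = v * (v ^+ j - 1) + (v - 1) by rewrite exprS; ring.
by apply: lcoefsD => //; apply: (lcoefsM Up).
Qed.

Let one1 : lcoefs (pmul p B 2) (1 - 1).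
Proof. by rewrite subrr; apply: lcoefs0; case: (pmul_stable p 2 hB). Qed.

(** A truncated geometric series inverts v modulo p^N by a polynomial u. Then E^-1 may be replaced
    by u times the conjugate of E, which sends polynomial pairs to polynomial pairs. *)
Lemma inverse_norm_mod N j : exists2 u : {poly K}, pcoefs B u &
  lcoefs (pmul p B N) (1 - (v * u%:L) ^+ j).
Proof.
have Bp : B p%:R by apply: subring_nat.
pose y : {poly K} := - ((p%:R ^+ 2 : K) *: w).
have hy : pcoefs B y.
  by apply: pcoefsN => //; apply: (pcoefsZ BB) => //; apply: subringX.
have vE : v = (1 - y)%:L by rewrite /v rmorphB rmorph1 /= /y rmorphN opprK lscale_poly.
have Up := pmul_stable p N hB; have [Ug _] := Up; have [U0 _] := Ug.
exists (\sum_(i < N) y ^+ i).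
  by apply: pcoefs_sum => // i _; apply: pcoefsX.
have e : v * (\sum_(i < N) y ^+ i)%:L = (1 - y ^+ N)%:L.
  rewrite vE -rmorphM; congr poly_laurent.
  by rewrite -[1 - y ^+ N]opprB subrX1 -mulNr opprB.
have hyN : lcoefs (pmul p B N) (y ^+ N)%:L.
  apply: lcoefs_poly => // i; rewrite /y exprNn exprZn -exprM.
  have : pcoefs B ((-1) ^+ N * w ^+ N).
    apply: (pcoefsM BB); last exact: pcoefsX.
    apply: pcoefsX => //; apply: pcoefsN => //; exact: pcoefs1.
  rewrite -scalerAr coefZ => /(_ i) h.
  apply: (@pmul_le _ p B (2 * N)) => //; first by lia.
  by exists ((-1) ^+ N * w ^+ N)`_i.
rewrite e -rmorphXn; elim: j => [|j IH]; first by rewrite expr0 rmorph1 subrr; apply: lcoefs0.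
have -> : 1 - ((1 - y ^+ N) ^+ j.+1)%:L = (1 - y ^+ N)%:L * (1 - ((1 - y ^+ N) ^+ j)%:L) +
    (y ^+ N)%:L by rewrite exprS rmorphM rmorphB rmorph1; ring.
apply: lcoefsD => //; apply: (lcoefsM Up) => //.
apply: lcoefs_poly; first by case: BG.
by apply: pcoefsB => //; [apply: pcoefs1|apply: pcoefsX].
Qed.

(** The map is multiplication by (E^(-j), E^j), which lowers n by j k; modulo p^N the first factor
    is u^j times the j-th power of the conjugate of E. *)
Lemma twist_dvd_down N a j : exists2 x, B x &
  pmul p B N (\det (twist_mx S d 1 0 (a + j * k)) - \det (twist_mx S d (v ^+ j) N a) * x).
Proof.
rewrite -(twist_mx1 N); apply: (@twist_dvd N 1 (v ^+ j) _ _ (E^-1 ^+ j) (E ^+ j)) => //;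
  rewrite ?exprVn ?invrK ?expf_neq0 ?invr_eq0 ?expf_neq0 //; try exact: lcoefsX.
- by rewrite -exprVn; apply: lcoefsX.
- by rewrite -exprVn; apply: lcoefsX.
rewrite -exprVn; apply: (@lattice_mulW N 1 (v ^+ j) _ _ _ _ (- (k%:Z *+ j))).
- exact: lcoefsX.
- exact: lcoefsX.
- by rewrite -mulNrn; apply: lord_leX; apply: lord_leV.
- by rewrite opprK; apply: lord_leX.
- by rewrite -mulr_natr; lia.
move=> P Q hP hQ; have [u hu uE] := inverse_norm_mod N j.
have Up := pmul_stable p N hB.
have [P1 [Q1 [hP1 hQ1 e1 e2]]] := val_power SD j hB pcoefs_D hP0 hQ0.
have hQ1N : pcoefs B (- Q1) by apply: pcoefsN.
have huj : pcoefs B (u ^+ j) by apply: pcoefsX.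
exists (u ^+ j * (P * P1 + D * Q * - Q1)), (u ^+ j * (P * - Q1 + Q * P1)); split.
- apply: (pcoefsM BB) => //; apply: pcoefsD => //; apply: (pcoefsM BB) => //.
  by apply: (pcoefsM BB) => //; apply: pcoefs_D.
- by apply: (pcoefsM BB) => //; apply: pcoefsD => //; apply: (pcoefsM BB).
- rewrite -val_pos_scale -(val_posM SD) -val_neg_pos -e2 -/E rmorphXn /=.
  have -> : E^-1 ^+ j * val_pos S P Q - u%:L ^+ j * (val_pos S P Q * val_neg S P0 Q0 ^+ j) =
      (E^-1 ^+ j * val_pos S P Q) * (1 - (v * u%:L) ^+ j).
    rewrite -Ev !exprMn exprVn; field.
    by rewrite expf_neq0.
  apply: (lcoefsM Up) => //; apply: (lcoefsM BB); first exact: lcoefsX.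
  exact: lcoefs_val_pos.
rewrite -val_neg_scale -(val_negM SD) -val_pos_neg -e1 -/E rmorphXn /= mulr1.
have -> : E ^+ j * val_neg S P Q - u%:L ^+ j * (val_neg S P Q * E ^+ j) * v ^+ j =
    (E ^+ j * val_neg S P Q) * (1 - (v * u%:L) ^+ j) by rewrite exprMn; ring.
apply: (lcoefsM Up) => //; apply: (lcoefsM BB); first exact: lcoefsX.
exact: lcoefs_val_neg.
Qed.

(** Multiplication by (E^j, E^(-j)) respects the lattices exactly, since v^j E^(-j) is the j-th
    power of the conjugate of E. *)
Lemma twist_dvd_up N a j : exists2 x, B x &
  pmul p B N (\det (twist_mx S d (v ^+ j) N a) - \det (twist_mx S d 1 0 (a + j * k)) * x).
Proof.
rewrite -(twist_mx1 N); apply: (@twist_dvd N (v ^+ j) 1 _ _ (E ^+ j) (E^-1 ^+ j)) => //;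
  rewrite ?exprVn ?invrK ?expf_neq0 ?invr_eq0 ?expf_neq0 //; try exact: lcoefsX.
- by rewrite -exprVn; apply: lcoefsX.
- by rewrite -exprVn; apply: lcoefsX.
rewrite -exprVn; apply: (@lattice_mulW N (v ^+ j) 1 _ _ _ _ (k%:Z *+ j)).
- exact: lcoefsX.
- exact: lcoefsX.
- exact: lord_leX.
- by rewrite -mulNrn; apply: lord_leX; apply: lord_leV.
- by rewrite -mulr_natr; lia.
move=> P Q hP hQ; have [Ug _] := pmul_stable p N hB.
have [P1 [Q1 [hP1 hQ1 e1 e2]]] := val_power SD j hB pcoefs_D hP0 hQ0.
exists (P * P1 + D * Q * Q1), (P * Q1 + Q * P1); split.
- apply: pcoefsD => //; apply: (pcoefsM BB) => //.
  by apply: (pcoefsM BB) => //; apply: pcoefs_D.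
- by apply: pcoefsD => //; apply: (pcoefsM BB).
- by rewrite -(val_posM SD) -e1 -/E mulrC subrr; apply: lcoefs0.
rewrite -(val_negM SD) -e2 mulr1 -Ev exprMn exprVn.
have -> : (E ^+ j)^-1 * (val_neg S P Q * (E ^+ j * val_neg S P0 Q0 ^+ j)) -
    val_neg S P Q * val_neg S P0 Q0 ^+ j = 0 by field; rewrite expf_neq0.
exact: lcoefs0.
Qed.

(** Zeros are carried up to the twisted determinants, where [panalytic_hansel] applies, and the
    resulting divisibility is carried back down. With t zeros it is by p^t, and t is arbitrary. *)
Lemma vanishing_class a :
  (forall m, exists2 j, (m <= j)%N & \det (twist_mx S d 1 0 (a + j * k)) = 0) ->
  forall j, \det (twist_mx S d 1 0 (a + j * k)) = 0.
Proof.
move=> inf y; have [_ _ sep] := pB; apply: sep => t.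
have [xs [uxs sxs zxs]] : exists xs : seq nat, [/\ uniq xs, size xs = t &
    forall x, x \in xs -> \det (twist_mx S d 1 0 (a + x * k)) = 0].
  elim: t => [|t [xs [uxs sxs zxs]]]; first by exists [::].
  have [j mj zj] := inf (\sum_(x <- xs) x).+1; exists (j :: xs); split.
  - rewrite /= uxs andbT; apply/negP => jxs; move: mj.
    by rewrite (big_rem j) //=; lia.
  - by rewrite /= sxs.
  by move=> x; rewrite inE => /predU1P[->|/zxs].
have [C hC] := panalytic_hansel pp pB uxs.
(* N - C = t leaves the full precision, and J is large enough for y and all the chosen zeros. *)
pose N := (t + C)%N; pose J := (y + \sum_(x <- xs) x)%N.
have := hC N J _ (panalytic_twist N J a hwL).
move=> /(_ _ y (leq_addr _ _)) hy.
have {}hy : pmul p B t (\det (twist_mx S d (v ^+ y) N a)).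
  apply: pmul_le (hy _) => //; first by rewrite sxs /N; lia.
  move=> x xxs; split; first by rewrite /J (big_rem x) //=; lia.
  have [u Bu] := twist_dvd_up N a x.
  by rewrite (zxs x xxs) mul0r subr0.
have [u Bu hu] := twist_dvd_down N a y.
rewrite -[X in pmul _ _ _ X](subrK (\det (twist_mx S d (v ^+ y) N a) * u)).
apply: addgroupD; first by case: (pmul_stable p t hB).
  by apply: pmul_le hu => //; rewrite /N; lia.
by apply: (stableMr (pmul_stable p t hB)).
Qed.

End Vanishing.

(** * The Pell equation modulo an ideal *)

Lemma pigeonhole (T : finType) (f : nat -> T) : exists i j, (i < j)%N /\ f i = f j.
Proof.
pose g (i : 'I_#|T|.+1) := f i.
have /injectivePn [x [y ne e]] : ~~ injectiveb g.
  by apply/injectiveP => /leq_card; rewrite card_ord ltnn.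
have [lt|gt|/val_inj exy] := ltngtP x y; last by rewrite exy eqxx in ne.
  by exists x, y.
by exists y, x.
Qed.

(** * Degrees and leading coefficients modulo an ideal *)

Section Congruences.
Variables (K : fieldType) (A : K -> Prop).
Hypothesis hA : subring A.
Local Notation L := (laurent K).
Implicit Types (I J : K -> Prop) (f g : L) (x y : K).

Let AG := subring_addgroup hA.
Let AS := subring_stable hA.

Definition mod_le I f (a : int) := forall n, a < n -> I (f n).

(** Cutting f and g off above a and b changes the product by a series with coefficients in I, after
    which the exact rules for degrees apply. *)
Lemma mod_leM I f g a b : stable A I -> lcoefs A f -> lcoefs A g ->
  mod_le I f a -> mod_le I g b ->
  mod_le I (f * g) (a + b) /\ I ((f * g) (a + b) - f a * g b).
Proof.
move=> hI hf hg fa gb; have [Ig IA] := hI; have [I0 _] := Ig; have [A0 _] := AG.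
pose cut (h : L) (c : int) := laurent_ps c (fun k => h (c - k%:Z)).
have cutE h c n : cut h c n = if n <= c then h n else 0.
  rewrite /cut lcoef_ps /psl; case: ifP => // nc; congr (h _); lia.
have cut_le h c : lord_le (cut h c) c by move=> n cn; rewrite cutE leNgt cn.
have cutA h c : lcoefs A h -> lcoefs A (cut h c) by move=> hh n; rewrite cutE; case: ifP.
have cut_mod h c : mod_le I h c -> lcoefs I (h - cut h c).
  move=> hc n; rewrite lcoefB cutE; case: leP => [_|cn]; first by rewrite subrr.
  by rewrite subr0; apply: hc.
have e : f * g = cut f a * cut g b + (f * (g - cut g b) + cut g b * (f - cut f a)) by ring.
have r : lcoefs I (f * (g - cut g b) + cut g b * (f - cut f a)).
  by apply: lcoefsD => //; apply: (lcoefsM hI); auto.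
split.
  move=> n abn; rewrite e lcoefD (lord_leM (cut_le _ _) (cut_le _ _)) // add0r.
  exact: r.
rewrite {1}e lcoefD (lcoefM_top (cut_le _ _) (cut_le _ _)) !cutE !lexx addrC addrA addNr add0r.
exact: r.
Qed.

Lemma exists_top I f : ~ lcoefs I f -> I 0 -> exists2 M, ~ I (f M) & mod_le I f M.
Proof.
move=> nf I0; have [N hN] := lcoef_bounded f.
have ex : exists k : nat, ~~ `[< I (f (N - k%:Z)) >].
  apply: contrapT => nex; apply: nf => n.
  have [/hN -> //|le] := ltP N n; apply: contrapT => nI; apply: nex.
  exists `|N - n|%N; apply/asboolP; have -> // : N - `|N - n|%N%:Z = n by lia.
case: (ex_minnP ex) => k /asboolP nk mk; exists (N - k%:Z) => // n lt.
have [/hN -> //|le] := ltP N n; apply: contrapT => nI.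
suff : (k <= `|N - n|)%N by lia.
by apply: mk; apply/asboolP; have -> // : N - `|N - n|%N%:Z = n by lia.
Qed.

Definition prime_ideal I := ~ I 1 /\ forall x y, A x -> A y -> I (x * y) -> I x \/ I y.

Lemma mod_domain I f g : stable A I -> prime_ideal I -> lcoefs A f -> lcoefs A g ->
  lcoefs I (f * g) -> lcoefs I f \/ lcoefs I g.
Proof.
move=> hI [_ pI] hf hg hfg; have [[I0 IB] _] := hI.
have [|nf] := pselect (lcoefs I f); first by left.
have [|ng] := pselect (lcoefs I g); first by right.
have [M nM hM] := exists_top nf I0; have [N nN hN] := exists_top ng I0.
have [_ h] := mod_leM hI hf hg hM hN.
have : I (f M * g N).
  have -> : f M * g N = (f * g) (M + N) - ((f * g) (M + N) - f M * g N) by ring.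
  exact: IB.
by case/pI.
Qed.

Definition classes I (X : seq K) := (forall y, y \in X -> A y) /\
  forall x, A x -> exists2 y, y \in X & I (x - y).

Lemma classes_distinct I X : stable A I -> classes I X -> exists2 Y, classes I Y &
  uniq Y /\ forall x y, x \in Y -> y \in Y -> I (x - y) -> x = y.
Proof.
move=> [[I0 IB] _]; move: {2}(size X) (leqnn (size X)) => n.
elim: n X => [|n IH] X sX [XA hX].
  have [y] := hX 0 AG.1; move: sX; rewrite leqn0 size_eq0 => /eqP ->.
  by rewrite in_nil.
have uX : classes I (undup X).
  by split=> [y|x /hX [y yX e]]; [rewrite mem_undup; apply: XA|exists y; rewrite ?mem_undup].
have [[x [y [xX yX xy ne]]]|dis] := pselect (exists x y, [/\ x \in undup X, y \in undup X,
    I (x - y) & x != y]); last first.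
  exists (undup X) => //; split=> [|x y xX yX xy]; first exact: undup_uniq.
  by apply/eqP; apply: contrapT => /negP ne; apply: dis; exists x, y.
apply: (IH (rem y (undup X))).
  rewrite size_rem //; have := size_undup X; case: (size (undup X)) => //= k; lia.
have [UA hU] := uX; split=> [z /mem_rem /UA //|z /hU [w wX zw]].
have [wy|nwy] := eqVneq w y; last by exists w => //; rewrite rem_filter ?undup_uniq // mem_filter /= nwy.
exists x; first by rewrite rem_filter ?undup_uniq // mem_filter /= ne.
have -> : z - x = (z - w) - (x - y) by rewrite wy; ring.
exact: IB.
Qed.

Lemma class_index I X : classes I X -> exists cl : K -> 'I_(size X).+1,
  forall x, A x -> (cl x < size X)%N /\ I (x - X`_(cl x)).
Proof.
move=> [XA hX].
suff /choice [cl hcl] : forall x, exists i : 'I_(size X).+1, A x ->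
    (i < size X)%N /\ I (x - X`_i) by exists cl.
move=> x; have [/hX [y yX h]|nA] := pselect (A x); last by exists ord0.
have lt : (index y X < (size X).+1)%N by rewrite ltnS index_size.
by exists (Ordinal lt) => _; rewrite /= index_mem nth_index.
Qed.

(** Two powers of x agree modulo I; as I is prime and does not contain x, the smaller power
    cancels. *)
Lemma finite_domain_power I X x : stable A I -> prime_ideal I -> classes I X -> A x -> ~ I x ->
  exists2 m, (0 < m)%N & I (x ^+ m - 1).
Proof.
move=> hI [I1 pI] hX Ax nx; have [[I0 IB] _] := hI.
have [cl hcl] := class_index hX.
have [i [j [ij e]]] := pigeonhole (fun i => cl (x ^+ i)).
have [_ hi] := hcl _ (subringX i hA Ax); have [_ hj] := hcl _ (subringX j hA Ax).
have {hi hj} h : I (x ^+ i * (x ^+ (j - i) - 1)).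
  have -> : x ^+ i * (x ^+ (j - i) - 1) = x ^+ j - X`_(cl (x ^+ j)) - (x ^+ i - X`_(cl (x ^+ i))).
    have xj : x ^+ j = x ^+ i * x ^+ (j - i) by rewrite -exprD subnKC // ltnW.
    by rewrite e; set c := X`_ _; rewrite xj; ring.
  exact: IB.
exists (j - i)%N; first by rewrite subn_gt0.
have [A1 AB _] := hA.
have nX : ~ I (x ^+ i).
  elim: (i) => [|k IH]; first by rewrite expr0.
  by rewrite exprS => /pI [] //; apply: subringX.
have AX n : A (x ^+ n) by apply: subringX.
by have [] := pI _ _ (AX i) (AB _ _ (AX _) A1) h.
Qed.

End Congruences.

Section PellModulo.
Variables (K : numClosedFieldType) (S : laurent K) (d : nat) (D : {poly K}) (A : K -> Prop).
Local Notation L := (laurent K).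
Hypotheses (SD : S ^+ 2 = D%:L) (Sd : lord_le S d%:Z) (Sd0 : S d%:Z != 0) (d0 : (0 < d)%N).
Hypotheses (hA : subring A) (A2 : A (2%:R)^-1) (ASi : A (S d%:Z)^-1) (AS : lcoefs A S).
(** A coefficient of negative index that is a unit of A keeps S from becoming a polynomial modulo
    any prime ideal. *)
Variable m0 : int.
Hypotheses (m0neg : m0 < 0) (Sm0 : S m0 != 0) (ASm0 : A (S m0)^-1).
Implicit Types (I J : K -> Prop) (f g : L) (P Q : {poly K}) (k : nat).

Let AG := subring_addgroup hA.
Let AA := subring_stable hA.
Let A0 : A 0. Proof. by case: AG. Qed.
Let A1 : A 1. Proof. by case: hA. Qed.

Let hD : pcoefs A D.
Proof. by move=> i; apply: (@lcoefs_polyE _ A); rewrite -SD; apply: lcoefsX. Qed.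

Lemma lcoefs_of_pcoefs I P : I 0 -> pcoefs I P -> lcoefs I P%:L.
Proof. by move=> I0 hP; apply: lcoefs_poly. Qed.

Lemma pcoefs_of_lcoefs I P : lcoefs I P%:L -> pcoefs I P.
Proof. by move=> hP i; apply: lcoefs_polyE. Qed.

Lemma lcoefs_pos P Q : pcoefs A P -> pcoefs A Q -> lcoefs A (val_pos S P Q).
Proof. by move=> hP hQ; apply: lcoefs_val_pos. Qed.

Lemma lcoefs_neg P Q : pcoefs A P -> pcoefs A Q -> lcoefs A (val_neg S P Q).
Proof. by move=> hP hQ; apply: lcoefs_val_neg. Qed.

Lemma ideal_val_pos I P Q : stable A I -> pcoefs I P -> pcoefs I Q -> lcoefs I (val_pos S P Q).
Proof.
move=> hI hP hQ; have [Ig _] := hI; have [I0 _] := Ig.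
apply: lcoefsD => //; first exact: lcoefs_of_pcoefs.
by rewrite mulrC; apply: (lcoefsM hI) => //; apply: lcoefs_of_pcoefs.
Qed.

Definition norm P Q : {poly K} := P ^+ 2 - D * Q ^+ 2.

Lemma norm_coefs P Q : pcoefs A P -> pcoefs A Q -> pcoefs A (norm P Q).
Proof.
move=> hP hQ; apply: pcoefsB => //; first exact: pcoefsX.
by apply: (pcoefsM AA) => //; apply: pcoefsX.
Qed.

Lemma norm_mod I P Q P' Q' : stable A I -> pcoefs A P -> pcoefs A Q -> pcoefs A P' ->
  pcoefs A Q' -> pcoefs I (P - P') -> pcoefs I (Q - Q') -> pcoefs I (norm P Q - norm P' Q').
Proof.
move=> hI hP hQ hP' hQ' eP eQ; have [Ig _] := hI.
have -> : norm P Q - norm P' Q' = (P + P') * (P - P') - (D * (Q + Q')) * (Q - Q').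
  by rewrite /norm; ring.
apply: pcoefsB => //; apply: (pcoefsM hI) => //; first exact: pcoefsD.
by apply: (pcoefsM AA) => //; apply: pcoefsD.
Qed.

(** Only the norm equation is modulo I. Degree and leading coefficient are exact, so that P + Q S
    has an inverse with coefficients in A and of degree exactly -k. *)
Definition pell I := exists k P Q, [/\ (0 < k)%N, pcoefs A P, pcoefs A Q,
  lord_le (val_pos S P Q) k%:Z /\ val_pos S P Q k%:Z = 1 & pcoefs I (norm P Q - 1)].

Lemma unit_inverse f (k : int) : lcoefs A f -> lord_le f k -> f k = 1 ->
  [/\ f != 0, lcoefs A f^-1, lord_le f^-1 (- k) & f^-1 (- k) = 1].
Proof.
move=> hf fk fk1; have fk0 : f k != 0 by rewrite fk1 oner_eq0.
split; first by apply: contraNneq fk0 => ->.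
- by apply: (lcoefsV hA hf fk fk0); rewrite fk1 invr1.
- exact: lord_leV.
by rewrite lcoefV_top // fk1 invr1.
Qed.

Lemma poly_pos_neg P Q : P%:L = (2%:R : K)^-1 *: (val_pos S P Q + val_neg S P Q) /\
  Q%:L = (val_pos S P Q - val_neg S P Q) * (2%:R * S)^-1.
Proof.
have h : 2%:R * S != 0 by apply: contraNneq (twoS_neq0 Sd0) => ->.
rewrite /val_pos /val_neg; split.
  rewrite addrACA subrr addr0 -mulr2n -mulr_natl [2%:R * _]mulr_natl -scaler_nat scalerA.
  by rewrite mulVf ?scale1r // pnatr_eq0.
by rewrite (_ : _ - _ = Q%:L * (2%:R * S)) ?mulfK //; ring.
Qed.

(** Modulo I the conjugate of E is E^-1, of degree -k. Hence the coefficients of P above degree k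
    and of Q above degree k - d lie in I and can be erased; a multiple of t^k then corrects the
    leading coefficient. *)
Lemma pell_of_mod I k P Q : stable A I -> (0 < k)%N -> pcoefs A P -> pcoefs A Q ->
  mod_le I (val_pos S P Q) k%:Z -> I (val_pos S P Q k%:Z - 1) ->
  pcoefs I (norm P Q - 1) -> pell I.
Proof.
move=> hI k0 hP hQ hk hk1 hN; have [Ig IA] := hI; have [I0 IB] := Ig.
set E := val_pos S P Q in hk hk1; have hE : lcoefs A E by apply: lcoefs_pos.
(* E is replaced by a congruent series of exact degree k and leading coefficient 1, which is
   invertible over A. *)
pose E1 := laurent_ps k%:Z (fun i => if i == 0%N then 1 else E (k%:Z - i%:Z)).
have E1k : E1 k%:Z = 1 by rewrite lcoef_ps /psl lexx subrr.
have E1le : lord_le E1 k%:Z by move=> n kn; rewrite lcoef_ps /psl leNgt kn.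
have E1A : lcoefs A E1.
  by move=> n; rewrite lcoef_ps /psl; case: ifP => // _; case: ifP.
have EE1 : lcoefs I (E - E1).
  move=> n; rewrite lcoefB lcoef_ps /psl; case: (ltgtP n k%:Z) => [lt|gt|->].
  - rewrite ifF; last by lia.
    have -> : k%:Z - `|k%:Z - n|%N%:Z = n by lia.
    by rewrite subrr.
  - by rewrite subr0; apply: hk.
  - by rewrite subrr.
have [E10 E1VA E1Vle E1V] := unit_inverse E1A E1le E1k.
have nE : lcoefs A (val_neg S P Q) by apply: lcoefs_neg.
have hN' : lcoefs I (val_neg S P Q - E1^-1).
  have -> : val_neg S P Q - E1^-1 = E1^-1 * ((norm P Q - 1)%:L - val_neg S P Q * (E - E1)).
    by rewrite rmorphB rmorph1 /= -(val_norm SD) -/E; field.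
  apply: (lcoefsM hI) => //; apply: lcoefsB => //; first exact: lcoefs_of_pcoefs.
  exact: (lcoefsM hI).
have neg_le : mod_le I (val_neg S P Q) (- k%:Z).
  move=> n kn; have := hN' n; rewrite lcoefB E1Vle // subr0; exact.
have [eP eQ] := poly_pos_neg P Q.
have Phigh i : (k < i)%N -> I P`_i.
  move=> ki; rewrite -lcoef_poly eP lcoefZ lcoefD; apply: IA => //.
  by apply: addgroupD => //; [apply: hk|apply: neg_le]; lia.
have Qhigh i : (k < i + d)%N -> I Q`_i.
  move=> ki; rewrite -lcoef_poly eQ.
  have h1 : mod_le I (E - val_neg S P Q) k%:Z.
    by move=> n kn; rewrite lcoefB; apply: IB; [apply: hk|apply: neg_le; lia].
  have h2 : mod_le I (2%:R * S)^-1 (- d%:Z).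
    by move=> n dn; rewrite (lord_leV (twoS_le Sd) (twoS_neq0 Sd0)).
  have [h _] := mod_leM hA hI (lcoefsB AG hE nE) (lcoefs_twoSV hA A2 ASi AS Sd Sd0) h1 h2.
  by apply: h; lia.
pose P1 := take_poly k.+1 P; pose Q1 := take_poly (k.+1 - d) Q.
have hP1 : pcoefs A P1 by move=> i; rewrite coef_take_poly; case: ifP.
have hQ1 : pcoefs A Q1 by move=> i; rewrite coef_take_poly; case: ifP.
have PP1 : pcoefs I (P - P1).
  move=> i; rewrite coefB coef_take_poly; case: ltnP => [_|le]; first by rewrite subrr.
  by rewrite subr0; apply: Phigh.
have QQ1 : pcoefs I (Q - Q1).
  move=> i; rewrite coefB coef_take_poly; case: ltnP => [_|le]; first by rewrite subrr.
  by rewrite subr0; apply: Qhigh; lia.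
have E1'le : lord_le (val_pos S P1 Q1) k%:Z.
  apply: lord_leD; first by apply: lord_le_poly; apply: size_take_poly.
  have [le|lt] := leqP d k.
    have -> : k%:Z = (k - d)%N%:Z + d%:Z by lia.
    apply: lord_leM => //; apply: lord_le_poly; apply: leq_trans (size_take_poly _ _) _; lia.
  have -> : Q1 = 0.
    by rewrite /Q1 (_ : (k.+1 - d)%N = 0%N) ?take_poly0l //; lia.
  by rewrite rmorph0 mul0r.
pose c := 1 - val_pos S P1 Q1 k%:Z.
have Ic : I c.
  have -> : c = (E k%:Z - val_pos S P1 Q1 k%:Z) - (E k%:Z - 1) by rewrite /c; ring.
  apply: IB => //; rewrite -lcoefB.
  have -> : E - val_pos S P1 Q1 = val_pos S (P - P1) (Q - Q1).
    by rewrite /E /val_pos !rmorphB /=; ring.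
  exact: ideal_val_pos.
have Ac : A c by case: hA => _ AB _; apply: AB => //; apply: lcoefs_pos.
have hcX (U : K -> Prop) : U 0 -> U c -> pcoefs U (c *: 'X^k).
  move=> U0 Uc i; rewrite coefZ coefXn; case: eqP => _; by rewrite ?mulr1 ?mulr0.
exists k, (P1 + c *: 'X^k), Q1.
have e : val_pos S (P1 + c *: 'X^k) Q1 = val_pos S P1 Q1 + c *: lmon K k%:Z.
  by rewrite /val_pos rmorphD /= lmon_poly lscale_poly addrAC.
have hP2 : pcoefs A (P1 + c *: 'X^k) by apply: pcoefsD => //; apply: hcX.
split=> //.
  rewrite e; split.
    by apply: lord_leD => //; apply: lord_leZ; apply: lord_le_mon.
  by rewrite lcoefD lcoefZ lcoef_mon eqxx mulr1 /c addrC subrK.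
have -> : norm (P1 + c *: 'X^k) Q1 - 1 = (norm P Q - 1) - (norm P Q - norm (P1 + c *: 'X^k) Q1).
  by ring.
apply: pcoefsB => //; apply: norm_mod => //.
by rewrite opprD addrA; apply: pcoefsB => //; apply: hcX.
Qed.

Lemma norm_power P Q n P' Q' : val_pos S P Q ^+ n = val_pos S P' Q' ->
  val_neg S P Q ^+ n = val_neg S P' Q' -> norm P' Q' = norm P Q ^+ n.
Proof.
move=> e1 e2; apply: lpoly_inj.
by rewrite -(val_norm SD) -e1 -e2 -exprMn (val_norm SD) rmorphXn.
Qed.

Lemma power_mod I (U V : {poly K}) n : stable A I -> pcoefs A U -> pcoefs A V ->
  pcoefs I (U - V) -> pcoefs I (U ^+ n - V ^+ n).
Proof.
move=> hI hU hV h; have [Ig _] := hI; have [I0 _] := Ig.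
elim: n => [|n IH]; first by rewrite !expr0 subrr; apply: pcoefs0.
have -> : U ^+ n.+1 - V ^+ n.+1 = U * (U ^+ n - V ^+ n) + V ^+ n * (U - V).
  by rewrite !exprS; ring.
by apply: pcoefsD => //; apply: (pcoefsM hI) => //; apply: pcoefsX.
Qed.

Lemma pell_power I k P Q n : stable A I -> (0 < k)%N -> (0 < n)%N ->
  pcoefs A P -> pcoefs A Q -> lord_le (val_pos S P Q) k%:Z -> val_pos S P Q k%:Z = 1 ->
  exists P' Q', [/\ pcoefs A P', pcoefs A Q', lord_le (val_pos S P' Q') (k * n)%N%:Z,
    val_pos S P' Q' (k * n)%N%:Z = 1 & norm P' Q' = norm P Q ^+ n].
Proof.
move=> hI k0 n0 hP hQ hk hk1.
have [P' [Q' [hP' hQ' e1 e2]]] := val_power SD n hA hD hP hQ.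
have kn : (k * n)%N%:Z = k%:Z *+ n by rewrite -mulr_natr; lia.
exists P', Q'; split=> //.
- by rewrite -e1 kn; apply: lord_leX.
- by rewrite -e1 kn lcoefX_top // hk1 expr1n.
exact: norm_power.
Qed.

(* Modulo I the quotient of two solutions has norm 1, degree 0 and leading
   coefficient 1, hence it is 1. *)
Lemma pell_unique I k P1 Q1 P2 Q2 : stable A I ->
  pcoefs A P1 -> pcoefs A Q1 -> pcoefs A P2 -> pcoefs A Q2 ->
  lord_le (val_pos S P1 Q1) k%:Z -> val_pos S P1 Q1 k%:Z = 1 ->
  lord_le (val_pos S P2 Q2) k%:Z -> val_pos S P2 Q2 k%:Z = 1 ->
  pcoefs I (norm P1 Q1 - 1) -> pcoefs I (norm P2 Q2 - 1) ->
  pcoefs I (P1 - P2) /\ pcoefs I (Q1 - Q2).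
Proof.
move=> hI hP1 hQ1 hP2 hQ2 k1 l1 k2 l2 n1 n2; have [Ig IA] := hI; have [I0 IB] := Ig.
set E1 := val_pos S P1 Q1 in k1 l1; set E2 := val_pos S P2 Q2 in k2 l2.
have [E10 V1A V1le V1] := unit_inverse (lcoefs_pos hP1 hQ1) k1 l1.
have [E20 V2A V2le V2] := unit_inverse (lcoefs_pos hP2 hQ2) k2 l2.
have negV P Q : pcoefs A P -> pcoefs A Q -> val_pos S P Q != 0 ->
    lcoefs A (val_pos S P Q)^-1 -> pcoefs I (norm P Q - 1) ->
    lcoefs I (val_neg S P Q - (val_pos S P Q)^-1).
  move=> hP hQ h0 hV hn.
  have -> : val_neg S P Q - (val_pos S P Q)^-1 = (val_pos S P Q)^-1 * (norm P Q - 1)%:L.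
    by rewrite rmorphB rmorph1 /= -(val_norm SD); field.
  by apply: (lcoefsM hI) => //; apply: lcoefs_of_pcoefs.
pose X := P1 * P2 + D * Q1 * - Q2; pose Y := P1 * - Q2 + Q1 * P2.
have hQ2N : pcoefs A (- Q2) by apply: pcoefsN.
have hX : pcoefs A X.
  by apply: pcoefsD => //; apply: (pcoefsM AA) => //; apply: (pcoefsM AA).
have hY : pcoefs A Y by apply: pcoefsD => //; apply: (pcoefsM AA).
have posE : lcoefs I (val_pos S X Y - E1 * E2^-1).
  rewrite -(val_posM SD) -val_neg_pos -/E1 -mulrBr; apply: (lcoefsM hI).
    exact: lcoefs_pos.
  exact: negV.
have negE : lcoefs I (val_neg S X Y - E1^-1 * E2).
  rewrite -(val_negM SD) -val_pos_neg -/E2 -mulrBl mulrC; apply: (lcoefsM hI).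
    exact: lcoefs_pos.
  exact: negV.
have o12 : lord_le (E1 * E2^-1) 0 by rewrite -(subrr k%:Z); apply: lord_leM.
have o21 : lord_le (E1^-1 * E2) 0 by rewrite -(addNr k%:Z); apply: lord_leM.
have t12 : (E1 * E2^-1) 0 = 1 by rewrite -(subrr k%:Z) lcoefM_top // l1 V2 mulr1.
have t21 : (E1^-1 * E2) 0 = 1 by rewrite -(addNr k%:Z) lcoefM_top // l2 V1 mulr1.
have eqm f g n : lcoefs I (f - g) -> I (g n) -> I (f n).
  by move=> h hg; rewrite -[f n](subrK (g n)) -lcoefB; apply: addgroupD.
have [eP eQ] := poly_pos_neg X Y.
have X1 : pcoefs I (X - 1).
  case=> [|i]; rewrite coefB coef1 -lcoef_poly eP lcoefZ.
    have -> : (2%:R)^-1 * (val_pos S X Y + val_neg S X Y) 0%N%:Z - (0 == 0)%N%:R =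
        (2%:R)^-1 * ((val_pos S X Y - E1 * E2^-1) 0 + (val_neg S X Y - E1^-1 * E2) 0).
      rewrite (_ : 0%N%:Z = 0) // (lcoefB (val_pos S X Y)) (lcoefB (val_neg S X Y) (_ * _)).
      rewrite lcoefD t12 t21 eqxx mulr1n.
      by field.
    by apply: IA => //; apply: addgroupD.
  rewrite subr0 lcoefD; apply: IA => //; apply: addgroupD => //.
    by apply: eqm posE _; rewrite o12.
  by apply: eqm negE _; rewrite o21.
have Y0 : pcoefs I Y.
  move=> i; rewrite -lcoef_poly eQ.
  have h1 : mod_le I (val_pos S X Y - val_neg S X Y) (-1).
    move=> n n0; rewrite lcoefB.
    have -> : val_pos S X Y n - val_neg S X Y n = (val_pos S X Y - E1 * E2^-1) n -
       (val_neg S X Y - E1^-1 * E2) n + ((E1 * E2^-1) n - (E1^-1 * E2) n).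
      by rewrite (lcoefB (val_pos S X Y)) (lcoefB (val_neg S X Y) (_ * _)); ring.
    apply: addgroupD => //; first exact: IB.
    have [->|ne] := eqVneq n 0; first by rewrite t12 t21 subrr.
    by rewrite o12 ?o21 ?subrr //; lia.
  have h2 : mod_le I (2%:R * S)^-1 (- d%:Z).
    by move=> n dn; rewrite (lord_leV (twoS_le Sd) (twoS_neq0 Sd0)).
  have [h _] := mod_leM hA hI (lcoefsB AG (lcoefs_pos hX hY) (lcoefs_neg hX hY))
     (lcoefs_twoSV hA A2 ASi AS Sd Sd0) h1 h2.
  by apply: h; lia.
split.
  have -> : P1 - P2 = P2 * (X - 1) + D * Q2 * Y - P1 * (norm P2 Q2 - 1).
    by rewrite /X /Y /norm; ring.
  apply: pcoefsB => //; last exact: (pcoefsM hI).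
  apply: pcoefsD => //; apply: (pcoefsM hI) => //; exact: (pcoefsM AA).
have -> : Q1 - Q2 = Q2 * (X - 1) + P2 * Y - Q1 * (norm P2 Q2 - 1).
  by rewrite /X /Y /norm; ring.
apply: pcoefsB => //; last exact: (pcoefsM hI).
by apply: pcoefsD => //; apply: (pcoefsM hI).
Qed.

(** If the norm is 1 + z with z^2 = 0 modulo I, then its e-th power is 1 + e z, hence 1, because e
    lies in I. *)
Lemma pell_nilpotent I J e : stable A I -> stable A J -> (forall x y, J x -> J y -> I (x * y)) ->
  (0 < e)%N -> I e%:R -> (forall x, J x -> A x) -> pell J -> pell I.
Proof.
move=> hI hJ JJ e0 Ie JA [k [P [Q [k0 hP hQ [hk hk1] hN]]]].
have [Ig IA] := hI; have [I0 IB] := Ig.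
have [P' [Q' [hP' hQ' hk' hk1' nE]]] := pell_power hJ k0 e0 hP hQ hk hk1.
exists (k * e)%N, P', Q'; split=> //; first by rewrite muln_gt0 k0.
have [z zE] : exists z, norm P Q = z + 1 by exists (norm P Q - 1); rewrite subrK.
rewrite zE addrK in hN.
have hz : pcoefs A z by move=> i; apply: JA.
have hz2 : pcoefs I (z * z).
  by move=> i; rewrite coefM; apply: addgroup_sum => // j _; apply: JJ.
suff H n : exists2 u, pcoefs A u & (z + 1) ^+ n - 1 = z *+ n + u * (z * z).
  rewrite nE zE; have [u hu ->] := H e; apply: pcoefsD => //; last exact: (pcoefsM hI).
  rewrite -mulr_natr mulrC -polyC_natr mulrC; apply: (pcoefsM hI) => //.
  exact: pcoefsC.
elim: n => [|n [u hu IH]].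
  exists 0; first exact: pcoefs0.
  by rewrite expr0 subrr mulr0n mul0r addr0.
exists (u * (z + 1) + n%:R).
  apply: pcoefsD => //; last by rewrite -polyC_natr; apply: pcoefsC => //; apply: subring_nat.
  apply: (pcoefsM AA) => //; apply: pcoefsD => //; exact: pcoefs1.
have -> : (z + 1) ^+ n.+1 - 1 = ((z + 1) ^+ n - 1) * (z + 1) + z by rewrite exprSr; ring.
by rewrite IH mulrS -mulr_natr; ring.
Qed.

(** * Lagrange's argument modulo a prime ideal *)

Section PrimeModulus.
Variables (I : K -> Prop) (X : seq K).
Hypotheses (hI : stable A I) (pI : prime_ideal A I) (IA : forall x, I x -> A x).
Hypothesis (hX : classes A I X).

Let Ig : addgroup I. Proof. by case: hI. Qed.
Let I0 : I 0. Proof. by case: Ig. Qed.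

(* If S were rational modulo I, the continued fraction algorithm would
   decrease the degree of its denominator forever. *)
Lemma irrational_mod P Q : pcoefs A P -> pcoefs A Q -> lcoefs I (val_pos S P Q) ->
  pcoefs I P /\ pcoefs I Q.
Proof.
have [n hn] : exists n : nat, forall i, (n <= i)%N -> I Q`_i.
  by exists (size Q) => i /leq_sizeP le; rewrite nth_default //; apply/leq_sizeP.
have Iprod f g : lcoefs A f -> lcoefs I g -> lcoefs I (f * g) by apply: lcoefsM.
pose a := polypart S; pose s := S - a%:L.
have ha : pcoefs A a by move=> i; rewrite coef_polypart.
have hs : lcoefs A s by apply: lcoefsB => //; apply: lcoefs_of_pcoefs.
have finish P' Q' : pcoefs A P' -> pcoefs A Q' -> lcoefs I (val_pos S P' Q') ->
    pcoefs I Q' -> pcoefs I P' /\ pcoefs I Q'.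
  move=> hP hQ h hQ'; split=> //; apply: pcoefs_of_lcoefs.
  have -> : P'%:L = val_pos S P' Q' - S * Q'%:L by rewrite /val_pos mulrC addrK.
  by apply: lcoefsB => //; apply: Iprod => //; apply: lcoefs_of_pcoefs.
elim: n P Q hn => [|n IH] P Q hn hP hQ h; first by apply: finish => // i; apply: hn.
apply: finish => //.
(* Multiplication by S + a turns Q into P', and modulo I one has P' = - Q s with s of negative
   degree. *)
pose P' := P + Q * a; pose r := D - a ^+ 2.
have hP' : pcoefs A P' by apply: pcoefsD => //; apply: (pcoefsM AA).
have hr : pcoefs A r by apply: pcoefsB => //; apply: pcoefsX.
have P'E : P'%:L = val_pos S P Q - Q%:L * s.
  by rewrite /P' /val_pos /s rmorphD rmorphM /=; ring.
have [||||_ IP'] := IH (a * P' + Q * r) P'.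
- move=> i ni; rewrite -lcoef_poly P'E lcoefB; apply: Ig.2; first exact: h.
  have hQn : mod_le I Q%:L n%:Z.
    case=> [j|//]; rewrite ltz_nat => nj; rewrite lcoef_poly; exact: hn.
  have hs1 : mod_le I s (-1) by move=> j hj; rewrite lord_le_polypart.
  have [hle _] := mod_leM hA hI (lcoefs_of_pcoefs A0 hQ) hs hQn hs1.
  by apply: hle; lia.
- by apply: pcoefsD => //; apply: (pcoefsM AA).
- by [].
- have -> : val_pos S (a * P' + Q * r) P' = (S + a%:L) * val_pos S P Q.
    by rewrite /val_pos /P' /r expr2 !(rmorphD, rmorphB, rmorphM) /= -SD; ring.
  by apply: Iprod => //; apply: lcoefsD => //; apply: lcoefs_of_pcoefs.
have IQs : lcoefs I (Q%:L * s).
  have -> : Q%:L * s = val_pos S P Q - P'%:L by rewrite P'E; ring.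
  by apply: lcoefsB => //; apply: lcoefs_of_pcoefs.
have [|Is] := mod_domain hA hI pI (lcoefs_of_pcoefs A0 hQ) hs IQs.
  exact: pcoefs_of_lcoefs.
(* The series s keeps the unit coefficient S m0, so it cannot vanish modulo I. *)
have [nI1 _] := pI; case: nI1; rewrite -(mulVf Sm0); apply: hI.2 => //.
have -> : S m0 = s m0; last exact: Is.
by rewrite /s lcoefB; case: m0 m0neg => // k _; rewrite subr0.
Qed.

Lemma norm_mod_neq0 P Q : pcoefs A P -> pcoefs A Q -> ~ (pcoefs I P /\ pcoefs I Q) ->
  [/\ ~ lcoefs I (val_pos S P Q), ~ lcoefs I (val_neg S P Q) & ~ pcoefs I (norm P Q)].
Proof.
move=> hP hQ nPQ.
have n1 : ~ lcoefs I (val_pos S P Q) by move=> h; apply: nPQ; apply: irrational_mod.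
have n2 : ~ lcoefs I (val_neg S P Q).
  rewrite val_neg_pos => /irrational_mod [||h1 h2] //; first exact: pcoefsN.
  by apply: nPQ; split=> //; rewrite -[Q]opprK; apply: pcoefsN.
split=> // /(lcoefs_of_pcoefs I0); rewrite -(val_norm SD).
by move/(mod_domain hA hI pI (lcoefs_pos hP hQ) (lcoefs_neg hP hQ)) => [].
Qed.

(** Box principle over the finite ring A / I: P and Q together have u = 2 n + 2 - d coefficients to
    choose, and the coefficients of P - Q S in degrees d - n to n impose u - 1 conditions. *)
Lemma exists_small n : (d <= n)%N -> exists P Q, [/\ pcoefs A P, pcoefs A Q,
  ~ (pcoefs I P /\ pcoefs I Q), lord_le (val_pos S P Q) n%:Z &
  mod_le I (val_neg S P Q) (d%:Z - 1 - n%:Z)].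
Proof.
move=> dn; have [Y hY [uY dY]] := classes_distinct hA hI hX.
have [YA hYc] := hY; have [cl hcl] := class_index hY.
pose q := (size Y); have q1 : (1 < q)%N.
  have [y0 y0Y e0] := hYc 0 A0; have [y1 y1Y e1] := hYc 1 A1.
  have ne : y0 != y1.
    apply/eqP => e; case: pI => nI1 _; apply: nI1.
    have -> : 1 = (1 - y1) - (0 - y0) by rewrite e; ring.
    exact: Ig.2.
  rewrite /q; case: Y y0Y y1Y {hY uY dY YA hYc cl hcl q} => [|a [|b Y]] //.
  by rewrite !inE => /eqP e /eqP e'; rewrite e e' eqxx in ne.
pose u := (n.+1 + (n.+1 - d))%N.
pose co (f : {ffun 'I_u -> 'I_q}) (i : nat) : K :=
  if insub i is Some j then Y`_(f j) else 0.
have coA h i : A (co h i).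
  by rewrite /co; case: insub => // j; apply: YA; apply: mem_nth.
pose Pf h : {poly K} := \poly_(i < n.+1) co h i.
pose Qf h : {poly K} := \poly_(i < n.+1 - d) co h (n.+1 + i)%N.
have hPf h : pcoefs A (Pf h) by move=> i; rewrite coef_poly; case: ifP.
have hQf h : pcoefs A (Qf h) by move=> i; rewrite coef_poly; case: ifP.
pose val h (c : nat) := val_neg S (Pf h) (Qf h) (d%:Z - n%:Z + c%:Z).
have valA h c : A (val h c) by apply: lcoefs_neg.
have cl_lt h c : (cl (val h c) < q)%N by have [] := hcl _ (valA h c).
pose out h : {ffun 'I_u.-1 -> 'I_q} := [ffun c : 'I_u.-1 => Ordinal (cl_lt h c)].
have /injectivePn [f [g ne e]] : ~~ injectiveb out.
  apply/injectiveP => /leq_card; rewrite !card_ffun !card_ord leq_exp2l //.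
  by rewrite /u; lia.
exists (Pf f - Pf g), (Qf f - Qf g); split.
- exact: pcoefsB.
- exact: pcoefsB.
- move=> [h1 h2]; case/eqP: ne; apply/ffunP => j; apply: val_inj => /=.
  apply/eqP; rewrite -(nth_uniq 0 _ _ uY) ?ltn_ord //; apply/eqP.
  have coE h : co h j = Y`_(h j) by rewrite /co valK.
  have I1 : I (co f j - co g j).
    have [lt|le] := ltnP j n.+1.
      by have := h1 j; rewrite coefB !coef_poly lt.
    have := h2 (j - n.+1)%N; rewrite coefB !coef_poly subnKC //.
    by rewrite ltn_subLR // ltn_ord.
  by apply: dY; rewrite ?mem_nth ?ltn_ord // -!coE.
- apply: lord_leD.
    apply: lord_le_poly; apply: leq_trans (size_polyD _ _) _.
    by rewrite geq_max size_polyN !size_poly.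
  have -> : n%:Z = (n - d)%N%:Z + d%:Z by lia.
  apply: lord_leM => //; apply: lord_le_poly; apply: leq_trans (size_polyD _ _) _.
  by rewrite geq_max size_polyN -subSn // !size_poly.
move=> i hi.
have vE : val_neg S (Pf f - Pf g) (Qf f - Qf g) =
    val_neg S (Pf f) (Qf f) - val_neg S (Pf g) (Qf g).
  by rewrite /val_neg !rmorphB /=; ring.
have [le|lt] := leP i n%:Z; last first.
  have : lord_le (val_neg S (Pf f - Pf g) (Qf f - Qf g)) n%:Z.
    apply: lord_leB.
      apply: lord_le_poly; apply: leq_trans (size_polyD _ _) _.
      by rewrite geq_max size_polyN !size_poly.
    have -> : n%:Z = (n - d)%N%:Z + d%:Z by lia.
    apply: lord_leM => //; apply: lord_le_poly; apply: leq_trans (size_polyD _ _) _.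
    by rewrite geq_max size_polyN -subSn // !size_poly.
  by move=> ->.
have lt : (`|(i - (d%:Z - n%:Z))%R|%N < u.-1)%N by rewrite /u; lia.
have ev (h : {ffun 'I_u -> 'I_q}) :
    val_neg S (Pf h) (Qf h) i = val h `|(i - (d%:Z - n%:Z))%R|%N.
  by rewrite /val; congr lcoef; lia.
rewrite vE lcoefB !ev; set c := `|_|%N in lt *.
have [_ hf] := hcl _ (valA f c); have [_ hg] := hcl _ (valA g c).
have ecl : cl (val f c) = cl (val g c) :> nat.
  have := congr1 (fun o : {ffun 'I_u.-1 -> 'I_q} => o (Ordinal lt)) e.
  by rewrite !ffunE => -[].
have -> : val f c - val g c = (val f c - Y`_(cl (val f c))) - (val g c - Y`_(cl (val g c))).
  by rewrite ecl; ring.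
exact: Ig.2.
Qed.

(** Modulo I the norm has degree below d, so it is a scalar times a monic N. Modulo I there are
    finitely many choices for N and for the remainders of P and Q, which prepares a pigeonhole
    argument. *)
Lemma exists_reduced n : (d <= n)%N -> exists P Q N U P0 V Q0 c,
  [/\ pcoefs A P, pcoefs A Q, ~ (pcoefs I P /\ pcoefs I Q), lord_le (val_pos S P Q) n%:Z &
      mod_le I (val_neg S P Q) (d%:Z - 1 - n%:Z)] /\
  [/\ N \is monic, pcoefs A N, (size N <= d)%N, A c /\ ~ I c & pcoefs I (norm P Q - c *: N)] /\
  [/\ pcoefs A U /\ pcoefs A V, pcoefs A P0 /\ pcoefs A Q0, P = U * N + P0 /\ Q = V * N + Q0,
      (size P0 < size N)%N & (size Q0 < size N)%N].
Proof.
move=> dn; have [P [Q [hP hQ nPQ hpos hneg]]] := exists_small dn.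
have [_ _ nN] := norm_mod_neq0 hP hQ nPQ; have hN := norm_coefs hP hQ.
have [M nM hM] : exists2 M, ~ I ((norm P Q)%:L M) & mod_le I (norm P Q)%:L M.
  by apply: exists_top => // h; apply: nN; apply: pcoefs_of_lcoefs.
have Md : M <= d%:Z - 1.
  rewrite leNgt; apply/negP => lt; apply: nM; rewrite -(val_norm SD).
  have hp : mod_le I (val_pos S P Q) n%:Z by move=> i /hpos ->.
  have [h _] := mod_leM hA hI (lcoefs_pos hP hQ) (lcoefs_neg hP hQ) hp hneg.
  by apply: h; lia.
case: M nM hM Md => [l|l] // nM hM Md.
set c := (norm P Q)`_l; have nc : ~ I c := nM.
have [m m0' hm] := finite_domain_power hA hI pI hX (hN l) nc.
(* As c^m = 1 modulo I, u inverts c; this makes N monic without leaving A. *)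
pose u := c ^+ m.-1; have uc : I (u * c - 1) by rewrite /u -exprSr prednK.
have Au : A u by apply: subringX => //; apply: hN.
pose N : {poly K} := 'X^l + \poly_(i < l) (u * (norm P Q)`_i).
have Nlt : (size (\poly_(i < l) (u * (norm P Q)`_i)%R) < size ('X^l : {poly K}))%N.
  by rewrite size_polyXn ltnS size_poly.
have sN : size N = l.+1 by rewrite /N size_polyDl // size_polyXn.
have mN : N \is monic by rewrite monicE /N lead_coefDl // lead_coefXn.
have [A1' _ AM] := hA.
have NA : pcoefs A N.
  apply: pcoefsD => //; first exact: pcoefsXn.
  by move=> i; rewrite coef_poly; case: ifP => // _; apply: AM.
have [U [P0 [hU hP0 PE sP]]] := pcoefs_division hA mN NA hP.
have [V [Q0 [hV hQ0 QE sQ]]] := pcoefs_division hA mN NA hQ.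
exists P, Q, N, U, P0, V, Q0, c; split=> //; split=> //.
split=> //; first (by rewrite sN; lia); first by split=> //; apply: hN.
move=> i; rewrite (coefB (norm P Q)) coefZ /N (coefD 'X^l) coefXn coef_poly.
have [lt|gt|->] := ltngtP i l.
- rewrite add0r; have -> : (norm P Q)`_i - c * (u * (norm P Q)`_i) = - ((norm P Q)`_i * (u * c - 1)).
    by ring.
  by apply: addgroupN => //; apply: hI.2 => //; apply: norm_coefs.
- by rewrite addr0 mulr0 subr0 -lcoef_poly; apply: hM; lia.
by rewrite addr0 mulr1 subrr.
Qed.

Lemma mod_leX f (k : int) n : lcoefs A f -> mod_le I f k ->
  mod_le I (f ^+ n) (k *+ n) /\ I ((f ^+ n) (k *+ n) - f k ^+ n).
Proof.
move=> hf hk; elim: n => [|n [IH1 IH2]].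
  rewrite !expr0 mulr0n lcoef1 subrr; split=> // i i0.
  by rewrite lcoef1 gt_eqF.
have [h1 h2] := mod_leM hA hI hf (lcoefsX n hA hf) hk IH1.
rewrite !exprS mulrS; split=> //.
have -> : (f * f ^+ n) (k + k *+ n) - f k * f k ^+ n =
    ((f * f ^+ n) (k + k *+ n) - f k * (f ^+ n) (k *+ n)) +
    f k * ((f ^+ n) (k *+ n) - f k ^+ n) by ring.
by apply: addgroupD => //; apply: hI.2.
Qed.

(** As for the classical Pell equation: two small elements with the same norm, congruent to each
    other modulo that norm, have an integral quotient, which after scaling has norm 1. *)
Lemma pell_prime : pell I.
Proof.
have [cl hcl] := class_index hX; have [A1' AB AM] := hA; have [nI1 pI'] := pI.
have clI x y : A x -> A y -> cl x = cl y -> I (x - y).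
  move=> /hcl [_ hx] /hcl [_ hy] e.
  have -> : x - y = (x - X`_(cl x)) - (y - X`_(cl y)) by rewrite e; ring.
  exact: Ig.2.
(* A spacing of 2 d between the degrees forces the quotient of two such elements to have positive
   degree. *)
have dn i : (d <= d + i * (2 * d))%N by apply: leq_addr.
have /choice [Pn] := fun i => exists_reduced (dn i).
move=> /choice [Qn] /choice [Nn] /choice [Un] /choice [P0n] /choice [Vn] /choice [Q0n].
move=> /choice [cn H].
pose data i := ([ffun l : 'I_d => cl (Nn i)`_l], [ffun l : 'I_d => cl (P0n i)`_l],
  [ffun l : 'I_d => cl (Q0n i)`_l], cl (cn i)).
have [i [j [ij [eN eP eQ ec]]]] := pigeonhole data.
have [[hPi hQi nPQi posi negi] [[mNi NAi sNi [Aci nci] ni] [[Ui Vi] [P0i Q0i] [PEi QEi] sPi sQi]]] := H i.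
have [[hPj hQj nPQj posj negj] [[mNj NAj sNj [Acj ncj] nj] [[Uj Vj] [P0j Q0j] [PEj QEj] sPj sQj]]] := H j.
have small (F G : {poly K}) : pcoefs A F -> pcoefs A G -> (size F <= d)%N -> (size G <= d)%N ->
    [ffun l : 'I_d => cl F`_l] = [ffun l : 'I_d => cl G`_l] -> pcoefs I (G - F).
  move=> hF hG sF sG e l; rewrite coefB; have [lt|le] := ltnP l d.
    apply: clI => //; have := congr1 (fun o : {ffun 'I_d -> 'I_(size X).+1} => o (Ordinal lt)) e.
    by rewrite !ffunE.
  by rewrite !nth_default ?subrr //; apply: leq_trans le.
have {eN} eN : pcoefs I (Nn j - Nn i) by apply: small.
have {eP} eP : pcoefs I (P0n j - P0n i).
  by apply: small => //; [apply: ltnW; apply: leq_trans sPi _|apply: ltnW; apply: leq_trans sPj _].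
have {eQ} eQ : pcoefs I (Q0n j - Q0n i).
  by apply: small => //; [apply: ltnW; apply: leq_trans sQi _|apply: ltnW; apply: leq_trans sQj _].
have {ec} ec : I (cn j - cn i) by apply: clI.
move: (Pn i) (Qn i) (Nn i) (Un i) (P0n i) (Vn i) (Q0n i) (cn i) hPi hQi nPQi posi negi mNi NAi sNi
  Aci nci ni Ui Vi P0i Q0i PEi QEi sPi sQi eN eP eQ ec => P Q N U P0 V Q0 c.
move: (Pn j) (Qn j) (Nn j) (Un j) (P0n j) (Vn j) (Q0n j) (cn j) hPj hQj nPQj posj negj mNj NAj sNj
  Acj ncj nj Uj Vj P0j Q0j PEj QEj sPj sQj => P' Q' N' U' P0' V' Q0' c'.
move=> hP' hQ' nPQ' pos' neg' mN' NA' sN' Ac' nc' n' hU' hV' hP0' hQ0' PE' QE' _ _.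
move=> hP hQ nPQ pos neg mN NA sN Ac nc nN hU hV hP0 hQ0 PE QE _ _ eN eP eQ ec.
clear H data small clI hcl Pn Qn Nn Un P0n Vn Q0n cn.
have IM (F G : {poly K}) : pcoefs A F -> pcoefs I G -> pcoefs I (F * G) by apply: pcoefsM.
pose x1 := U' - U; pose x2 := V' - V.
have hx1 : pcoefs A x1 by apply: pcoefsB. have hx2 : pcoefs A x2 by apply: pcoefsB.
have dP : pcoefs I (P' - P - N * x1).
  have -> : P' - P - N * x1 = U' * (N' - N) + (P0' - P0) by rewrite PE PE' /x1; ring.
  by apply: pcoefsD => //; apply: IM.
have dQ : pcoefs I (Q' - Q - N * x2).
  have -> : Q' - Q - N * x2 = V' * (N' - N) + (Q0' - Q0) by rewrite QE QE' /x2; ring.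
  by apply: pcoefsD => //; apply: IM.
(* (X0, Y0) is (P' + Q' S) (P - Q S) divided by N: substitute P' = P + N x1 and Q' = Q + N x2 modulo
   I, and use that the norm of (P, Q) is c N. *)
pose X0 := c%:P + x1 * P - D * x2 * Q; pose Y0 := x2 * P - x1 * Q.
have hc : pcoefs A c%:P by apply: pcoefsC.
have hX0 : pcoefs A X0.
  by apply: pcoefsB => //; [apply: pcoefsD => //|]; apply: (pcoefsM AA) => //; apply: (pcoefsM AA).
have hY0 : pcoefs A Y0 by apply: pcoefsB => //; apply: (pcoefsM AA).
pose X1 := P' * P + D * Q' * - Q; pose Y1 := P' * - Q + Q' * P.
have hQN : pcoefs A (- Q) by apply: pcoefsN.
have hX1 : pcoefs A X1.
  by apply: pcoefsD => //; apply: (pcoefsM AA) => //; apply: (pcoefsM AA).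
have hY1 : pcoefs A Y1 by apply: pcoefsD => //; apply: (pcoefsM AA).
have nN' : pcoefs I (norm P Q - c%:P * N) by rewrite mul_polyC.
have XX : pcoefs I (X1 - N * X0).
  have -> : X1 - N * X0 = P * (P' - P - N * x1) - D * Q * (Q' - Q - N * x2) +
      (norm P Q - c%:P * N) by rewrite /X1 /X0 /norm; ring.
  apply: pcoefsD => //; apply: pcoefsB => //; first exact: IM.
  by apply: IM => //; apply: (pcoefsM AA).
have YY : pcoefs I (Y1 - N * Y0).
  have -> : Y1 - N * Y0 = P * (Q' - Q - N * x2) - Q * (P' - P - N * x1).
    by rewrite /Y1 /Y0; ring.
  by apply: pcoefsB => //; apply: IM.
have hNX : pcoefs A (N * X0) by apply: (pcoefsM AA).
have hNY : pcoefs A (N * Y0) by apply: (pcoefsM AA).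
have norm1 : norm X1 Y1 = norm P' Q' * norm P Q by rewrite /norm /X1 /Y1; ring.
have norm0 : norm (N * X0) (N * Y0) = N * N * norm X0 Y0 by rewrite /norm; ring.
have nN1 : pcoefs I (norm P' Q' - c%:P * N).
  have -> : norm P' Q' - c%:P * N = (norm P' Q' - c'%:P * N') + N' * (c' - c)%:P +
      c%:P * (N' - N) by rewrite rmorphB /=; ring.
  apply: pcoefsD => //; last exact: IM.
  apply: pcoefsD => //; first by rewrite mul_polyC.
  by apply: IM => //; apply: pcoefsC.
have NN0 : ~ lcoefs I N%:L.
  move=> /(pcoefs_of_lcoefs) /(_ (size N).-1); rewrite -lead_coefE.
  by move: mN; rewrite monicE => /eqP ->.
have norm_c : pcoefs I (norm X0 Y0 - c%:P ^+ 2).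
  have hc2 : pcoefs A (norm X0 Y0 - c%:P ^+ 2).
    by apply: pcoefsB => //; [apply: norm_coefs|apply: pcoefsX].
  have h : lcoefs I (N%:L * (N%:L * (norm X0 Y0 - c%:P ^+ 2)%:L)).
    rewrite -!rmorphM; apply: lcoefs_of_pcoefs => //.
    have -> : N * (N * (norm X0 Y0 - c%:P ^+ 2)) = - (norm X1 Y1 - norm (N * X0) (N * Y0)) +
       (norm P Q * (norm P' Q' - c%:P * N) + c%:P * N * (norm P Q - c%:P * N)).
      by rewrite norm1 norm0; ring.
    apply: pcoefsD => //; first by apply: pcoefsN => //; apply: norm_mod.
    apply: pcoefsD => //; first by apply: IM => //; apply: norm_coefs.
    by apply: IM => //; apply: (pcoefsM AA).
  have NL : lcoefs A N%:L by apply: lcoefs_of_pcoefs.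
  have cL : lcoefs A (norm X0 Y0 - c%:P ^+ 2)%:L by apply: lcoefs_of_pcoefs.
  have [//|h'] := mod_domain hA hI pI NL (lcoefsM AA NL cL) h.
  have [//|h''] := mod_domain hA hI pI NL cL h'.
  exact: pcoefs_of_lcoefs.
have [m m_gt0 hm] := finite_domain_power hA hI pI hX Ac nc.
pose u := c ^+ m.-1; have uc : I (u * c - 1) by rewrite /u -exprSr prednK.
have Au : A u by apply: subringX.
have hu : pcoefs A u%:P by apply: pcoefsC.
pose X2 := u%:P * X0; pose Y2 := u%:P * Y0.
have hX2 : pcoefs A X2 by apply: (pcoefsM AA). have hY2 : pcoefs A Y2 by apply: (pcoefsM AA).
have norm2 : pcoefs I (norm X2 Y2 - 1).
  have -> : norm X2 Y2 - 1 = u%:P ^+ 2 * (norm X0 Y0 - c%:P ^+ 2) +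
      (u%:P * c%:P + 1) * (u * c - 1)%:P.
    by rewrite /norm /X2 /Y2 rmorphB rmorphM rmorph1 /=; ring.
  apply: pcoefsD => //; first by apply: IM => //; apply: pcoefsX.
  apply: IM; last exact: pcoefsC.
  by apply: pcoefsD => //; [apply: (pcoefsM AA)|apply: pcoefs1].
set e := val_pos S X2 Y2; have he : lcoefs A e by apply: lcoefs_pos.
have ne : ~ lcoefs I e.
  move=> h; apply: nI1; have := norm2 0%N; rewrite coefB coef1 => h1.
  have h2 : I (norm X2 Y2)`_0.
    apply: (@lcoefs_polyE _ I); rewrite -(val_norm SD) mulrC; apply: (lcoefsM hI) => //.
    exact: lcoefs_neg.
  have -> : (1 : K) = (norm X2 Y2)`_0 - ((norm X2 Y2)`_0 - (0 == 0)%N%:R).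
    by rewrite eqxx mulr1n; ring.
  exact: Ig.2.
have [M nM hM] := exists_top ne I0.
have M0 : 0 < M.
  have Ptop P1 Q1 n : pcoefs A P1 -> pcoefs A Q1 -> ~ (pcoefs I P1 /\ pcoefs I Q1) ->
      lord_le (val_pos S P1 Q1) n%:Z -> mod_le I (val_neg S P1 Q1) (d%:Z - 1 - n%:Z) ->
      exists a b, [/\ n%:Z - d%:Z + 1 <= a /\ - n%:Z <= b, ~ I (val_pos S P1 Q1 a),
        ~ I (val_neg S P1 Q1 b), mod_le I (val_pos S P1 Q1) a & mod_le I (val_neg S P1 Q1) b].
    move=> h1 h2 h3 h4 h5; have [n1 n2 n3] := norm_mod_neq0 h1 h2 h3.
    have [a na ha] := exists_top n1 I0; have [b nb hb] := exists_top n2 I0.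
    have h4' : mod_le I (val_pos S P1 Q1) n%:Z by move=> k /h4 ->.
    have [r nr] : exists r : nat, ~ I (norm P1 Q1)`_r.
      by apply: contrapT => h; apply: n3 => r; apply: contrapT => h'; apply: h; exists r.
    have hp := lcoefs_pos h1 h2; have hn := lcoefs_neg h1 h2.
    have [k1 _] := mod_leM hA hI hp hn ha h5; have [k2 _] := mod_leM hA hI hp hn h4' hb.
    exists a, b; split=> //; split.
      rewrite leNgt; apply/negP => lt; apply: nr; rewrite -lcoef_poly -(val_norm SD).
      by apply: k1; lia.
    rewrite leNgt; apply/negP => lt; apply: nr; rewrite -lcoef_poly -(val_norm SD).
    by apply: k2; lia.
  have [a [_ [[la _] na _ ha _]]] := Ptop _ _ _ hP' hQ' nPQ' pos' neg'.
  have [_ [b [[_ lb] _ nb _ hb]]] := Ptop _ _ _ hP hQ nPQ pos neg.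
  rewrite ltNge; apply/negP => Mle.
  have hN1 : mod_le I N%:L (d%:Z - 1).
    case=> [k|k] hk; last by lia.
    by rewrite lcoef_poly nth_default //; apply: leq_trans sN _; lia.
  have [h1 _] := mod_leM hA hI (lcoefs_of_pcoefs A0 NA) he hN1 hM.
  have [_ h2] := mod_leM hA hI (lcoefs_pos hP' hQ') (lcoefs_neg hP hQ) ha hb.
  have nab : ~ I (u * (val_pos S P' Q' * val_neg S P Q) (a + b)).
    move=> h; have h3 : I ((val_pos S P' Q' * val_neg S P Q) (a + b)).
      have -> : (val_pos S P' Q' * val_neg S P Q) (a + b) =
         c * (u * (val_pos S P' Q' * val_neg S P Q) (a + b)) -
         (val_pos S P' Q' * val_neg S P Q) (a + b) * (u * c - 1) by ring.
      apply: Ig.2; apply: hI.2 => //.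
      by apply: (lcoefsM AA); [apply: lcoefs_pos|apply: lcoefs_neg].
    have : I (val_pos S P' Q' a * val_neg S P Q b).
      have -> : val_pos S P' Q' a * val_neg S P Q b = (val_pos S P' Q' * val_neg S P Q) (a + b) -
        ((val_pos S P' Q' * val_neg S P Q) (a + b) - val_pos S P' Q' a * val_neg S P Q b) by ring.
      exact: Ig.2.
    by case/pI' => //; [apply: lcoefs_pos|apply: lcoefs_neg].
  apply: nab; rewrite -lcoefZ val_neg_pos (val_posM SD) -/X1 -/Y1.
  have -> : u *: val_pos S X1 Y1 = N%:L * e +
      val_pos S (u%:P * (X1 - N * X0)) (u%:P * (Y1 - N * Y0)).
    have gen (z : K) (F F0 G0 F1 G1 : {poly K}) : z *: val_pos S F1 G1 =
        F%:L * val_pos S (z%:P * F0) (z%:P * G0) +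
        val_pos S (z%:P * (F1 - F * F0)) (z%:P * (G1 - F * G0)).
      by rewrite lscaleE /val_pos !(rmorphM, rmorphB) /=; ring.
    exact: gen.
  have gap : (i * (2 * d) + 2 * d <= j * (2 * d))%N by rewrite -mulSnr leq_mul2r ij orbT.
  rewrite lcoefD; apply: addgroupD => //.
    by apply: h1; move: la lb gap Mle; move: (i * _)%N (j * _)%N => ni' nj'; lia.
  by apply: ideal_val_pos => //; apply: IM.
case: M nM hM M0 => // k nM hM M0.
(* The leading coefficient has finite order modulo I, so some power of the solution has leading
   coefficient 1. *)
have [m' m'_gt0 hm'] := finite_domain_power hA hI pI hX (he k%:Z) nM.
have [P2 [Q2 [hP2 hQ2 e1 e2]]] := val_power SD m' hA hD hX2 hY2.
have [h1 h2] := mod_leX m' he hM.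
have km : k%:Z *+ m' = (k * m')%N%:Z by rewrite -mulr_natr; lia.
rewrite km in h1 h2.
apply: (@pell_of_mod I (k * m') P2 Q2) => //.
- by rewrite muln_gt0 m'_gt0 andbT; lia.
- by rewrite -e1.
- rewrite -e1.
  have -> : (e ^+ m') (k * m')%N%:Z - 1 = ((e ^+ m') (k * m')%N%:Z - e k%:Z ^+ m') +
    (e k%:Z ^+ m' - 1) by ring.
  exact: addgroupD.
rewrite (norm_power e1 e2) -[X in _ - X](expr1n _ m'); apply: power_mod => //.
  exact: norm_coefs.
exact: pcoefs1.
Qed.

End PrimeModulus.

(** * From prime ideals to ideals with finite quotient *)

Definition extend I x z := exists i a, [/\ I i, A a & z = i + a * x].

Lemma extend_ideal I x : stable A I -> (forall x, I x -> A x) -> A x ->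
  [/\ stable A (extend I x), forall z, I z -> extend I x z, forall z, extend I x z -> A z &
      extend I x x].
Proof.
move=> [[I0 IB] IM] IA Ax; have [A1' AB AM] := hA; split.
- split; first split.
  + by exists 0, 0; rewrite mul0r addr0.
  + move=> _ _ [i [a [Ii Aa ->]]] [j [b [Ij Ab ->]]]; exists (i - j), (a - b).
    by split; [exact: IB|exact: AB|ring].
  + move=> z _ Az [i [a [Ii Aa ->]]]; exists (z * i), (z * a).
    by split; [exact: IM|exact: AM|ring].
- by move=> z Iz; exists z, 0; rewrite mul0r addr0.
- by move=> _ [i [a [Ii Aa ->]]]; apply: addgroupD => //; [exact: IA|exact: AM].
by exists 0, 1; rewrite mul1r add0r.
Qed.

(** This count is the measure for the induction on ideals: the representative of x enters the larger
    ideal. *)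
Lemma extend_count I X x : stable A I -> (forall x, I x -> A x) -> classes A I X ->
  A x -> ~ I x ->
  (count (fun z => ~~ `[< extend I x z >]) X < count (fun z => ~~ `[< I z >]) X)%N.
Proof.
move=> hI IA hX Ax nx; have [hE IE EA Ex] := extend_ideal hI IA Ax.
have [y yX hy] := hX.2 _ Ax.
have ny : ~ I y by move=> Iy; apply: nx; rewrite -(subrK y x); apply: addgroupD => //; case: hI.
have Ey : extend I x y.
  have -> : y = x - (x - y) by ring.
  by apply: hE.1.2 => //; apply: IE.
have le (Y : seq K) : (count (fun z => ~~ `[< extend I x z >]) Y <= count (fun z => ~~ `[< I z >]) Y)%N.
  by apply: sub_count => z /asboolP nE; apply/asboolP => Iz; apply: nE; apply: IE.
case/splitPr: yX => X1 X2; rewrite !count_cat /=.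
have -> : `[< extend I x y >] by apply/asboolP.
have -> : `[< I y >] = false by apply/asboolP.
by rewrite /= add0n add1n addnS ltnS; apply: leq_add.
Qed.

Lemma pell_trivial I : stable A I -> I 1 -> pell I.
Proof.
move=> hI I1; have p0 := pcoefs0 A0.
exists 1%N, 'X, 0; split=> //; first exact: pcoefs_X.
  rewrite /val_pos rmorph0 mul0r addr0; split; last by rewrite lcoef_poly coefX.
  by apply: lord_le_poly; rewrite size_polyX.
move=> i; rewrite -[_`_i]mulr1; apply: hI.2 => //; apply: pcoefsB => //; last exact: pcoefs1.
by apply: norm_coefs => //; apply: pcoefs_X.
Qed.

(** Powers of equal degree of the two solutions agree modulo I1 + I2 by [pell_unique], so they glue
    to a solution modulo the intersection of I1 and I2. Products of two elements of that
    intersection lie in I, so [pell_nilpotent] finishes. *)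
Lemma pell_glue I x y e : stable A I -> (forall x, I x -> A x) -> A x -> A y -> I (x * y) ->
  (0 < e)%N -> I e%:R -> pell (extend I x) -> pell (extend I y) -> pell I.
Proof.
move=> hI IA Ax Ay Ixy e0 Ie.
have [hI1 II1 I1A I1x] := extend_ideal hI IA Ax.
have [hI2 II2 I2A I2y] := extend_ideal hI IA Ay.
set I1 := extend I x in hI1 II1 I1A I1x *; set I2 := extend I y in hI2 II2 I2A I2y *.
move=> [k1 [P1 [Q1 [k10 hP1 hQ1 [o1 t1] n1]]]] [k2 [P2 [Q2 [k20 hP2 hQ2 [o2 t2] n2]]]].
have [P3 [Q3 [hP3 hQ3 o3 t3 n3]]] := pell_power hI1 k10 k20 hP1 hQ1 o1 t1.
have [P4 [Q4 [hP4 hQ4 o4 t4 n4]]] := pell_power hI2 k20 k10 hP2 hQ2 o2 t2.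
rewrite mulnC in o4 t4; set k := (k1 * k2)%N in o3 t3 o4 t4.
have powm (J : K -> Prop) (U : {poly K}) n : stable A J -> pcoefs A U -> pcoefs J (U - 1) ->
    pcoefs J (U ^+ n - 1).
  by move=> hJ hU h; rewrite -[X in _ - X](expr1n _ n); apply: power_mod => //; apply: pcoefs1.
have {}n3 : pcoefs I1 (norm P3 Q3 - 1) by rewrite n3; apply: powm => //; apply: norm_coefs.
have {}n4 : pcoefs I2 (norm P4 Q4 - 1) by rewrite n4; apply: powm => //; apply: norm_coefs.
pose I3 z := exists u v, [/\ I1 u, I2 v & z = u - v].
have hI3 : stable A I3.
  have [[z1 b1] m1] := hI1; have [[z2 b2] m2] := hI2; split; first split.
  - by exists 0, 0; rewrite subrr.
  - move=> _ _ [u [v [hu hv ->]]] [u' [v' [hu' hv' ->]]]; exists (u - u'), (v - v').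
    by split; [exact: b1|exact: b2|ring].
  move=> z _ Az [u [v [hu hv ->]]]; exists (z * u), (z * v).
  by split; [exact: m1|exact: m2|ring].
have h13 z : I1 z -> I3 z by move=> h; exists z, 0; rewrite subr0; split=> //; case: hI2 => -[].
have h23 z : I2 z -> I3 z.
  by move=> h; exists 0, (- z); rewrite sub0r opprK; split=> //; [case: hI1 => -[]|
     apply: addgroupN => //; case: hI2].
have [eP eQ] := pell_unique hI3 hP3 hQ3 hP4 hQ4 o3 t3 o4 t4 (fun i => h13 _ (n3 i)) (fun i => h23 _ (n4 i)).
(* Chinese remainders: subtracting from P3 the part of P3 - P4 that lies in I1 keeps its class
   modulo I1 and gives it the class of P4 modulo I2. *)
have split3 (F : {poly K}) : pcoefs I3 F -> exists G, pcoefs I1 G /\ pcoefs I2 (G - F).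
  move=> hF; have /choice [g hg] : forall i, exists u, I1 u /\ I2 (u - F`_i).
    by move=> i; have [u [v [hu hv ->]]] := hF i; exists u; split=> //; rewrite opprB addrC subrK.
  have [z1 _] := hI1.1; have [z2 _] := hI2.1.
  exists (\poly_(i < size F) g i); split=> i; rewrite ?coefB coef_poly.
    by case: ltnP => // _; case: (hg i).
  case: ltnP => [_|le]; first by case: (hg i).
  by rewrite nth_default // subrr.
have [G [G1 G2]] := split3 _ eP; have [H [H1 H2]] := split3 _ eQ.
pose P := P3 - G; pose Q := Q3 - H.
have hP : pcoefs A P by apply: pcoefsB => // i; apply: I1A.
have hQ : pcoefs A Q by apply: pcoefsB => // i; apply: I1A.
pose J z := I1 z /\ I2 z.
have hJ : stable A J.
  have [[z1 b1] m1] := hI1; have [[z2 b2] m2] := hI2; split; first split=> //.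
    by move=> z z' [h1 h2] [h1' h2']; split; [exact: b1|exact: b2].
  by move=> z z' Az [h1 h2]; split; [exact: m1|exact: m2].
have dP1 : pcoefs I1 (P - P3) by rewrite /P addrC addKr; apply: pcoefsN => //; case: hI1.
have dQ1 : pcoefs I1 (Q - Q3) by rewrite /Q addrC addKr; apply: pcoefsN => //; case: hI1.
have dP2 : pcoefs I2 (P - P4).
  have -> : P - P4 = - (G - (P3 - P4)) by rewrite /P; ring.
  by apply: pcoefsN => //; case: hI2.
have dQ2 : pcoefs I2 (Q - Q4).
  have -> : Q - Q4 = - (H - (Q3 - Q4)) by rewrite /Q; ring.
  by apply: pcoefsN => //; case: hI2.
have val_sub (F1 F2 F3 F4 : {poly K}) n : val_pos S F1 F3 n =
    val_pos S F2 F4 n + val_pos S (F1 - F2) (F3 - F4) n.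
  by rewrite -lcoefD; congr lcoef; rewrite /val_pos !rmorphB /=; ring.
have pJ : pell J.
  apply: (@pell_of_mod J k P Q) => //.
  - by rewrite muln_gt0 k10.
  - move=> n kn; split.
      by rewrite (val_sub P P3 Q Q3) o3 // add0r; apply: ideal_val_pos.
    by rewrite (val_sub P P4 Q Q4) o4 // add0r; apply: ideal_val_pos.
  - split.
      by rewrite (val_sub P P3 Q Q3) t3 addrC addKr; apply: ideal_val_pos.
    by rewrite (val_sub P P4 Q Q4) t4 addrC addKr; apply: ideal_val_pos.
  move=> i; split.
    have -> : norm P Q - 1 = (norm P Q - norm P3 Q3) + (norm P3 Q3 - 1) by ring.
    by apply: pcoefsD => //; [case: hI1|apply: norm_mod].
  have -> : norm P Q - 1 = (norm P Q - norm P4 Q4) + (norm P4 Q4 - 1) by ring.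
  by apply: pcoefsD => //; [case: hI2|apply: norm_mod].
apply: (pell_nilpotent hI hJ _ e0 Ie _ pJ); last by move=> z [/I1A].
move=> _ _ [[i [a [Ii Aa ->]]] _] [_ [j [b [Ij Ab ->]]]].
have [_ _ AM] := hA; have [Ig IM] := hI.
have -> : (i + a * x) * (j + b * y) = (j + b * y) * i + ((a * x) * j + (a * b) * (x * y)) by ring.
apply: addgroupD => //.
  by apply: IM => //; apply: addgroupD => //; [apply: IA|apply: AM].
by apply: addgroupD => //; apply: IM => //; apply: AM.
Qed.

(** An ideal that is neither prime nor all of A contains some x y with x and y outside it; the two
    larger ideals, which leave fewer representatives outside, are treated first. *)
Lemma pell_ideal I e X : stable A I -> (forall x, I x -> A x) -> classes A I X ->
  (0 < e)%N -> I e%:R -> pell I.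
Proof.
move=> hI0 I0A hX e0 Ie.
suff H n J : stable A J -> (forall x, I x -> J x) -> (forall x, J x -> A x) ->
    (count (fun x => ~~ `[< J x >]) X < n)%N -> pell J.
  by apply: (H (size X).+1) => //; rewrite ltnS; apply: count_size.
elim: n J => // n IH J hJ IJ JA; rewrite ltnS => cJ.
have hXJ : classes A J X.
  by split; [exact: hX.1|move=> x /hX.2 [y yX /IJ]; exists y].
have [J1|nJ1] := pselect (J 1); first exact: pell_trivial.
have [pJ|npJ] := pselect (prime_ideal A J); first exact: pell_prime hXJ.
have [x [y [Ax Ay Jxy nx ny]]] : exists x y, [/\ A x, A y, J (x * y), ~ J x & ~ J y].
  apply: contrapT => h; apply: npJ; split=> // x y Ax Ay Jxy.
  have [|nx] := pselect (J x); first by left.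
  have [|ny] := pselect (J y); first by right.
  by case: h; exists x, y.
have step z : A z -> ~ J z -> pell (extend J z).
  move=> Az nz; have [hE JE EA _] := extend_ideal hJ JA Az.
  apply: IH => //; first by move=> w /IJ /JE.
  exact: leq_trans (extend_count hJ JA hXJ Az nz) cJ.
by apply: (pell_glue hJ JA Ax Ay Jxy e0 (IJ _ Ie)); apply: step.
Qed.


End PellModulo.

(** * Small elements *)

Section SmallElements.
Variables (K : numClosedFieldType) (S : laurent K) (d : nat).
Local Notation W := (laurent K * laurent K)%type.
Hypotheses (Sd : lord_le S d%:Z) (Sd0 : S d%:Z != 0).
Implicit Types (P Q : {poly K}) (a b : int).

Definition small_element a b := exists P Q, [/\ (P != 0) || (Q != 0),
  lord_le (val_pos S P Q) a & lord_le (val_neg S P Q) b].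

Lemma proj1_0 (z : W) : proj S 1 0 z = pi0 S z.
Proof. by rewrite /proj big_ord_recl big_ord0 addr0. Qed.

Lemma sum_lmon (f : laurent K) (n : nat) :
  lord_le f (n%:Z - 1) -> lord_le (f - \sum_(i < n) f i%:Z *: lmon K i%:Z) (-1).
Proof.
move=> hf; have -> : -1 = n%:Z - 1 - n%:Z by lia.
have -> : \sum_(i < n) f i%:Z *: lmon K i%:Z =
    \sum_(i < n) f (n%:Z - 1 - i%:Z) *: lmon K (n%:Z - 1 - i%:Z).
  rewrite (reindex_inj rev_ord_inj) /=; apply: eq_bigr => i _; have := ltn_ord i => lt.
  by have -> : (n - i.+1)%N%:Z = n%:Z - 1 - i%:Z by lia.
exact: lord_le_sub_mon.
Qed.

Lemma row_twist (n : nat) (y : 'rV[K]_n) : y *m twist_mx S d 1 0 n =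
  coords S d 1 0 n (\sum_(i < n) y 0 i *: lmon K i%:Z, 0).
Proof.
rewrite mulmx_sum_row.
have -> : (\sum_(i < n) y 0 i *: lmon K i%:Z, 0) =
    \sum_(i < n) y 0 i *: ((lmon K i%:Z, 0) : W).
  elim/big_rec2: _ => // i f g _ <-.
  by congr pair; rewrite /= scaler0 addr0.
by rewrite linear_sum; apply: eq_bigr => i _; rewrite linearZ rowK.
Qed.

(** A vector y killed by the matrix gives f = sum of y_i t^i, and the lattice part of (f, 0) is the
    small element. Conversely, y consists of the coefficients of P + Q S in degrees 0 to n - 1. *)
Lemma twist_det_small (n : nat) :
  \det (twist_mx S d 1 0 n) = 0 <-> small_element (n%:Z - 1) (d%:Z - 1 - n%:Z).
Proof.
split=> [/eqP/det0P [y y0 yT]|[P [Q [PQ0 hpos hneg]]]]; last first.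
  pose y := \row_(i < n) val_pos S P Q i%:Z.
  set f := \sum_(i < n) val_pos S P Q i%:Z *: lmon K i%:Z.
  have fE : \sum_(i < n) y 0 i *: lmon K i%:Z = f by apply: eq_bigr => i _; rewrite mxE.
  have hg := sum_lmon hpos; rewrite -/f in hg; set g := val_pos S P Q - f in hg.
  have [rP rQ] := rho_val Sd0 P Q.
  apply/eqP/det0P; exists y.
    apply: contraL PQ0 => /eqP y0; rewrite negb_or !negbK.
    have f0 : f = 0 by rewrite -fE y0 big1 // => i _; rewrite mxE scale0r.
    have hp : lord_le (val_pos S P Q) (-1) by rewrite -[val_pos S P Q]subr0 -f0.
    have [] := @rho_small _ _ _ Sd Sd0 (val_pos S P Q, val_neg S P Q) hp.
      by apply: lord_le_trans hneg => /=; lia.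
    by rewrite rP rQ => -> ->; rewrite !eqxx.
  rewrite row_twist fE.
  have -> : ((f, 0) : W) = (val_pos S P Q, val_neg S P Q) - (g, val_neg S P Q).
    by rewrite /g; congr pair; rewrite /= ?subrr //; ring.
  rewrite linearB /=.
  have hneg' : lord_le (val_neg S P Q) (d%:Z - 1) by apply: lord_le_trans hneg; lia.
  have h1 : pi0 S (g, val_neg S P Q) = (g, val_neg S P Q).
    have [e1 e2] := @rho_small _ _ _ Sd Sd0 (g, val_neg S P Q) hg hneg'.
    by rewrite /pi0 /rho_pos /rho_neg e1 e2 /val_pos /val_neg !(rmorph0, mul0r, addr0, subr0).
  have h2 : pi0 S (val_pos S P Q, val_neg S P Q) = 0.
    by rewrite /pi0 /rho_pos /rho_neg rP rQ /= !subrr.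
  apply/rowP => l; rewrite !mxE !proj1_0 h1 h2 /= hneg ?subr0 //.
  by have := ltn_ord l; lia.
rewrite row_twist in yT; set f := \sum_(i < n) _ in yT.
have fle : lord_le f (n%:Z - 1).
  apply: lord_le_sum => i _; apply: lord_leZ; apply: lord_le_trans (@lord_le_mon _ _).
  by have := ltn_ord i; lia.
pose z : W := (f, 0).
have p2 : lord_le (pi0 S z).2 (d%:Z - 1 - n%:Z).
  have := @lord_le_sub_mon _ _ _ n (pi0_lord_le2 Sd Sd0 z).
  rewrite big1 ?subr0 // => l _.
  have := congr1 (fun r : 'rV[K]_n => r 0 l) yT.
  by rewrite !mxE proj1_0 => ->; rewrite scale0r.
have p1 := pi0_lord_le1 S z.
exists (rhoP S z), (rhoQ S z); split.
- apply: contraNT y0; rewrite negb_or !negbK => /andP[/eqP eP /eqP eQ].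
  have f1 : lord_le f (-1).
    move: p1; rewrite /pi0 /rho_pos eP eQ /val_pos /=.
    by rewrite !(rmorph0, mul0r, addr0, subr0).
  have fE : f = (\poly_(i < n) (if insub i is Some l then y 0 l else 0))%:L.
    rewrite poly_def raddf_sum; apply: eq_bigr => i _.
    by rewrite valK lmon_poly lscale_poly.
  have /polyP f0 : \poly_(i < n) (if insub i is Some l then y 0 l else 0) = 0.
    by apply: (@poly_lord_lt0 _ _ (-1)) => //; rewrite -fE.
  apply/eqP/rowP => l; have := f0 l.
  by rewrite coef_poly ltn_ord valK coef0 mxE.
- have -> : val_pos S (rhoP S z) (rhoQ S z) = f - (pi0 S z).1 by rewrite /pi0 /= subKr.
  by apply: lord_leB => //; apply: lord_le_trans p1; lia.
have -> : val_neg S (rhoP S z) (rhoQ S z) = - (pi0 S z).2 by rewrite /pi0 /= sub0r opprK.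
exact: lord_leN.
Qed.

(* If the product of one element with the conjugate of the other has degree
   less than d at both infinite places, its S-component vanishes. *)
Lemma small_proportional P Q P' Q' a b a' b' :
  lord_le (val_pos S P Q) a -> lord_le (val_neg S P Q) b ->
  lord_le (val_pos S P' Q') a' -> lord_le (val_neg S P' Q') b' ->
  a + b' < d%:Z -> a' + b < d%:Z -> P * Q' = P' * Q.
Proof.
move=> h1 h2 h3 h4 l1 l2; apply/eqP; rewrite -subr_eq0; apply/eqP.
apply: (@poly_lord_lt0 _ _ (-1)) => //.
have h : 2%:R * S != 0 by apply: contraNneq (twoS_neq0 Sd0) => ->.
have -> : (P * Q' - P' * Q)%:L =
    (val_neg S P Q * val_pos S P' Q' - val_pos S P Q * val_neg S P' Q') * (2%:R * S)^-1.
  rewrite (_ : _ - _ = (P * Q' - P' * Q)%:L * (2%:R * S)) ?mulfK //.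
  by rewrite /val_pos /val_neg rmorphB !rmorphM /=; ring.
have -> : -1 = d%:Z - 1 + - d%:Z by lia.
apply: lord_leM; last exact: lord_leV (twoS_le Sd) (twoS_neq0 Sd0).
apply: lord_leB.
  by apply: lord_le_trans (lord_leM h2 h3); lia.
by apply: lord_le_trans (lord_leM h1 h4); lia.
Qed.

Lemma lord_le_polyM (u : {poly K}) (f : laurent K) a : u != 0 -> lord_le (u%:L * f) a ->
  lord_le f a.
Proof.
move=> u0 h; have [->|f0] := eqVneq f 0; first by [].
have [M [fM hM]] := laurent_topP f0.
have su : (0 < size u)%N by rewrite size_poly_gt0.
have hu : lord_le u%:L (size u).-1%:Z by apply: lord_le_poly; rewrite prednK.
suff Ma : M <= a by apply: lord_le_trans hM.
rewrite leNgt; apply/negP => lt.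
have := lcoefM_top hu hM; rewrite h; last by lia.
by move/esym/eqP; rewrite mulf_eq0 lcoef_poly -lead_coefE lead_coef_eq0 (negbTE u0) (negbTE fM).
Qed.

Lemma coprime_part P Q : (P != 0) || (Q != 0) -> exists u P0 Q0,
  [/\ u != 0, coprimep P0 Q0, P = u * P0 & Q = u * Q0].
Proof.
move=> PQ; exists (gcdp P Q), (P %/ gcdp P Q), (Q %/ gcdp P Q); split.
- by rewrite gcdp_eq0 negb_and.
- exact: coprimep_div_gcd.
- by rewrite mulrC divpK // dvdp_gcdl.
- by rewrite mulrC divpK // dvdp_gcdr.
Qed.

Lemma coprime_proportional P Q P' Q' : coprimep P Q -> P * Q' = P' * Q ->
  exists u, P' = u * P /\ Q' = u * Q.
Proof.
move=> /Bezout_eq1_coprimepP [[u v] /= e] h; exists (u * P' + v * Q'); split.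
  rewrite mulrDl -[LHS]mulr1 -e mulrDr; congr (_ + _); first by ring.
  by rewrite -mulrA [Q' * P]mulrC h; ring.
rewrite mulrDl -[LHS]mulr1 -e mulrDr; congr (_ + _); last by ring.
by rewrite -mulrA -h; ring.
Qed.

Lemma small_element_primitive a b : small_element a b -> exists P Q, [/\ coprimep P Q,
  lord_le (val_pos S P Q) a & lord_le (val_neg S P Q) b].
Proof.
move=> [P [Q [PQ h1 h2]]]; have [u [P0 [Q0 [u0 c PE QE]]]] := coprime_part PQ.
exists P0, Q0; split=> //; apply: (lord_le_polyM u0).
  by rewrite val_pos_scale -PE -QE.
by rewrite val_neg_scale -PE -QE.
Qed.

(** A primitive element for the first L indices is proportional to the next small element, one of
    the two degree sums being exactly d - 1. It divides that element and so inherits the sharper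
    bound. *)
Lemma small_run (n L : nat) : (0 < L)%N ->
  (forall i, (i < L)%N -> small_element ((n + i)%N%:Z - 1) (d%:Z - 1 - (n + i)%N%:Z)) ->
  exists P Q, [/\ coprimep P Q, lord_le (val_pos S P Q) (n%:Z - 1) &
    lord_le (val_neg S P Q) (d%:Z - n%:Z - L%:Z)].
Proof.
elim: L => // L IH _ h; have [L0|L0] := posnP L.
  have := h 0%N; rewrite L0 addn0 => /(_ isT) /small_element_primitive [P [Q [c h1 h2]]].
  by exists P, Q; split=> //; apply: lord_le_trans h2; lia.
have [|P [Q [c h1 h2]]] := IH L0; first by move=> i iL; apply: h; apply: ltnW.
exists P, Q; split=> //.
have [P' [Q' [PQ' h3 h4]]] := h L (ltnSn L).
have e : P * Q' = P' * Q by apply: (small_proportional h1 h2 h3 h4); lia.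
have [u [P'E Q'E]] := coprime_proportional c e.
have u0 : u != 0 by apply: contraTneq PQ' => u0; rewrite P'E Q'E u0 !mul0r eqxx.
apply: (lord_le_polyM u0); rewrite val_neg_scale -P'E -Q'E.
by apply: lord_le_trans h4; lia.
Qed.

End SmallElements.

(** * Progressions of small elements *)

(** Masks are brought to length [size s], where they can be counted by a finite type. *)
Lemma mask_padded (T : Type) (m : bitseq) (s : seq T) :
  mask [seq nth false m i | i <- iota 0 (size s)] s = mask m s.
Proof.
elim: s m => [|x s IH] m /=; first by case: m.
have -> : iota 1 (size s) = [seq i.+1 | i <- iota 0 (size s)] by rewrite (iotaDl 1 0).
rewrite -map_comp; have := IH (behead m).
rewrite (eq_map (g := nth false m \o succn)) => [->|i]; last by rewrite /= nth_behead.
by case: m => [|[] m] //=; case: s {IH}.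
Qed.

Section PolynomialFacts.
Variable K : numClosedFieldType.
Implicit Types (p q : {poly K}).

Lemma closed_poly_roots p : p != 0 -> exists2 rs, size rs = (size p).-1 &
  p = lead_coef p *: \prod_(z <- rs) ('X - z%:P).
Proof.
move=> p0; have [rs pE] := closed_field_poly_normal p; exists rs => //.
by rewrite [in RHS]pE size_scale ?lead_coef_eq0 // size_prod_XsubC.
Qed.

Lemma dvdp_radical p q n : p != 0 -> ((size p).-1 <= n)%N ->
  (forall z, root p z -> root q z) -> p %| q ^+ n.
Proof.
move=> p0 sp h; have [rs srs pE] := closed_poly_roots p0.
have lp : lead_coef p != 0 by rewrite lead_coef_eq0.
have rp z : z \in rs -> root q z.
  by move=> zrs; apply: h; rewrite pE rootZ // root_prod_XsubC.
rewrite pE dvdpZl // (dvdp_trans _ (dvdp_exp2l _ sp)) // -srs.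
elim: rs rp {srs pE} => [|z rs IH] rp; first by rewrite big_nil dvd1p.
rewrite big_cons exprS; apply: dvdp_mul.
  by rewrite dvdp_XsubCl; apply: rp; rewrite inE eqxx.
by apply: IH => y yrs; apply: rp; rewrite inE yrs orbT.
Qed.

Lemma divisors_pigeonhole p (N : nat -> {poly K}) : p != 0 -> (forall j, N j %| p) ->
  exists i j, (i < j)%N /\ N i %= N j.
Proof.
move=> p0 hN; have [rs _ pE] := closed_poly_roots p0.
have lp : lead_coef p != 0 by rewrite lead_coef_eq0.
have /choice [m hm] : forall j, exists m, N j %= \prod_(z <- mask m rs) ('X - z%:P).
  move=> j; have : N j %| \prod_(z <- rs) ('X - z%:P).
    by have := hN j; rewrite pE dvdpZr.
  by case/dvdp_prod_XsubC => m; exists m.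
pose code j := [ffun i : 'I_(size rs) => nth false (m j) i].
have [i [j [ij e]]] := pigeonhole code.
exists i, j; split=> //; apply: eqp_trans (hm i) _; rewrite eqp_sym.
apply: eqp_trans (hm j) _; rewrite -(mask_padded (m i)) -(mask_padded (m j)).
rewrite (_ : map _ _ = [seq nth false (m i) k | k <- iota 0 (size rs)]) ?eqpxx //.
apply/eq_in_map => k; rewrite mem_iota => /= lt.
by have := congr1 (fun o : {ffun 'I_(size rs) -> bool} => o (Ordinal lt)) e; rewrite !ffunE.
Qed.

End PolynomialFacts.

Section Progression.
Variables (K : numClosedFieldType) (S : laurent K) (d : nat) (D : {poly K}).
Hypotheses (SD : S ^+ 2 = D%:L) (Sd : lord_le S d%:Z) (Sd0 : S d%:Z != 0) (d0 : (0 < d)%N).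
Hypotheses (sD : size D = (2 * d).+1) (nsq : ~ is_square D).
Implicit Types (P Q : {poly K}).

Lemma D_neq0 : D != 0. Proof. by rewrite -size_poly_gt0 sD. Qed.

Lemma sqrt_irrational P Q : P ^+ 2 = D * Q ^+ 2 -> P = 0 /\ Q = 0.
Proof.
move=> e; have [Q0|Q0] := eqVneq Q 0.
  split=> //; have : P ^+ 2 == 0 by rewrite e Q0 expr0n mulr0.
  by rewrite expf_eq0 => /andP[_ /eqP].
have /dvdpP [u PE] : Q %| P by rewrite -(@dvdp_pexp2r _ _ _ 2) // e dvdp_mull.
case: nsq; exists u; apply: (mulIf (expf_neq0 2 Q0)).
by rewrite -e PE exprMn.
Qed.

Lemma norm_neq0 P Q : (P != 0) || (Q != 0) -> norm D P Q != 0.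
Proof.
move=> PQ; apply: contraL PQ; rewrite /norm subr_eq0 => /eqP /sqrt_irrational [-> ->].
by rewrite eqxx.
Qed.

Lemma val_neq0 P Q : (P != 0) || (Q != 0) -> val_pos S P Q != 0 /\ val_neg S P Q != 0.
Proof.
move=> /norm_neq0; rewrite -lpoly_eq0 -(val_norm SD) mulf_eq0 negb_or => /andP[].
by [].
Qed.

(** The quotient of an element by its conjugate is multiplicative and depends only on the
    proportionality class; relations between classes become equations in the field of series. *)
Lemma proportional_val P Q P' Q' : (P != 0) || (Q != 0) -> (P' != 0) || (Q' != 0) ->
  (P * Q' = P' * Q <-> val_pos S P Q / val_neg S P Q = val_pos S P' Q' / val_neg S P' Q').
Proof.
move=> /val_neq0 [p0 n0] /val_neq0 [p0' n0'].
have S0 : S != 0 by apply: contraNneq Sd0 => ->.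
have two0 : (2%:R : laurent K) != 0.
  have := twoS_neq0 Sd0; by apply: contraNneq => ->; rewrite mul0r.
have e : val_pos S P Q * val_neg S P' Q' - val_pos S P' Q' * val_neg S P Q =
    - (2%:R * S) * (P * Q' - P' * Q)%:L.
  by rewrite /val_pos /val_neg rmorphB !rmorphM /=; ring.
split=> h.
  apply/eqP; rewrite eqr_div // -subr_eq0 e h subrr rmorph0 mulr0 //.
move/eqP: h; rewrite eqr_div // -subr_eq0 e mulf_eq0 oppr_eq0 mulf_eq0 (negbTE S0) orbF.
rewrite (negbTE two0) /= lpoly_eq0 subr_eq0 => /eqP //.
Qed.

Definition pair_power P Q (l : nat) : {poly K} * {poly K} :=
  iter l (fun y => (P * y.1 + D * Q * y.2, P * y.2 + Q * y.1)) (1, 0).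

Lemma pair_power_val P Q l :
  val_pos S (pair_power P Q l).1 (pair_power P Q l).2 = val_pos S P Q ^+ l /\
  val_neg S (pair_power P Q l).1 (pair_power P Q l).2 = val_neg S P Q ^+ l.
Proof.
elim: l => [|l [IH1 IH2]].
  by rewrite /val_pos /val_neg /= rmorph1 rmorph0 mul0r addr0 subr0.
by rewrite !exprS -IH1 -IH2 (val_posM SD) (val_negM SD).
Qed.

Lemma pair_power_rec P Q l : (pair_power P Q l.+2).1 =
  2%:R * P * (pair_power P Q l.+1).1 - norm D P Q * (pair_power P Q l).1.
Proof. by rewrite /norm /=; move: (pair_power P Q l) => y; ring. Qed.

(* The traces of the powers of P + Q S satisfy a linear recurrence, so a pole of
   P / N would make the poles of these traces grow linearly. *)
Lemma trace_dvd P Q (N : {poly K}) (c : K) (b : nat) : N != 0 -> norm D P Q = c *: N ^+ 2 ->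
  (forall l, exists M : {poly K}, [/\ M != 0, (size M <= b.+1)%N &
     N ^+ (2 * l) %| (pair_power P Q l).1 ^+ 2 * M]) -> N %| P.
Proof.
move=> N0 nE H; pose g := gcdp N P.
have g0 : g != 0 by rewrite gcdp_eq0 negb_and N0.
pose n := N %/ g; pose t := P %/ g.
have NE : N = n * g by rewrite divpK // dvdp_gcdl.
have PE : P = t * g by rewrite divpK // dvdp_gcdr.
have cnt : coprimep n t by apply: coprimep_div_gcd; rewrite N0.
have tr l : exists u v, [/\ (pair_power P Q l).1 = g ^+ l * u, coprimep n u,
    (pair_power P Q l.+1).1 = g ^+ l.+1 * v & coprimep n v].
  elim: l => [|l [u [v [e1 c1 e2 c2]]]].
    exists 1, t; split=> //; first by rewrite expr0 mulr1.
      exact: coprimep1.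
    by rewrite /= mulr1 mulr0 addr0 expr1 mulrC.
  exists v, (2%:R * t * v - c *: (n ^+ 2 * u)); split=> //.
    rewrite pair_power_rec e1 e2 nE {1}PE NE -!mul_polyC !exprS; ring.
  have -> : 2%:R * t * v - c *: (n ^+ 2 * u) = (- (c *: (n * u))) * n + (2%:R : K) *: (t * v).
    by rewrite -!mul_polyC expr2 (_ : (2%:R : K)%:P = 2%:R) ?polyC_natr //; ring.
  by rewrite coprimep_addl_mul coprimepZr ?pnatr_eq0 // coprimepMr cnt.
(* With this exponent n^(2 (b + 1)) divides M, of degree at most b, so n must be constant. *)
have [M [M0 sM hM]] := H b.+1.
have [u [_ [e cu _ _]]] := tr b.+1.
have h : n ^+ (2 * b.+1) %| M.
  have h1 : n ^+ (2 * b.+1) * g ^+ (2 * b.+1) %| (u ^+ 2 * M) * g ^+ (2 * b.+1).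
    rewrite -exprMn -NE.
    have <- : (pair_power P Q b.+1).1 ^+ 2 * M = u ^+ 2 * M * g ^+ (2 * b.+1).
      by rewrite e exprMn -exprM [(b.+1 * 2)%N]mulnC; ring.
    exact: hM.
  rewrite dvdp_mul2r ?expf_neq0 // in h1.
  by rewrite -(@Gauss_dvdpr _ _ (u ^+ 2)) // coprimep_expl // coprimep_expr.
have n0 : n != 0 by apply: contraNneq N0 => n0; rewrite NE n0 mul0r.
have sn : size n = 1%N.
  have le := leq_trans (dvdp_leq M0 h) sM; have := size_exp n (2 * b.+1).
  have : (0 < size n)%N by rewrite size_poly_gt0.
  move: (size (n ^+ (2 * b.+1))) le => k le; case: (size n) => [|[|l]] //= _ el.
  suff : (2 * b.+1 <= l.+1 * (2 * b.+1))%N by rewrite -el; lia.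
  by rewrite leq_pmull.
have /eqP/size_poly1P [a a0 nE'] := sn.
rewrite NE nE'.
by rewrite mul_polyC dvdpZl // dvdp_gcdr.
Qed.

Lemma norm_scale P Q (u : {poly K}) : norm D (u * P) (u * Q) = u ^+ 2 * norm D P Q.
Proof. by rewrite /norm; ring. Qed.

Lemma norm_val P Q : (norm D P Q)%:L = val_pos S P Q * val_neg S P Q.
Proof. by rewrite (val_norm SD). Qed.

Lemma coprime_nonzero P Q : coprimep P Q -> (P != 0) || (Q != 0).
Proof.
apply: contraTT; rewrite negb_or !negbK => /andP[/eqP -> /eqP ->].
by rewrite /coprimep gcdp0 size_poly0.
Qed.

Lemma val_pos_nonzero P Q : val_pos S P Q != 0 -> (P != 0) || (Q != 0).
Proof.
apply: contraNT; rewrite negb_or !negbK => /andP[/eqP -> /eqP ->].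
by rewrite /val_pos rmorph0 mul0r addr0.
Qed.

(* From an integral element P + Q S of norm c N^2 with N | P: cancelling N leaves
   a denominator r with r^2 | D. *)
Lemma pell_descent P Q N (c : K) : N != 0 -> c != 0 -> Q != 0 -> norm D P Q = c *: N ^+ 2 ->
  N %| P -> exists r Dstar, [/\ D = r ^+ 2 * Dstar, Pellian Dstar & r = N %/ gcdp N Q].
Proof.
move=> N0 c0 Q0 nE /dvdpP [P' PE]; pose G := gcdp N Q.
have G0 : G != 0 by rewrite gcdp_eq0 negb_and N0.
pose r := N %/ G; pose Q' := Q %/ G.
have NE : N = r * G by rewrite divpK // dvdp_gcdl.
have QE : Q = Q' * G by rewrite divpK // dvdp_gcdr.
have crQ : coprimep r Q' by apply: coprimep_div_gcd; rewrite N0.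
have e : D * Q' ^+ 2 = r ^+ 2 * (P' ^+ 2 - c%:P).
  apply: (mulIf (expf_neq0 2 G0)); move: nE; rewrite /norm PE -mul_polyC => nE.
  transitivity (D * Q ^+ 2); first by rewrite QE; ring.
  have -> : D * Q ^+ 2 = (P' * N) ^+ 2 - c%:P * N ^+ 2 by rewrite -nE; ring.
  by rewrite NE; ring.
have /dvdpP [E DE] : r ^+ 2 %| D.
  rewrite -(@Gauss_dvdpl _ D (Q' ^+ 2)) ?coprimep_expl ?coprimep_expr //.
  by rewrite e dvdp_mulr.
have r0 : r != 0 by apply: contraNneq N0 => r0; rewrite NE r0 mul0r.
have eE : E * Q' ^+ 2 = P' ^+ 2 - c%:P.
  apply: (mulfI (expf_neq0 2 r0)); rewrite -e DE; ring.
exists r, E; split=> //; first by rewrite mulrC.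
split.
- have E0 : E != 0 by apply: contraNneq D_neq0 => E0; rewrite DE E0 mul0r.
  have : (size D).-1 = ((size E).-1 + (size r).-1 * 2)%N.
    rewrite DE size_mul ?expf_neq0 // -(size_exp r 2).
    have : (0 < size E)%N by rewrite size_poly_gt0.
    have : (0 < size (r ^+ 2))%N by rewrite size_poly_gt0 expf_neq0.
    by case: (size E) => // a; case: (size (r ^+ 2)) => // b _ _; rewrite addnS.
  rewrite sD /= => /(congr1 odd); rewrite oddD !oddM andbF addbF /= => <-.
  by [].
- by move=> [q qE]; apply: nsq; exists (q * r); rewrite DE qE exprMn.
pose b := sqrtC c^-1; have b2 : b ^+ 2 = c^-1 by rewrite sqrtCK.
have b0 : b != 0 by apply: contraNneq c0 => b0; rewrite -invr_eq0 -b2 b0 expr0n.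
exists (b *: P'), (b *: Q'); split.
  rewrite scaler_eq0 negb_or b0 /=; apply: contraNneq Q0 => Q'0.
  by rewrite QE Q'0 mul0r.
rewrite !exprZn b2 -scalerAr eE -scalerBr opprB addrC subrK.
by rewrite -mul_polyC -rmorphM mulVf.
Qed.

(** Let g = gcd(r, P). Then g^2 divides both D and the norm N, hence g divides P' and the gcd G in N
    = r G. Cancelling g^2 there shows that r / g divides (P / g)^2, to which it is prime; so r
    equals g up to a constant. *)
Lemma conductor_sq_dvd P Q P' Q' r (c : K) : norm D P Q != 0 -> r ^+ 2 %| D ->
  norm D P' Q' = c *: norm D P Q ->
  r = norm D P Q %/ gcdp (norm D P Q) (P' * - Q + Q' * P) -> r ^+ 2 %| norm D P Q.
Proof.
set N := norm D P Q => N0 rD nE; set G := gcdp N _ => rE.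
have NE : N = r * G by rewrite rE divpK // dvdp_gcdl.
have r0 : r != 0 by apply: contraNneq N0 => r0; rewrite NE r0 mul0r.
pose g := gcdp r P; have g0 : g != 0 by rewrite gcdp_eq0 negb_and r0.
pose r' := r %/ g; pose P2 := P %/ g.
have rE' : r = r' * g by rewrite divpK // dvdp_gcdl.
have PE : P = P2 * g by rewrite divpK // dvdp_gcdr.
have cop : coprimep r' P2 by apply: coprimep_div_gcd; rewrite r0.
have [E DE] := dvdpP _ _ rD.
have NE1 : N = (P2 ^+ 2 - r' ^+ 2 * E * Q ^+ 2) * g ^+ 2.
  by rewrite /N /norm PE DE rE'; ring.
have gN : g ^+ 2 %| N by rewrite NE1 dvdp_mull.
have gD : g ^+ 2 %| D by rewrite DE rE' exprMn mulrA dvdp_mull.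
have gP' : g %| P'.
  rewrite -(@dvdp_pexp2r _ _ _ 2) //.
  have -> : P' ^+ 2 = c *: N + D * Q' ^+ 2 by rewrite -nE /norm subrK.
  rewrite dvdp_add //; first by rewrite -mul_polyC dvdp_mull.
  exact: dvdp_mulr.
have gG : g %| G.
  rewrite dvdp_gcd; apply/andP; split.
    by apply: dvdp_trans gN; rewrite expr2 dvdp_mull.
  by apply: dvdp_add; [apply: dvdp_mulr | apply/dvdp_mull/dvdp_gcdr].
have [G' GE] := dvdpP _ _ gG.
have n1 : P2 ^+ 2 - r' ^+ 2 * E * Q ^+ 2 = r' * G'.
  apply: (mulIf (expf_neq0 2 g0)); rewrite -NE1 NE GE rE'; ring.
have h : r' %| P2 ^+ 2.
  have -> : P2 ^+ 2 = r' * (G' + r' * E * Q ^+ 2).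
    by rewrite mulrDr -n1; ring.
  exact: dvdp_mulr.
have : size r' == 1%N.
  by rewrite -dvdp1 -(@Gauss_dvdpr _ _ (P2 ^+ 2)) ?mulr1 // coprimep_expr.
case/size_poly1P => a a0 r'E.
by rewrite rE' r'E mul_polyC exprZn dvdpZl ?expf_neq0.
Qed.

(** The inequality 2 s < d acts twice: it makes products with equal index sums proportional, and it
    turns 2 deg r <= s into the bound on the degree of D / r^2. *)
Lemma pell_of_progression (A : int) (s k : nat) : (0 < k)%N -> (2 * s < d)%N ->
  (forall j : nat, small_element S (A + (j * k)%N%:Z) (s%:Z - A - (j * k)%N%:Z)) ->
  exists r Dstar : {poly K}, [/\ D = r ^+ 2 * Dstar, Pellian Dstar &
    (3 * d < 2 * (size Dstar).-1)%N].
Proof.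
move=> k0 sd H0; pose k' := ((2 * s).+1 * k)%N.
have k's : (2 * s < k')%N by rewrite /k'; apply: leq_pmulr.
have /choice [F hF] : forall j : nat, exists y : {poly K} * {poly K}, [/\ coprimep y.1 y.2,
    lord_le (val_pos S y.1 y.2) (A + (j * k')%N%:Z) &
    lord_le (val_neg S y.1 y.2) (s%:Z - A - (j * k')%N%:Z)].
  move=> j; have := H0 (j * (2 * s).+1)%N; rewrite -mulnA.
  by move=> /(small_element_primitive Sd0) [P [Q h]]; exists (P, Q).
move: k' k's hF => {k k0 H0} k ks hF.
pose p j := (F j).1; pose q j := (F j).2.
have cpr j : coprimep (p j) (q j) by case: (hF j).
have hpos j : lord_le (val_pos S (p j) (q j)) (A + (j * k)%N%:Z) by case: (hF j).
have hneg j : lord_le (val_neg S (p j) (q j)) (s%:Z - A - (j * k)%N%:Z) by case: (hF j).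
move: p q cpr hpos hneg => {F hF} p q cpr hpos hneg.
have nz j := coprime_nonzero (cpr j).
have [pos0 neg0] : (forall j, val_pos S (p j) (q j) != 0) /\ (forall j, val_neg S (p j) (q j) != 0).
  by split=> j; case: (val_neq0 (nz j)).
pose R j := val_pos S (p j) (q j) / val_neg S (p j) (q j).
have R0 j : R j != 0 by rewrite mulf_neq0 ?invr_eq0.
have mulR i l m n : (i + l = m + n)%N -> R i * R l = R m * R n.
  move=> e; have RM i' l' : R i' * R l' =
      val_pos S (p i' * p l' + D * q i' * q l') (p i' * q l' + q i' * p l') /
      val_neg S (p i' * p l' + D * q i' * q l') (p i' * q l' + q i' * p l').
    by rewrite -(val_posM SD) -(val_negM SD) /R mulf_div.
  have nzM i' l' : (p i' * p l' + D * q i' * q l' != 0) || (p i' * q l' + q i' * p l' != 0).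
    by apply: val_pos_nonzero; rewrite -(val_posM SD) mulf_neq0.
  have hp i' l' : lord_le (val_pos S (p i' * p l' + D * q i' * q l') (p i' * q l' + q i' * p l'))
      (A + (i' * k)%N%:Z + (A + (l' * k)%N%:Z)).
    by rewrite -(val_posM SD); apply: lord_leM.
  have hn i' l' : lord_le (val_neg S (p i' * p l' + D * q i' * q l') (p i' * q l' + q i' * p l'))
      (s%:Z - A - (i' * k)%N%:Z + (s%:Z - A - (l' * k)%N%:Z)).
    by rewrite -(val_negM SD); apply: lord_leM.
  have ek : (i * k + l * k = m * k + n * k)%N by rewrite -!mulnDl e.
  rewrite !RM; apply/(proportional_val (nzM i l) (nzM m n)).
  by apply: (small_proportional Sd Sd0 (hp i l) (hn i l) (hp m n) (hn m n)); lia.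
(* In terms of quotients by conjugates, the phi_j form a geometric progression of ratio rho. *)
pose rho := R 1%N / R 0%N.
have geo i : R i = R 0%N * rho ^+ i.
  elim: i => [|i IH]; first by rewrite expr0 mulr1.
  have e : R i.+1 * R 0%N = R i * R 1%N by apply: mulR; rewrite addn0 addn1.
  apply: (mulIf (R0 0%N)); rewrite e IH exprSr /rho; field.
  by rewrite R0.
pose N j := norm D (p j) (q j).
have N0 j : N j != 0 by apply: norm_neq0.
have sN j : (size (N j) <= s.+1)%N.
  apply: poly_lord_le; rewrite norm_val.
  by apply: lord_le_trans (lord_leM (hpos j) (hneg j)); lia.
(* Some multiple u phi_j equals phi_0 times the j-th power of phi_1 and the conjugate of phi_0. On
   norms this reads u^2 N_j = N_0 (N_1 N_0)^j, which locates the roots of N_j; their multiplicities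
   are at most s. *)
have Ndvd j : N j %| (N 0%N * N 1%N) ^+ s.
  apply: dvdp_radical => //; first by have := sN j; case: (size (N j)).
  move=> z rz.
  pose y := pair_power (p 1%N * p 0%N + D * q 1%N * - q 0%N) (p 1%N * - q 0%N + q 1%N * p 0%N) j.
  pose P := p 0%N * y.1 + D * q 0%N * y.2; pose Q := p 0%N * y.2 + q 0%N * y.1.
  have [e1 e2] := pair_power_val (p 1%N * p 0%N + D * q 1%N * - q 0%N)
     (p 1%N * - q 0%N + q 1%N * p 0%N) j.
  rewrite -/y -(val_posM SD) -(val_negM SD) -val_neg_pos -val_pos_neg in e1 e2.
  have eP : val_pos S P Q = val_pos S (p 0%N) (q 0%N) * val_pos S y.1 y.2 by rewrite (val_posM SD).
  have eN : val_neg S P Q = val_neg S (p 0%N) (q 0%N) * val_neg S y.1 y.2 by rewrite (val_negM SD).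
  have nPQ : (P != 0) || (Q != 0).
    by apply: val_pos_nonzero; rewrite eP e1 mulf_neq0 // expf_neq0 // mulf_neq0.
  have prop : p j * Q = P * q j.
    apply/(proportional_val (nz j) nPQ); rewrite eP eN e1 e2 -/(R j) geo /rho /R.
    by rewrite invf_div mulf_div expr_div_n mulf_div.
  have [u [PE QE]] := coprime_proportional (cpr j) prop.
  have : norm D P Q = N 0%N * (N 1%N * N 0%N) ^+ j.
    apply: lpoly_inj; rewrite norm_val eP eN e1 e2 rmorphM rmorphXn rmorphM /= /N !norm_val.
    by rewrite !exprMn; ring.
  rewrite PE QE norm_scale => /(congr1 (fun f : {poly K} => f.[z])).
  rewrite hornerM (rootP rz) mulr0 => /esym/eqP.
  rewrite hornerM horner_exp hornerM /root hornerM mulf_eq0 => /orP[/eqP -> |].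
    by rewrite mul0r.
  by rewrite expf_eq0 mulrC => /andP[].
have [i [j [ij eqN]]] := divisors_pigeonhole (expf_neq0 s (mulf_neq0 (N0 0%N) (N0 1%N))) Ndvd.
pose c := lead_coef (N j) / lead_coef (N i).
have li : lead_coef (N i) != 0 by rewrite lead_coef_eq0.
have lj : lead_coef (N j) != 0 by rewrite lead_coef_eq0.
have c0 : c != 0 by rewrite mulf_neq0 ?invr_eq0.
have Nj : N j = c *: N i.
  by rewrite /c mulrC -scalerA (eqp_eq eqN) scalerA mulVf // scale1r.
pose P := p j * p i + D * q j * - q i; pose Q := p j * - q i + q j * p i.
have eP : val_pos S P Q = val_pos S (p j) (q j) * val_neg S (p i) (q i).
  by rewrite val_neg_pos (val_posM SD).
have eN : val_neg S P Q = val_neg S (p j) (q j) * val_pos S (p i) (q i).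
  by rewrite val_pos_neg (val_negM SD).
have nE : norm D P Q = c *: N i ^+ 2.
  apply: lpoly_inj; rewrite norm_val eP eN expr2 scalerAl -Nj rmorphM /= /N !norm_val; ring.
have nPQ : (P != 0) || (Q != 0) by apply: val_pos_nonzero; rewrite eP mulf_neq0.
have quotE l : val_pos S P Q ^+ l / val_neg S P Q ^+ l = rho ^+ ((j - i) * l).
  rewrite -expr_div_n exprM; congr (_ ^+ _); rewrite eP eN -mulf_div -[X in _ * X]invf_div.
  rewrite -/(R j) -/(R i) (geo j) (geo i) -mulf_div divff // mul1r -expfB //.
(* The l-th power of P + Q S is proportional to phi_m times the conjugate of phi_0, where m = (j -
   i) l. The norm N_m N_0 of the latter, of degree at most 2 s, is the factor M asked for by
   [trace_dvd]. *)
have NP : N i %| P.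
  apply: (@trace_dvd P Q (N i) c (2 * s) (N0 i) nE) => l.
  exists (N ((j - i) * l)%N * N 0%N); split.
  - by rewrite mulf_neq0.
  - rewrite size_mul //; have := leq_add (sN ((j - i) * l)%N) (sN 0%N).
    by move: (_ + _)%N => x; lia.
  set m := ((j - i) * l)%N; have [e1 e2] := pair_power_val P Q l.
  move: (pair_power P Q l) e1 e2 => X e1 e2.
  pose y1 := p m * p 0%N + D * q m * - q 0%N; pose y2 := p m * - q 0%N + q m * p 0%N.
  have f1 : val_pos S y1 y2 = val_pos S (p m) (q m) * val_neg S (p 0%N) (q 0%N).
    by rewrite val_neg_pos (val_posM SD).
  have f2 : val_neg S y1 y2 = val_neg S (p m) (q m) * val_pos S (p 0%N) (q 0%N).
    by rewrite val_pos_neg (val_negM SD).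
  have pPQ : val_pos S P Q != 0 by rewrite eP mulf_neq0.
  have nX : (X.1 != 0) || (X.2 != 0) by apply: val_pos_nonzero; rewrite e1 expf_neq0.
  have ny : (y1 != 0) || (y2 != 0) by apply: val_pos_nonzero; rewrite f1 mulf_neq0.
  have prop : X.1 * y2 = y1 * X.2.
    apply/(proportional_val nX ny); rewrite e1 e2 f1 f2 quotE -mulf_div -[X in _ * X]invf_div.
    by rewrite -/(R m) -/(R 0%N) geo mulrAC divff // mul1r.
  have nEX : norm D X.1 X.2 = c ^+ l *: N i ^+ (2 * l).
    rewrite exprM -exprZn -nE; apply: lpoly_inj.
    by rewrite rmorphXn /= !norm_val e1 e2 exprMn.
  have nEy : norm D y1 y2 = N m * N 0%N.
    by apply: lpoly_inj; rewrite rmorphM /= /N !norm_val f1 f2; ring.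
  have -> : X.1 ^+ 2 * (N m * N 0%N) = norm D X.1 X.2 * y1 ^+ 2.
    transitivity ((X.1 * y1) ^+ 2 - D * (X.1 * y2) ^+ 2); first by rewrite -nEy /norm; ring.
    by rewrite prop /norm; ring.
  by rewrite nEX -scalerAl dvdpZr ?expf_neq0 // dvdp_mulr.
(* If Q = 0 then rho has finite order, so phi_0 divides phi_m for arbitrarily large m, and its
   conjugate would have arbitrarily low degree. *)
have Q0 : Q != 0.
  apply/eqP => Q0; have rho1 : rho ^+ (j - i) = 1.
    have pPQ : val_pos S P Q != 0 by rewrite eP mulf_neq0.
    have := quotE 1%N; rewrite muln1 !expr1 => <-.
    have <- : val_pos S P Q = val_neg S P Q.
      by rewrite Q0 /val_pos /val_neg rmorph0 mul0r addr0 subr0.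
    by rewrite divff.
  have [M [top _]] := laurent_topP (neg0 0%N).
  pose t := `|(s%:Z - A - M)%R|.+1%N; pose m := ((j - i) * t)%N.
  have prop : p 0%N * q m = p m * q 0%N.
    apply/(proportional_val (nz 0%N) (nz m)); rewrite -/(R 0%N) -/(R m).
    by rewrite (geo m) /m exprM rho1 expr1n mulr1.
  have [u [PE QE]] := coprime_proportional (cpr 0%N) prop.
  have u0 : u != 0.
    by apply: contraTneq (nz m) => u0; rewrite PE QE u0 !mul0r eqxx.
  have le : lord_le (val_neg S (p 0%N) (q 0%N)) (s%:Z - A - (m * k)%N%:Z).
    by apply: (lord_le_polyM Sd0 u0); rewrite val_neg_scale -PE -QE; apply: hneg.
  case/eqP: top; apply: le.
  have : (t <= m * k)%N.
    have ji : (0 < (j - i) * k)%N by rewrite muln_gt0 subn_gt0 ij; lia.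
    by rewrite /m mulnAC leq_pmull.
  by rewrite /t; lia.
have [r [Ds [DE PD rE]]] := pell_descent (N0 i) c0 Q0 nE NP.
exists r, Ds; split=> //.
have rN : r ^+ 2 %| N i.
  have rD : r ^+ 2 %| D by rewrite DE dvdp_mulr.
  exact: (conductor_sq_dvd (N0 i) rD Nj rE).
have r0 : r != 0 by apply: contraNneq D_neq0 => r0; rewrite DE r0 expr0n mul0r.
have Ds0 : Ds != 0 by apply: contraNneq D_neq0 => Ds0; rewrite DE Ds0 mulr0.
have sr := leq_trans (dvdp_leq (N0 i) rN) (sN i).
have := congr1 (fun f : {poly K} => size f) DE; rewrite /= sD size_mul ?expf_neq0 //.
have := size_exp r 2; have : (0 < size Ds)%N by rewrite size_poly_gt0.
have : (0 < size r)%N by rewrite size_poly_gt0.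
move: sr; move: (size (r ^+ 2)) (size r) (size Ds) => x y z; lia.
Qed.

End Progression.

(** * Convergents of the square root *)

Section SquareRoot.
Variables (K : numClosedFieldType) (S : laurent K) (d : nat) (D : {poly K}).
Hypotheses (SD : S ^+ 2 = D%:L) (d0 : (0 < d)%N) (sD : size D = (2 * d).+1) (nsq : ~ is_square D).
Implicit Types (P Q : {poly K}).

Lemma sqrt_lord : lord_le S d%:Z /\ S d%:Z != 0.
Proof.
have S0 : S != 0.
  apply: contraPneq SD => ->; rewrite expr0n /= => /esym/eqP.
  by rewrite lpoly_eq0 -size_poly_eq0 sD.
have [M [SM hM]] := laurent_topP S0.
have lD : D`_(2 * d) != 0 by rewrite -[(2 * d)%N]/((2 * d).+1.-1) -sD -/(lead_coef D)
  lead_coef_eq0 -size_poly_eq0 sD.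
have Stop : (S * S) (M + M) != 0 by rewrite (lcoefM_top hM hM) mulf_neq0.
have e : M + M = (2 * d)%N%:Z.
  rewrite -expr2 SD in Stop.
  have Sle : lord_le D%:L (M + M) by rewrite -SD expr2; apply: lord_leM.
  have [lt|gt|//] := ltgtP (M + M) (2 * d)%N%:Z.
    by have := Sle _ lt; rewrite lcoef_poly => /eqP; rewrite (negbTE lD).
  case/eqP: Stop; have hD : lord_le D%:L (2 * d)%N%:Z by apply: lord_le_poly; rewrite sD.
  exact: hD.
by have <- : M = d%:Z by lia.
Qed.

Let Sd := sqrt_lord.1.
Let Sd0 := sqrt_lord.2.

(** Comparing coefficients in S^2 = D determines each coefficient of S from the higher ones, after
    division by twice the leading one. *)
Lemma sqrt_coefs (A : K -> Prop) : subring A -> A (2%:R)^-1 -> A (S d%:Z)^-1 -> A (S d%:Z) ->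
  pcoefs A D -> lcoefs A S.
Proof.
move=> hA A2 ASi AS hD; have AG := subring_addgroup hA; have [A1 _ AM] := hA.
have H (k : nat) : A (S (d%:Z - k%:Z)).
  elim/ltn_ind: k => -[|k] IH; first by rewrite subr0.
  have AD : A ((S ^+ 2) (d%:Z + d%:Z - k.+1%:Z)).
    by rewrite SD; apply: lcoefs_poly => //; case: AG.
  move: AD; rewrite expr2 (lcoefM_conv k.+1 Sd Sd) big_ord_recl big_ord_recr /=.
  rewrite subr0 subn0 subnn subr0; set T := \sum_(i < k) _ => AD.
  have AT : A T.
    apply: addgroup_sum => // i _; have := ltn_ord i => ik; apply: (AM); apply: IH.
      by rewrite /bump /=; lia.
    by rewrite /bump /=; lia.
  have two0 : (2%:R : K) != 0 by rewrite pnatr_eq0.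
  have -> : S (d%:Z - k.+1%:Z) =
      (S d%:Z * S (d%:Z - k.+1%:Z) + (T + S (d%:Z - (bump 0 k)%:Z) * S d%:Z) - T) *
      (2%:R^-1 * (S d%:Z)^-1).
    rewrite /bump leq0n add1n; by field; rewrite Sd0 ?pnatr_eq0.
  apply: (AM); last exact: AM.
  exact: AG.2.
move=> n; have [lt|le] := ltP d%:Z n; first by rewrite Sd //; case: AG.
by have -> : n = d%:Z - `|(d%:Z - n)%R|%N%:Z by lia.
Qed.

Lemma sqrt_not_polynomial : exists2 m : int, m < 0 & S m != 0.
Proof.
apply: contrapT => nex; apply: nsq; exists (polypart S); apply: lpoly_inj.
rewrite -SD rmorphXn /=; congr (_ ^+ 2); apply/laurentP => -[n|n].
  by rewrite lcoef_poly coef_polypart.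
rewrite [RHS](_ : _ = 0) //; apply/eqP; apply: contrapT => /negP Sn; apply: nex.
by exists (Negz n).
Qed.

Lemma inverse_degree (f : laurent K) : f != 0 -> lord_le f (-1) -> exists e : nat,
  [/\ (0 < e)%N, lord_le f^-1 e%:Z, f^-1 e%:Z != 0 & (size (polypart f^-1)).-1 = e].
Proof.
move=> f0 hf; have [M [fM hM]] := laurent_topP f0.
have M1 : M <= -1 by rewrite leNgt; apply: contra fM => /hf ->.
have eM : - M = `|M|%N%:Z by lia.
have hV := lord_leV hM fM; have V0 : (f^-1) (- M) != 0 by rewrite lcoefV_top // invr_eq0.
rewrite eM in hV V0; exists `|M|%N; split=> //; first by lia.
suff -> : size (polypart f^-1) = `|M|%N.+1 by [].
apply/anti_leq/andP; split.
  by apply/leq_sizeP => j lt; rewrite coef_polypart hV //; lia.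
rewrite ltnNge; apply: contra V0 => /leq_sizeP /(_ _ (leqnn _)).
by rewrite coef_polypart => ->.
Qed.

Lemma quotient_degree n : complete_quotient S n.+1 != 0 -> exists k : nat,
  [/\ (0 < k)%N, lord_le (complete_quotient S n.+1) k%:Z, complete_quotient S n.+1 k%:Z != 0 &
      (size (partial_quotient S n.+1)).-1 = k].
Proof.
move=> h; apply: (@inverse_degree (complete_quotient S n - (partial_quotient S n)%:L)).
  by rewrite -invr_eq0.
exact: lord_le_polypart.
Qed.

(** Squaring the determinant of two consecutive convergents hides its alternating sign. *)
Lemma unimodular_neq0 P' Q' P Q : (P' * Q - P * Q') ^+ 2 = 1 ->
  (P' != 0) || (Q' != 0) /\ (P != 0) || (Q != 0).
Proof.
move=> det; split; apply: contra_eqT det; rewrite negb_or !negbK => /andP[/eqP -> /eqP ->].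
  by rewrite mul0r mulr0 subrr expr0n eq_sym oner_eq0.
by rewrite mul0r mulr0 subrr expr0n eq_sym oner_eq0.
Qed.

(* [val_pos S P' Q'] and [val_pos S P Q] are, up to sign, consecutive errors
   p_n - q_n S of convergents p_n / q_n. *)
Lemma convergents n : exists (M : nat) P' Q' P Q, [/\ (n <= M)%N,
  (P' * Q - P * Q') ^+ 2 = 1,
  val_pos S P' Q' = complete_quotient S n.+1 * val_pos S P Q,
  lord_le (val_pos S P' Q') (- M%:Z) & lord_le (val_neg S P' Q') (d%:Z + M%:Z) /\
  lord_le (val_neg S P Q) (d%:Z + M%:Z)].
Proof.
elim: n => [|n [M [P' [Q' [P [Q [nM det e hpos [hneg' hneg]]]]]]]].
  pose a := polypart S; exists 0%N, 1, 0, (- a), 1.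
  have ha : lord_le a%:L d%:Z.
    have -> : a%:L = S - (S - a%:L) by rewrite subKr.
    by apply: lord_leB => //; apply: lord_le_trans (lord_le_polypart S).
  have pos1 : val_pos S 1 0 = 1 by rewrite /val_pos rmorph1 rmorph0 mul0r addr0.
  have neg1 : val_neg S 1 0 = 1 by rewrite /val_neg rmorph1 rmorph0 mul0r subr0.
  have posa : val_pos S (- a) 1 = S - a%:L.
    by rewrite /val_pos rmorph1 rmorphN mul1r addrC.
  have nz : S - a%:L != 0.
    by rewrite -posa; case: (val_neq0 SD nsq (P := - a) (Q := 1)); rewrite ?oner_eq0 ?orbT.
  rewrite pos1 neg1 posa /= addr0 oppr0; split=> //.
  - by rewrite mulr0 subr0 mulr1 expr1n.
  - by rewrite mulVf.
  - exact: lord_le1.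
  split; first by apply: lord_le_trans (lord_le1 K).
  by rewrite /val_neg rmorph1 mul1r; apply: lord_leB => //; rewrite rmorphN; apply: lord_leN.
have [posn0 _] := val_neq0 SD nsq (unimodular_neq0 det).1.
set al := complete_quotient S n.+1 in e *; pose a := partial_quotient S n.+1.
have al0 : al != 0 by apply: contraNneq posn0 => al0; rewrite e al0 mul0r.
have [k [k0 hal top ek]] := quotient_degree al0.
have ePQ : val_pos S P Q = al^-1 * val_pos S P' Q' by rewrite e mulKf.
exists (M + k)%N, P, Q, (P' - a * P), (Q' - a * Q).
have det' : (P * (Q' - a * Q) - (P' - a * P) * Q) ^+ 2 = 1 by rewrite -det; ring.
have [posn1 _] := val_neq0 SD nsq (unimodular_neq0 det').2.
have posE : val_pos S (P' - a * P) (Q' - a * Q) = (al - a%:L) * val_pos S P Q.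
  by rewrite mulrBl -e val_pos_scale /val_pos !rmorphB; ring.
have ha : lord_le a%:L k%:Z.
  by apply: lord_le_poly; rewrite -ek; case: (size a).
split=> //; first by lia.
- rewrite posE /= -/al mulKf //; apply: contraNneq posn1 => h.
  by rewrite posE h mul0r.
- rewrite ePQ; have -> : - (M + k)%N%:Z = - k%:Z + - M%:Z by lia.
  by apply: lord_leM => //; apply: lord_leV.
split; first by apply: lord_le_trans hneg; lia.
have -> : val_neg S (P' - a * P) (Q' - a * Q) = val_neg S P' Q' - a%:L * val_neg S P Q.
  by rewrite val_neg_scale /val_neg !rmorphB; ring.
apply: lord_leB; first by apply: lord_le_trans hneg'; lia.
by apply: lord_le_trans (lord_leM ha hneg); lia.
Qed.

(** The pair (P, -Q) is used, so that the tiny value P + Q S becomes the second component. It equals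
    the previous error divided by a complete quotient of degree deg a, hence the extra - deg a. *)
Lemma quotient_small_element n : exists2 M : nat, (n <= M)%N &
  small_element S (d%:Z + M%:Z) (- M%:Z - (size (partial_quotient S n.+1)).-1%:Z).
Proof.
have [M [P' [Q' [P [Q [nM det e hpos [_ hneg]]]]]]] := convergents n.
have [posn0 _] := val_neq0 SD nsq (unimodular_neq0 det).1.
set al := complete_quotient S n.+1 in e *.
have al0 : al != 0 by apply: contraNneq posn0 => al0; rewrite e al0 mul0r.
have [k [k0 hal top ek]] := quotient_degree al0.
exists M => //; exists P, (- Q); rewrite oppr_eq0; split=> //; first by case: (unimodular_neq0 det).
  by rewrite -val_neg_pos.
rewrite -val_pos_neg ek.
have -> : val_pos S P Q = al^-1 * val_pos S P' Q' by rewrite e mulKf.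
by rewrite addrC; apply: lord_leM => //; apply: lord_leV.
Qed.

(** For d = 1 the run length [d./2] is 0 and runs carry no information. But then P^2 - D is a
    nonzero constant for P the polynomial part of S, and [pell_descent] applies with N = 1. *)
Lemma pell_linear : d = 1%N -> exists r Dstar : {poly K}, [/\ D = r ^+ 2 * Dstar,
  Pellian Dstar & (3 * d < 2 * (size Dstar).-1)%N].
Proof.
move=> d1; pose P := polypart S.
have one0 : (1 : {poly K}) != 0 by rewrite oner_eq0.
have N0 : norm D P 1 != 0 by apply: norm_neq0; rewrite // one0 orbT.
have hP : lord_le P%:L d%:Z.
  have -> : P%:L = S - (S - P%:L) by rewrite subKr.
  by apply: lord_leB => //; apply: lord_le_trans (lord_le_polypart S).
have sN : (size (norm D P 1) <= 1)%N.
  apply: poly_lord_le; rewrite (norm_val SD).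
  have -> : 0%N%:Z = d%:Z + -1 by rewrite d1.
  rewrite /val_pos /val_neg rmorph1 mul1r; apply: lord_leM; first exact: lord_leD.
  by rewrite -opprB; apply/lord_leN/lord_le_polypart.
have /size_poly1P [c c0 nE] : size (norm D P 1) == 1%N by rewrite eqn_leq sN size_poly_gt0.
have [|r [Ds [DE PD rE]]] := pell_descent sD nsq one0 c0 one0 _ (dvd1p P).
  by rewrite expr1n nE alg_polyC.
exists r, Ds; split=> //.
have r0 : r != 0.
  by apply: contra_eq_neq sD => r0; rewrite DE r0 expr0n mul0r size_poly0.
have Ds0 : Ds != 0.
  by apply: contra_eq_neq sD => h; rewrite DE h mulr0 size_poly0.
have sr : (size r <= 1)%N.
  by rewrite rE; apply: leq_trans (leq_divp _ _) _; rewrite size_poly1.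
have := congr1 (fun f : {poly K} => size f) DE; rewrite /= sD size_mul ?expf_neq0 //.
have := size_exp r 2; have : (0 < size Ds)%N by rewrite size_poly_gt0.
have : (0 < size r)%N by rewrite size_poly_gt0.
move: sr; move: (size (r ^+ 2)) (size r) (size Ds) => x y z; lia.
Qed.

(* Infinitely many large partial quotients give runs of small elements; by
   vanishing in classes they recur along a full arithmetic progression. *)
Lemma small_progression : (1 < d)%N ->
  (forall m, exists2 n, (m <= n)%N &
     forall i, (i < d./2)%N -> \det (twist_mx S d 1 0 (n + i)) = 0) ->
  exists a k : nat, (0 < k)%N /\ forall j i, (i < d./2)%N ->
    \det (twist_mx S d 1 0 (a + j * k + i)) = 0.
Proof.
move=> d1 runs; have [m0 m0neg Sm0] := sqrt_not_polynomial.
(* The listed elements put all coefficients of S into A, make 2 and the leading coefficient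
   invertible there, and keep S irrational modulo primes. *)
have [p [A [B [[pp hA pB] [AB AZ [L hL]]]]]] :=
  exists_frame [:: S d%:Z, (S d%:Z)^-1, 2%:R^-1, (S m0)^-1 & D].
have hB : subring B by case: pB.
have AS : A (S d%:Z) by apply: AZ; rewrite !inE eqxx.
have ASi : A (S d%:Z)^-1 by apply: AZ; rewrite !inE eqxx ?orbT.
have A2 : A 2%:R^-1 by apply: AZ; rewrite !inE eqxx ?orbT.
have ASm : A (S m0)^-1 by apply: AZ; rewrite !inE eqxx ?orbT.
have AG := subring_addgroup hA; have [A1 _ AM] := hA.
have AD : pcoefs A D.
  move=> i; have [lt|ge] := ltnP i (size D).
    by apply: AZ; rewrite !inE mem_nth ?orbT.
  by rewrite nth_default //; case: AG.
have hS : lcoefs A S := sqrt_coefs hA A2 ASi AS AD.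
pose I x := A x /\ pmul p B 2 x.
have hI : stable A I.
  have [[p0 pB2] pM] := pmul_stable p 2 hB.
  split; first split=> [|x y [Ax px] [Ay py]].
  - by split=> //; case: AG.
  - by split; [apply: AG.2|apply: pB2].
  by move=> x y Ax [Ay py]; split; [apply: AM|apply: pM => //; apply: AB].
have hX : classes A I [seq y <- L | `[< A y >]].
  split=> [y|x Ax]; first by rewrite mem_filter => /andP[/asboolP].
  have [y yL [Ay py]] := hL x Ax; exists y; first by rewrite mem_filter yL andbT; apply/asboolP.
  by split=> //; apply: AG.2.
have Ip : I (p ^ 2)%:R.
  split; first exact: subring_nat.
  by exists 1; rewrite ?mulr1 ?natrX //; apply: AB.
have p0 : (p%:R ^+ 2 : K) != 0.
  by rewrite expf_neq0 // pnatr_eq0 -lt0n prime_gt0.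
have [k [P0 [Q0 [k0 hP0 hQ0 [Ek Ek1] hN]]]] : pell S D A I.
  apply: (pell_ideal SD Sd Sd0 d0 hA A2 ASi hS m0neg Sm0 ASm hI _ hX _ Ip) => [x []//|].
  by rewrite expn_gt0 prime_gt0.
pose w := (p%:R ^+ 2)^-1 *: (norm D P0 Q0 - 1).
have hw : pcoefs B w.
  by move=> i; rewrite coefZ; have [_ [b Bb ->]] := hN i; rewrite mulKf.
have normE : P0 ^+ 2 - D * Q0 ^+ 2 = 1 + (p%:R ^+ 2 : K) *: w.
  by rewrite scalerA mulfV // scale1r /norm [RHS]addrC subrK.
have van := vanishing_class SD Sd Sd0 pp pB (AB _ A2) (AB _ ASi) (fun n => AB _ (hS n))
  (fun i => AB _ (hP0 i)) (fun i => AB _ (hQ0 i)) hw normE Ek Ek1.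
(* One residue class modulo k contains the starting points of infinitely many runs; otherwise the
   sum of the bounds m a over all classes contradicts [runs]. *)
have [a ha] : exists a, forall m, exists2 j, (m <= j)%N &
    forall i, (i < d./2)%N -> \det (twist_mx S d 1 0 (a + j * k + i)) = 0.
  apply: contrapT => nex.
  have /choice [m hm] : forall a, exists m, forall j, (m <= j)%N ->
      ~ forall i, (i < d./2)%N -> \det (twist_mx S d 1 0 (a + j * k + i)) = 0.
    move=> a; apply: contrapT => nm; apply: nex; exists a => m.
    apply: contrapT => nj; apply: nm; exists m => j mj h; apply: nj.
    by exists j.
  have [n le hn] := runs ((\sum_(a < k) m a) * k)%N.
  apply: (hm (n %% k)%N (n %/ k)%N); last first.
    by move=> i ik; rewrite [(_ %% _ + _)%N]addnC -divn_eq; apply: hn.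
  have lt : (n %% k < k)%N by rewrite ltn_mod.
  apply: (@leq_trans (\sum_(a < k) m a)); last by rewrite leq_divRL.
  by rewrite (bigD1 (Ordinal lt)) //= leq_addr.
exists a, k; split=> // j i ik; rewrite addnAC; apply: van => m.
by have [j' mj' h] := ha m; exists j' => //; rewrite addnAC; apply: h.
Qed.

Lemma unbounded_pell :
  ~ (exists N : nat, forall n, (N <= n)%N -> (2 * (size (partial_quotient S n)).-1 <= d)%N) ->
  exists r Dstar : {poly K}, [/\ D = r ^+ 2 * Dstar,
    Pellian Dstar & (3 * d < 2 * (size Dstar).-1)%N].
Proof.
move=> unb; have [d1|d1] : d = 1%N \/ (1 < d)%N by lia.
  exact: pell_linear.
have [|a [k [k0 h]]] := small_progression d1.
  move=> m; have [n mn big] : exists2 n, (m < n)%N &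
      (d < 2 * (size (partial_quotient S n)).-1)%N.
    apply: contrapT => nex; apply: unb; exists m.+1 => n mn.
    by rewrite leqNgt; apply/negP => lt; apply: nex; exists n.
  case: n mn big => // n mn big; have [M nM [P [Q [nz hp hn]]]] := quotient_small_element n.
  (* At n = d + 1 + M the bound d + M on the first component is met. The bound - M - deg a on the
     second allows shifts i up to deg a - 2, which covers i < [d./2] because deg a > d / 2. *)
  exists (d + 1 + M)%N; first by lia.
  move=> i ih; apply/(twist_det_small Sd Sd0); exists P, Q; split=> //.
    by apply: lord_le_trans hp; lia.
  apply: lord_le_trans hn; move: big; move: (size _).-1 => e big; lia.
have h0 : (0 < d./2)%N by lia.
(* s is the sum of the two degree bounds of a run, (a - 1 + j k) + (d - a - j k - [d./2]). *)
apply: (pell_of_progression SD Sd Sd0 d0 sD nsq (A := a%:Z - 1) (s := (d - d./2 - 1)%N) k0).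
  by lia.
move=> j; have [|P [Q [c hp hn]]] := small_run Sd Sd0 (n := (a + j * k)%N) h0.
  by move=> i ih; apply/(twist_det_small Sd Sd0); apply: h.
exists P, Q; split; first exact: coprime_nonzero c.
  by apply: lord_le_trans hp; lia.
by apply: lord_le_trans hn; lia.
Qed.

End SquareRoot.

(** Squarefreeness makes r constant, so D and E differ by the square of a constant, which y
    absorbs. *)
Lemma squarefree_Pellian (K : numClosedFieldType) (D r E : {poly K}) : squarefree D ->
  D = r ^+ 2 * E -> Pellian E -> Pellian D.
Proof.
move=> sf DE; have /eqP/size_poly1P [c c0 rE] : size r = 1%N by apply: sf; rewrite DE dvdp_mulr.
have {}DE : D = c ^+ 2 *: E by rewrite DE rE -mul_polyC rmorphXn.
move=> [ev nsqE [x [y [y0 xy]]]]; split.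
- by rewrite DE size_scale ?expf_neq0.
- move=> [q qE]; apply: nsqE; exists (c^-1 *: q).
  by rewrite exprZn -qE DE scalerA exprVn mulVf ?scale1r ?expf_neq0.
exists x, (c^-1 *: y); split; first by rewrite scaler_eq0 negb_or invr_eq0 c0.
by rewrite -xy DE exprZn -scalerAl -scalerAr scalerA exprVn mulfV ?scale1r ?expf_neq0.
Qed.

Theorem theorem1p2 (R : realType) (D : {poly R[i]}) (d : nat)
    (d_gt0 : (0 < d)%N) (degD : (size D).-1 = (2 * d)%N)
    (D_nsquare : ~ is_square D)
    (sqrtD : laurent R[i]) (sqrtDE : sqrtD ^+ 2 = D%:L) :
  let bounded_degrees := exists N : nat, forall n : nat, (N <= n)%N ->
    (2 * (size (partial_quotient sqrtD n)).-1 <= d)%N in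
  (~ (exists r Dstar : {poly R[i]},
        [/\ D = r ^+ 2 * Dstar, Pellian Dstar &
            (3 * d < 2 * (size Dstar).-1)%N]) ->
   bounded_degrees) /\
  (squarefree D -> ~ Pellian D -> bounded_degrees).
Proof.
move=> bounded_degrees; have sD : size D = (2 * d).+1.
  by move: degD; case: (size D) => [|n] /= e; lia.
have main := @unbounded_pell _ sqrtD d D sqrtDE d_gt0 sD D_nsquare.
split=> [nex|sf nP]; apply: contrapT => /main.
  exact: nex.
by move=> [r [E [DE PE _]]]; apply: nP; apply: squarefree_Pellian sf DE PE.
Qed.
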